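(* Let $\alpha,\gamma\in(0,1]$, $b\ge0$, and let $M^\alpha_\gamma(t)=M(D_\gamma(t))+bD_\alpha(t)$, where $\{M(t)\}$ is a generalized counting process with positive rates $\lambda_1,\dots,\lambda_k$, $\Lambda=\lambda_1+\cdots+\lambda_k$, $D_\gamma,D_\alpha$ are stable subordinators, and all component processes are independent. Let $H(t)=\inf\{s\ge0:M^\alpha_\gamma(s)>t\}$, $t\ge0$. The density function $g(x,t)=\Pr\{H(t)\in\mathrm{d}x\}/\mathrm{d}x$ solves $$b^\alpha\frac{\mathrm{d}^\alpha}{\mathrm{d}t^\alpha}w(x,t)+\Big(\sum_{j=1}^k\lambda_j(I-T^j)\Big)^\gamma w(x,t)=-\frac{\partial}{\partial x}w(x,t),\qquad x>0,\ t>0,$$ with initial condition $w(x,0)=\delta(x)$ and boundary condition $$w(0,t)=\frac{-\gamma\Lambda^\gamma}{\Gamma(1-\gamma)}\sum_{n=0}^\infty\frac{\Gamma(n-\gamma)}{\Lambda^n}\sum_{n_1+n_2+\cdots+n_k=n}\Big(\prod_{j=1}^k\frac{\lambda_j^{n_j}}{n_j!}\Big)\mathcal{H}\big(t-(n_1+2n_2+\cdots+kn_k)\big).$$ Here $\mathcal{H}(\cdot)$ is the Heaviside step function, $T=e^{-\partial_t}$ if $b>0$ and $T=B$ if $b=0$ is the shift operator (in the variable $t$), and $\frac{\mathrm{d}^\alpha}{\mathrm{d}t^\alpha}$ is the Caputo fractional derivative.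
   Context: Generalized counting process (GCP): for $k\ge1$ and $\lambda_1,\dots,\lambda_k>0$, it is the non-negative integer valued Lévy process $\{M(t)\}_{t\ge0}$, $M(0)=0$, with $\Pr\{M(t+h)=n+j\mid M(t)=n\}=1-\Lambda h+o(h)$ for $j=0$, $=\lambda_jh+o(h)$ for $1\le j\le k$, $=o(h)$ for $j\ge k+1$, where $\Lambda=\sum_{j=1}^k\lambda_j$. Equivalently $\mathbb{E}(u^{M(t)})=\exp(-t\sum_{j=1}^k\lambda_j(1-u^j))$ for $|u|\le1$. Stable subordinator $\{D_\alpha(t)\}$, $0<\alpha<1$: non-decreasing Lévy process with $\mathbb{E}(e^{-sD_\alpha(t)})=e^{-ts^\alpha}$, $s>0$; $D_1(t)=t$. $\delta$ is the Dirac delta. The translation operator is $e^{y\partial_t}f(t)=f(t+y)$ and $B$ is the backward shift, so $(Tf)(t)=f(t-1)$ in both cases, with functions extended by $0$ to negative arguments. The fractional power is given by $(I-T)^\gamma=\sum_{r\ge0}(-1)^r\binom{\gamma}{r}T^r$ and correspondingly $$\Big(\sum_{j=1}^k\lambda_j(I-T^j)\Big)^\gamma=\Lambda^\gamma\sum_{r=0}^\infty(-1)^r\binom{\gamma}{r}\Big(\frac1\Lambda\sum_{j=1}^k\lambda_jT^j\Big)^r .$$ In the boundary condition the inner sum is over $(n_1,\dots,n_k)\in\mathbb{N}_0^k$ with the given sum; for $\gamma=1$ the coefficient $\Gamma(n-\gamma)/\Gamma(1-\gamma)$ is understood as the limit $\gamma\to1^-$. Caputo derivative: for $0<\alpha<1$,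 $\frac{\mathrm{d}^\alpha}{\mathrm{d}t^\alpha}f(t)=\frac{1}{\Gamma(1-\alpha)}\int_0^t(t-s)^{-\alpha}f'(s)\,\mathrm{d}s$, and $f'(t)$ for $\alpha=1$; its Laplace transform is $\eta^\alpha\tilde f(\eta)-\eta^{\alpha-1}f(0)$. The initial-boundary value problem is understood in the sense of Laplace transforms in $t$ (variable $\eta>0$) and $x$ (variable $\mu>0$): the Caputo derivative contributes $b^\alpha\eta^\alpha\tilde w(x,\eta)-b^\alpha\eta^{\alpha-1}w(x,0)$ with $w(x,0)=\delta(x)$ having $x$-Laplace transform $1$, and $\partial_xw$ has $x$-Laplace transform $\mu\tilde{\tilde w}(\mu,\eta)-\tilde w(0,\eta)$, where $\tilde w(0,\eta)$ is the Laplace transform of the prescribed boundary value $w(0,t)$. *)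

(* Defs.v *)
From HB Require Import structures.
From mathcomp Require Import all_boot all_order all_algebra.
From mathcomp Require Import all_classical all_reals all_analysis.

Set Implicit Arguments.
Unset Strict Implicit.
Unset Printing Implicit Defensive.

Import Order.TTheory GRing.Theory Num.Theory.
Import numFieldNormedType.Exports.

Local Open Scope classical_set_scope.
Local Open Scope ring_scope.

Definition quadrant {R : realType} : set (R * R) :=
  [set p | 0 <= p.1 /\ 0 <= p.2].

Section Processes.
Context {R : realType} {d : measure_display} {T : measurableType d}.
Variable P : probability T R.

(* A process is indexed by R; only its values at times t >= 0 matter. *)

Definition cadlag (X : R -> T -> R) : Prop :=
  forall w, (forall t, 0 <= t -> X s w @[s --> t^'+] --> X t w) /\
            (forall t, 0 < t -> cvg (X s w @[s --> t^'-])).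

Definition stationary_increments (X : R -> T -> R) : Prop :=
  forall t h, 0 <= t -> 0 <= h -> forall A : set R, measurable A ->
    P [set w | A (X (t + h) w - X t w)] = P [set w | A (X h w)].

Definition independent_increments (X : R -> T -> R) : Prop :=
  forall (n : nat) (t : nat -> R) (A : nat -> set R),
    0 <= t 0%N -> (forall i, (i < n)%N -> t i <= t i.+1) ->
    (forall i, (i < n)%N -> measurable (A i)) ->
    let E (i : nat) := [set w | A i (X (t i.+1) w - X (t i) w)] in
    P [set w | forall i, (i < n)%N -> E i w] = (\prod_(i < n) P (E i))%E.

(* Stochastic continuity is a consequence of right-continuity at 0 and
   stationarity of the increments. *)
Definition levy_process (X : R -> T -> R) : Prop :=
  [/\ forall t, 0 <= t -> measurable_fun setT (X t),
      forall w, X 0 w = 0,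
      stationary_increments X,
      independent_increments X &
      cadlag X].

Definition cond_prob (A B : set T) : R := fine (P (A `&` B)) / fine (P B).

Definition total_rate (k : nat) (lam : 'I_k -> R) : R := \sum_(j < k) lam j.

(* The index j : 'I_k, with values 0, ..., k-1, stands for a jump of size j.+1;
   so lam j is the rate called lambda_(j+1) on paper. *)
Definition generalized_counting_process (k : nat) (lam : 'I_k -> R)
    (M : R -> T -> nat) : Prop :=
  levy_process (fun t w => (M t w)%:R) /\
  forall (t : R) (n : nat), 0 <= t -> (0 < P [set w | M t w = n])%E ->
    let p (h : R) (j : nat) :=
      cond_prob [set w | M (t + h) w = (n + j)%N] [set w | M t w = n] in
    [/\ (p h 0%N - (1 - total_rate lam * h)) / h @[h --> 0^'+] --> 0,
        forall j : 'I_k, (p h j.+1 - lam j * h) / h @[h --> 0^'+] --> 0 &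
        forall j : nat, (k < j)%N -> p h j / h @[h --> 0^'+] --> 0].

Definition stable_subordinator (a : R) (D : R -> T -> R) : Prop :=
  (a < 1 ->
    [/\ levy_process D,
        forall w s t, 0 <= s -> s <= t -> D s w <= D t w &
        forall t s, 0 <= t -> 0 < s ->
          (\int[P]_w (expR (- (s * D t w))%R)%:E)%E = (expR (- (t * s `^ a)))%:E])
  /\ (a = 1 -> forall t w, 0 <= t -> D t w = t).

Definition process_sigma_algebra (X : R -> T -> R) : set (set T) :=
  <<s [set E | exists t (A : set R),
         [/\ 0 <= t, measurable A & E = X t @^-1` A] ] >>.

(* Mutual independence: since setT belongs to each sigma-algebra, the product
   rule for triples contains the one for pairs. *)
Definition independent_processes3 (X Y Z : R -> T -> R) : Prop :=
  forall A B C, process_sigma_algebra X A -> process_sigma_algebra Y B ->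
    process_sigma_algebra Z C ->
    P (A `&` B `&` C) = (P A * P B * P C)%E.

Definition time_changed_gcp (b : R) (M : R -> T -> nat) (Dg Da : R -> T -> R) :
    R -> T -> R :=
  fun t w => (M (Dg t w) w)%:R + b * Da t w.

(* inf is real-valued, with inf set0 = 0. *)
Definition first_passage (X : R -> T -> R) (t : R) (w : T) : R :=
  inf [set s | 0 <= s /\ t < X s w].

(* g x t is the value at x of a density of H t, which lives on [0, +oo[. *)
Definition is_density (H : R -> T -> R) (g : R -> R -> R) : Prop :=
  [/\ measurable_fun (@quadrant R) (fun p => g p.1 p.2),
      forall x t, 0 <= x -> 0 < t -> 0 <= g x t &
      forall t, 0 < t -> forall A : set R, measurable A ->
        P (H t @^-1` A) =
        (\int[lebesgue_measure]_(x in A `&` `[0%R, +oo[) (g x t)%:E)%E].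

End Processes.

Section FractionalOperator.
Context {R : realType}.
Implicit Types f : R -> R.

(* Both exp(-d/dt) and the backward shift B, for functions extended by 0 to
   negative arguments. *)
Definition unit_shift f (t : R) : R := if 1 <= t then f (t - 1) else 0.

Definition gbinom (a : R) (r : nat) : R :=
  (\prod_(i < r) (a - i%:R)) / (r`!)%:R.

Definition mean_shift (k : nat) (lam : 'I_k -> R) f (t : R) : R :=
  (total_rate lam)^-1 * \sum_(j < k) lam j * iter j.+1 unit_shift f t.

(* Since the r-th power of mean_shift involves only shifts by at least r, the
   series has finitely many nonzero terms at each t. *)
Definition frac_difference (k : nat) (lam : 'I_k -> R) (a : R) f (t : R) : R :=
  total_rate lam `^ a *
  limn (series (fun r => (-1) ^+ r * gbinom a r * iter r (mean_shift lam) f t)).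

End FractionalOperator.

Section BoundaryValue.
Context {R : realType}.

Definition euler_integral (z : R) : R :=
  \int[lebesgue_measure]_(x in `]0, +oo[) (x `^ (z - 1) * expR (- x)).

(* For z <= 0, the continuation of the Gamma function through
   Gamma (z + m) = z (z + 1) ... (z + m - 1) Gamma z. *)
Definition Gamma (z : R) : R :=
  if 0 < z then euler_integral z
  else let m := (Num.truncn `|z|).+1 in
       euler_integral (z + m%:R) / \prod_(i < m) (z + i%:R).

Definition Gamma_ratio (n : nat) (a : R) : R :=
  if a < 1 then Gamma (n%:R - a) / Gamma (1 - a)
  else lim (Gamma (n%:R - c) / Gamma (1 - c) @[c --> 1^'-]).

Definition heaviside (t : R) : R := if 0 <= t then 1 else 0.

(* The multi-indices of sum n have all their components at most n, hence the
   index type {ffun 'I_k -> 'I_n.+1}. The series is a finite sum at each t. *)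
Definition boundary_value (k : nat) (lam : 'I_k -> R) (a : R) (t : R) : R :=
  - a * total_rate lam `^ a *
  limn (series (fun n : nat =>
    Gamma_ratio n a / total_rate lam ^+ n *
    \sum_(m : {ffun 'I_k -> 'I_n.+1} | (\sum_(j < k) m j)%N == n)
      (\prod_(j < k) (lam j ^+ m j / ((m j)`!)%:R)) *
      heaviside (t - (\sum_(j < k) j.+1 * m j)%N%:R))).

End BoundaryValue.

Section LaplaceTransforms.
Context {R : realType}.
Notation leb := (@lebesgue_measure R).

Definition laplace (f : R -> R) (s : R) : R :=
  \int[leb]_(t in `[0, +oo[) (expR (- (s * t)) * f t).

Definition laplace_converges (f : R -> R) (s : R) : Prop :=
  leb.-integrable `[0, +oo[ (fun t => (expR (- (s * t)) * f t)%:E).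

Definition laplace2 (w : R -> R -> R) (mu eta : R) : R :=
  laplace (fun x => laplace (w x) eta) mu.

Definition laplace2_converges (w : R -> R -> R) (mu eta : R) : Prop :=
  (leb \x leb)%E.-integrable quadrant
    (fun p : R * R =>
       (expR (- (mu * p.1)) * expR (- (eta * p.2)) * w p.1 p.2)%:E).

Definition laplace_measure (m : set R -> \bar R) (mu : R) : R :=
  fine (\int[m]_(x in `[0%R, +oo[) (expR (- (mu * x))%R)%:E)%E.

(* Laplace images at s of the Caputo derivative of order a and of the ordinary
   derivative of a function with transform F at s and initial value f0. *)
Definition caputo_image (a s F f0 : R) : R := s `^ a * F - s `^ (a - 1) * f0.
Definition derivative_image (s F f0 : R) : R := s * F - f0.

(* The equation
     b^alpha (d/dt)^alpha w + (\sum_j lam_j (I - T^j))^gamma w = - dw/dx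
   with initial datum w(., 0) = init (a measure in x) and boundary datum
   w(0, .) = bdry, after Laplace transform in t and x. *)
Definition solves_ibvp (b alpha gamma : R) (k : nat) (lam : 'I_k -> R)
    (init : set R -> \bar R) (bdry : R -> R) (w : R -> R -> R) : Prop :=
  forall mu eta : R, 0 < mu -> 0 < eta ->
  let Lw := fun x => frac_difference lam gamma (w x) in
  [/\ laplace2_converges w mu eta,
      laplace2_converges Lw mu eta,
      laplace_converges bdry eta &
      b `^ alpha *
        caputo_image alpha eta (laplace2 w mu eta) (laplace_measure init mu)
      + laplace2 Lw mu eta
      = - derivative_image mu (laplace2 w mu eta) (laplace bdry eta)].

(* The same problem for a measure-valued unknown w t = w(dx, t). The difference
   operator acts in t only and is a finite linear combination at each t, so it
   commutes with the transform in x. *)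
Definition solves_ibvp_measure (b alpha gamma : R) (k : nat) (lam : 'I_k -> R)
    (init : set R -> \bar R) (bdry : R -> R) (w : R -> set R -> \bar R) : Prop :=
  forall mu eta : R, 0 < mu -> 0 < eta ->
  let wx := fun t => laplace_measure (w t) mu in
  let Lwx := frac_difference lam gamma wx in
  [/\ laplace_converges wx eta,
      laplace_converges Lwx eta,
      laplace_converges bdry eta &
      b `^ alpha *
        caputo_image alpha eta (laplace wx eta) (laplace_measure init mu)
      + laplace Lwx eta
      = - derivative_image mu (laplace wx eta) (laplace bdry eta)].

End LaplaceTransforms.

(* Main.v *)
(* Let X be the time-changed process and psi s its Laplace exponent, so that
   E (e^(- s X(x))) = e^(- x psi s); conditioning on the subordinators gives
   psi s = phi s ^ gamma + (b s) ^ alpha with phi s = \sum_j lam_j (1 - e^(- s j)).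
   Up to null sets X is nondecreasing, whence {H(t) < x} is contained in
   {t < X(x)} and {t < X(x)} in {H(t) <= x}; by Tonelli the double transform of
   the law of H is therefore psi eta / (eta (mu + psi eta)).
   The transform in t turns T into multiplication by e^(- eta), hence, by the
   binomial series (convergent in Laplace norm since its argument becomes
   1 - phi eta / Lambda < 1), the difference operator into multiplication by
   phi eta ^ gamma. The multinomial theorem identifies the boundary value with the
   difference operator applied to the Heaviside function, whose transform is
   phi eta ^ gamma / eta. What remains is an identity between rational functions. *)
Require Import Defs.
From HB Require Import structures.
From mathcomp Require Import all_boot all_order all_algebra.
From mathcomp Require Import all_classical all_reals all_analysis.
From mathcomp Require Import measurable_realfun.
From mathcomp Require Import ring lra.

Set Implicit Arguments.
Unset Strict Implicit.
Unset Printing Implicit Defensive.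

Import Order.TTheory GRing.Theory Num.Theory.
Import numFieldNormedType.Exports.

Local Open Scope classical_set_scope.
Local Open Scope ring_scope.

(** * The binomial series *)

(** The counting process is given by infinitesimal transition probabilities, so its exponent phi has
    to be derived: the mean of [e ^ (- s M t)] is multiplicative in t, and its right derivative at 0
    is squeezed out of the rates. Conditioning is done without conditional laws: a random time is
    rounded up to a grid, which leaves countably many fixed times, and right-continuity removes the
    rounding. Paths are monotone, and cross a given level, only almost surely, while [first_passage]
    is 0 on a path that never crosses; the pathwise comparison is therefore made outside a null set.
    On the analytic side everything takes place in the [L^1] norm with weight [e ^ (- s t)]: there
    [mean_shift] is a strict contraction, and binomial coefficients of an exponent in []0, 1]] are
    bounded by 1, so a geometric series dominates. For a density g the transform of [g x] may
    diverge for exceptional x, and a real-valued integral then reads 0; hence the identities are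
    proved for extended integrals first and transferred almost everywhere. *)

HB.lock Definition bcoef {R : realType} (a : R) (n : nat) : R := (-1) ^+ n * gbinom a n.

Section BinomialSeries.
Context {R : realType}.
Implicit Types (a x : R) (n : nat).

Lemma bcoefE a n : bcoef a n = (\prod_(i < n) (i%:R - a)) / (n`!)%:R.
Proof.
rewrite bcoef.unlock /gbinom mulrA; congr (_ / _).
rewrite (_ : (-1) ^+ n = \prod_(i < n) (-1)); last first.
  by rewrite prodr_const card_ord.
by rewrite -big_split; apply: eq_bigr => i _ /=; rewrite mulN1r opprB.
Qed.

Lemma bcoef0 a : bcoef a 0 = 1.
Proof. by rewrite bcoefE big_ord0 fact0 divr1. Qed.

Lemma bcoefS a n : n.+1%:R * bcoef a n.+1 = (n%:R - a) * bcoef a n.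
Proof.
rewrite !bcoefE big_ord_recr factS natrM /=.
have h1 : (n.+1%:R : R) != 0 by rewrite pnatr_eq0.
have h2 : ((n`!)%:R : R) != 0 by rewrite pnatr_eq0 -lt0n fact_gt0.
by field; rewrite h2 addrC natr1 h1.
Qed.

(** Write [c_n] for [bcoef a n]. Since [(n + 1) c_(n+1) = (n - a) c_n] and [|n - a| <= n] for n >=
    1, the numbers [n |c_n|] do not increase from n = 1 on, where the value is a. *)
Lemma norm_natr_bcoef_le1 a n : 0 <= a <= 1 -> `|n%:R * bcoef a n| <= 1.
Proof.
move=> /andP[a0 a1]; elim: n => [|n ih]; first by rewrite mul0r normr0.
rewrite bcoefS; case: n => [|n] in ih *.
  by rewrite bcoef0 mulr1 sub0r normrN ger0_norm.
apply: le_trans ih; rewrite !normrM ler_wpM2r//.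
have n1 : (1 : R) <= n.+1%:R by rewrite ler1n.
by rewrite ger0_norm ?ger0_norm //; lra.
Qed.

Lemma norm_bcoef_le1 a n : 0 <= a <= 1 -> `|bcoef a n| <= 1.
Proof.
case: n => [|n] ha; first by rewrite bcoef0 normr1.
apply: le_trans (norm_natr_bcoef_le1 n.+1 ha).
by rewrite [leRHS]normrM normr_nat ler_peMl// ler1n.
Qed.

(* The derivative of [(\sum_(i < n) bcoef a i * x ^ i) (1 - x) ^ (- a)]
   telescopes to the single term
   [- n * bcoef a n * x ^ (n - 1) * (1 - x) ^ (- a - 1)]. *)
Lemma bcoef_series_remainder a x n : 0 < a <= 1 -> 0 <= x -> x < 1 ->
  `|series (fun r => bcoef a r * x ^+ r) n.+1 * (1 - x) `^ (- a) - 1|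
    <= (1 - x) `^ (- a - 1) * x ^+ n.
Proof.
move=> /andP[a0 a1] x0 x1.
pose p : nat -> {poly R} := fun m => \sum_(i < m) bcoef a i *: 'X^i.
pose F (y : R) := (p n.+1).[y] * (1 - y) `^ (- a).
have pS m : p m.+1 = p m + bcoef a m *: 'X^m.
  by rewrite /p big_ord_recr.
have pE m y : (p m).[y] = series (fun r => bcoef a r * y ^+ r) m.
  rewrite /series /= big_mkord /p horner_sum; apply: eq_bigr => i _.
  by rewrite hornerZ hornerXn.
have dp m (y : R) : (1 - y) * (p m)^`().[y] + a * (p m).[y] =
    - (m%:R * bcoef a m * y ^+ m.-1).
  elim: m => [|m ih]; first by rewrite /p big_ord0 deriv0 !horner0; ring.
  rewrite pS derivD derivZ derivXn !hornerE mulrDr mulrDr addrACA ih.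
  have -> : m.+1%:R * bcoef a m.+1 * y ^+ m.+1.-1 =
    (m%:R - a) * bcoef a m * y ^+ m by rewrite bcoefS.
  rewrite !hornerMn !hornerXn -mulr_natr; case: m {ih} => [|m] /=.
    by rewrite expr0; ring.
  by rewrite exprS; ring.
have dF (y : R) : y < 1 -> is_derive y 1 F
   (- (n.+1%:R * bcoef a n.+1 * y ^+ n) * (1 - y) `^ (- a - 1)).
  move=> y1; have y10 : 0 < 1 - y by rewrite subr_gt0.
  have d1 : is_derive y 1 (fun y : R => 1 - y) (-1).
    rewrite (_ : (fun y : R => _) = (cst 1 : R -> R) - id)//.
    by apply: is_derive_eq; rewrite sub0r.
  have d2 : is_derive y 1 (fun y : R => (1 - y) `^ (- a))
     (-1 * (- a * (1 - y) `^ (- a - 1))).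
    have := @is_derive1_comp _ (fun z : R => z `^ (- a)) (fun y : R => 1 - y) y
       (- a * (1 - y) `^ (- a - 1)) (-1) (is_derive1_powR (- a) y10) d1.
    by rewrite mulrC.
  have d3 := is_deriveM (is_derive_poly (p n.+1) y) d2.
  apply: is_derive_eq d3 _.
  rewrite -(dp n.+1 y) /GRing.scale /=.
  have -> : (1 - y) `^ (- a) = (1 - y) * (1 - y) `^ (- a - 1).
    rewrite -[X in _ = X * _](@powRr1 _ (1 - y)) ?ltW// -powRD.
      by congr (_ `^ _); ring.
    by apply/implyP => _; rewrite gt_eqF.
  by ring.
have F0 : F 0 = 1.
  rewrite /F pE subr0 powR1 mulr1 /series /= big_nat_recl// expr0 mulr1 bcoef0.
  by rewrite big1 ?addr0// => i _; rewrite exprS mul0r mulr0.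
have cF : {within `[0, x], continuous F}.
  apply: derivable_within_continuous => y; rewrite in_itv/= => /andP[_ h].
  by have := dF y (le_lt_trans h x1); move/@ex_derive.
have dF' (y : R) : y \in `]0, x[ -> is_derive y 1 F
   (- (n.+1%:R * bcoef a n.+1 * y ^+ n) * (1 - y) `^ (- a - 1)).
  by rewrite in_itv/= => /andP[_ h]; apply: dF; exact: lt_trans h x1.
(* As [F 0 = 1], the remainder is [F' c * x] with c in [[0, x]]. The coefficient in [F' c] is at
   most 1 in absolute value, and both [c ^ n] and [(1 - c) ^ (- a - 1)] increase with c. *)
have [c + +] := MVT_segment x0 dF' cF.
rewrite F0 subr0 /F pE in_itv/= => /andP[c0 cx] ->.
have c1 := le_lt_trans cx x1.
rewrite !normrM normrN normrM (ger0_norm x0) (ger0_norm (powR_ge0 _ _)).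
rewrite (ger0_norm (exprn_ge0 _ c0)).
have hp : (1 - c) `^ (- a - 1) <= (1 - x) `^ (- a - 1).
  have -> : - a - 1 = - (a + 1) by ring.
  rewrite !powRN lef_pV2 ?posrE ?powR_gt0 ?subr_gt0//.
  by rewrite ge0_ler_powR ?nnegrE//; lra.
have hn := norm_natr_bcoef_le1 n.+1 (_ : 0 <= a <= 1).
have hc : c ^+ n <= x ^+ n by rewrite lerXn2r// nnegrE.
rewrite -[leRHS]mulr1; apply: ler_pM => //.
- by rewrite !mulr_ge0 ?powR_ge0 ?exprn_ge0.
- rewrite mulrC; apply: ler_pM => //; rewrite ?powR_ge0 ?mulr_ge0 ?exprn_ge0//.
  by rewrite -[leRHS]mul1r; apply: ler_pM; rewrite ?exprn_ge0 ?hn ?(ltW a0).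
- exact: ltW.
Qed.

(** After multiplication by [(1 - x) ^ (- a)] the limit to reach is 1, and the remainder bound is a
    constant times [x ^ n]. *)
Lemma cvg_bcoef_series a x : 0 < a <= 1 -> 0 <= x -> x < 1 ->
  series (fun r => bcoef a r * x ^+ r) @ \oo --> (1 - x) `^ a.
Proof.
move=> ha x0 x1; have y0 : 0 < 1 - x by rewrite subr_gt0.
set s := series _.
rewrite -(cvg_shiftS s).
suff h : (fun n => s n.+1 * (1 - x) `^ (- a)) @ \oo --> (1 : R).
  have -> : (fun n => s n.+1) =
      (fun n => s n.+1 * (1 - x) `^ (- a) * (1 - x) `^ a).
    by apply/funext => n; rewrite powRN divfK ?gt_eqF ?powR_gt0.
  by have := cvgM h (cvg_cst ((1 - x) `^ a)); rewrite mul1r; exact.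
apply/cvgrPdist_le => e e0.
have c1 : (fun n => (1 - x) `^ (- a - 1) * x ^+ n) @ \oo --> (0 : R).
  have h : (fun n => x ^+ n) @ \oo --> (0 : R) by apply: cvg_expr; rewrite ger0_norm.
  by have := cvgM (cvg_cst ((1 - x) `^ (- a - 1))) h; rewrite mulr0; exact.
move/cvgrPdist_le : c1 => /(_ e e0); apply: filterS => n.
rewrite sub0r normrN distrC; apply: le_trans.
by rewrite [leRHS]ger0_norm ?mulr_ge0 ?powR_ge0 ?exprn_ge0// bcoef_series_remainder.
Qed.

End BinomialSeries.

(** * Multinomial expansion through truncated exponentials *)

Section Multinomial.
Context {F : numFieldType} {A : comAlgType F}.

(** The exponential series of [x X], cut after degree n. Up to that degree a product of such
    polynomials is the exponential of the sum, by the binomial theorem. *)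
Let E n (x : A) : {poly A} := \poly_(i < n.+1) ((i`!)%:R^-1 *: x ^+ i).

Let coef_prodE n (s : seq A) i : (i <= n)%N ->
  (\prod_(x <- s) E n x)`_i = (i`!)%:R^-1 *: (\sum_(x <- s) x) ^+ i.
Proof.
elim: s i => [|x s ih] i lein.
  rewrite !big_nil coef1; case: i lein => [|i] _ /=.
    by rewrite expr0 fact0 invr1 scale1r.
  by rewrite expr0n scaler0.
rewrite !big_cons coefM addrC exprDn scaler_sumr; apply: eq_bigr => u _.
have leui : (u <= i)%N by rewrite -ltnS.
rewrite coef_poly ltnS (leq_trans leui lein) ih; last first.
  exact: leq_trans (leq_subr _ _) lein.
rewrite -scalerAl -scalerAr scalerA [x ^+ u * _]mulrC -(scaler_nat 'C(i, u)) scalerA.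
congr (_ *: _).
have h m : ((m`!)%:R : F) != 0 by rewrite pnatr_eq0 -lt0n fact_gt0.
have hb : ('C(i, u))%:R * (u`!)%:R * ((i - u)`!)%:R = (i`!)%:R :> F.
  by rewrite -!natrM -mulnA bin_fact.
by rewrite -hb; field; rewrite !h pnatr_eq0 -lt0n bin_gt0.
Qed.

(** Both sides are n! times the coefficient of [X ^ n] in the product of the [E n (a j)], computed
    by [coef_prodE] and by distributing the product over the sums. The truncation at degree n yields
    multi-indices with components at most n, as in [boundary_value]. *)
Lemma exprn_sum_multinomial (k : nat) (a : 'I_k -> A) n :
  (\sum_(j < k) a j) ^+ n = (n`!)%:R *:
    \sum_(m : {ffun 'I_k -> 'I_n.+1} | (\sum_(j < k) m j)%N == n)
      \prod_(j < k) ((m j)`!%:R^-1 *: a j ^+ m j).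
Proof.
have h : ((n`!)%:R : F) != 0 by rewrite pnatr_eq0 -lt0n fact_gt0.
apply: (scalerI (invr_neq0 h)). rewrite scalerA mulVf// scale1r.
have := @coef_prodE n [seq a j | j <- index_enum 'I_k] n (leqnn n).
rewrite !big_map => <-.
under eq_bigr do rewrite /E poly_def.
rewrite bigA_distr_bigA coef_sum [RHS]big_mkcond /=; apply: eq_bigr => m _.
have -> : \prod_(j < k) (((m j)`!%:R^-1 *: a j ^+ m j) *: 'X^(m j)) =
    (\prod_(j < k) ((m j)`!%:R^-1 *: a j ^+ m j)) *: 'X^(\sum_(j < k) m j)
    :> {poly A}.
  elim/big_rec3 : _ => [|j x y z _ ->]; first by rewrite expr0 scale1r.
  by rewrite exprD -scalerAl -scalerAr scalerA.
by rewrite coefZ coefXn eq_sym; case: ifP => _; rewrite ?mulr1 ?mulr0.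
Qed.

End Multinomial.

(** * Step functions as images of polynomials *)

Section Heaviside.
Context {R : realType}.
Implicit Types (p q : {poly R}) (t : R).

(** The linear map sending [X ^ i] to the unit step at i. Multiplication by X becomes the unit
    shift, so powers of shift operators can be computed in a polynomial ring. *)
Let stairs p t : R := \sum_(i < size p) p`_i * heaviside (t - i%:R).

Let stairsE n p t : (size p <= n)%N ->
  stairs p t = \sum_(i < n) p`_i * heaviside (t - i%:R).
Proof.
move=> h; rewrite /stairs (big_ord_widen n (fun i => p`_i * heaviside (t - i%:R))) //.
rewrite big_mkcond; apply: eq_bigr => i _; case: ltnP => // hi.
by rewrite nth_default ?mul0r.
Qed.

Let stairsD p q t : stairs (p + q) t = stairs p t + stairs q t.
Proof.
pose n := maxn (size p) (size q).
rewrite (@stairsE n) ?size_polyD// (@stairsE n p) ?leq_maxl//.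
rewrite (@stairsE n q) ?leq_maxr// -big_split; apply: eq_bigr => i _.
by rewrite coefD mulrDl.
Qed.

Let stairsZ c p t : stairs (c *: p) t = c * stairs p t.
Proof.
rewrite (@stairsE (size p)) ?size_scale_leq// /stairs mulr_sumr.
by apply: eq_bigr => i _; rewrite coefZ mulrA.
Qed.

Let stairs0 t : stairs 0 t = 0.
Proof. by rewrite /stairs size_poly0 big_ord0. Qed.

Let stairs_sum I (r : seq I) (P : pred I) (f : I -> {poly R}) t :
  stairs (\sum_(i <- r | P i) f i) t = \sum_(i <- r | P i) stairs (f i) t.
Proof. by apply: (big_morph (stairs^~ t)) => [p q|]; [exact: stairsD|exact: stairs0]. Qed.

Let stairsXn n t : stairs 'X^n t = heaviside (t - n%:R).
Proof.
rewrite (@stairsE n.+1) ?size_polyXn// big_ord_recr /= coefXn eqxx mul1r.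
rewrite big1 ?add0r// => i _; rewrite coefXn (_ : (_ == _) = false) ?mul0r//.
by rewrite ltn_eqF.
Qed.

Let stairsX p t : stairs ('X * p) t = unit_shift (stairs p) t.
Proof.
rewrite (@stairsE (size p).+1); last first.
  rewrite mulrC; have [->|p0] := eqVneq p 0; first by rewrite mul0r size_poly0.
  by rewrite size_mulX.
rewrite big_ord_recl coefXM mul0r add0r /=.
under eq_bigr => i _ do rewrite coefXM /=.
rewrite /unit_shift; case: ifPn => t1.
  apply: eq_bigr => i _; congr (_ * heaviside _).
  by rewrite /bump/= add1n -natr1 opprD addrA addrAC.
rewrite big1// => i _; rewrite /heaviside /bump/= add1n ifF ?mulr0//.
apply/negbTE; move: t1; rewrite -!ltNge -natr1 => t1.
by have : (0 : R) <= i%:R by []; lra.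
Qed.

Let stairsXnM n p t : stairs ('X^n * p) t = iter n unit_shift (stairs p) t.
Proof.
elim: n t => [|n ih] t /=; first by rewrite expr0 mul1r.
rewrite exprS -mulrA stairsX; congr (unit_shift _ t); apply/funext => u.
exact: ih.
Qed.

(** Under [stairs] the operator [mean_shift] is multiplication by [q / Lambda], with q the
    polynomial of the rates, so its n-th power is read off from the expansion of [q ^ n]. *)
Lemma iter_mean_shift_heaviside (k : nat) (lam : 'I_k -> R) n t :
  iter n (mean_shift lam) heaviside t =
  (n`!)%:R / total_rate lam ^+ n *
    \sum_(m : {ffun 'I_k -> 'I_n.+1} | (\sum_(j < k) m j)%N == n)
      (\prod_(j < k) (lam j ^+ m j / ((m j)`!)%:R)) *
      heaviside (t - (\sum_(j < k) j.+1 * m j)%N%:R).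
Proof.
pose q : {poly R} := \sum_(j < k) lam j *: 'X^(j.+1).
have iterE i : iter i (mean_shift lam) heaviside =
    fun u => (total_rate lam ^+ i)^-1 * stairs (q ^+ i) u.
  elim: i => [|i ih] /=; apply/funext => u.
    by have := stairsXn 0 u; rewrite !expr0 invr1 mul1r subr0 => ->.
  rewrite ih /mean_shift exprS invfM -mulrA; congr (_ * _).
  rewrite [q ^+ i.+1]exprS mulr_suml stairs_sum mulr_sumr.
  apply: eq_bigr => j _.
  rewrite -scalerAl stairsZ stairsXnM [RHS]mulrCA; congr (_ * _).
  (* Iterated shifts commute with a constant factor; for arguments below 1 both sides are 0. *)
  elim: j.+1 u => [//|m ihm] u /=.
  by rewrite {1 3}/unit_shift; case: ifP => _; rewrite ?mulr0 // ihm.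
rewrite iterE mulrC [RHS]mulrAC; congr (_ * _).
rewrite exprn_sum_multinomial stairsZ stairs_sum; congr (_ * _).
apply: eq_bigr => m _.
have -> : \prod_(j < k) ((m j)`!%:R^-1 *: (lam j *: 'X^(j.+1)) ^+ m j) =
   (\prod_(j < k) (lam j ^+ m j / ((m j)`!)%:R)) *: 'X^(\sum_(j < k) j.+1 * m j)
   :> {poly R}.
  elim/big_rec3 : _ => [|j x y z _ ->]; first by rewrite expr0 scale1r.
  rewrite exprD exprZn -exprM -!scalerAl -scalerAr !scalerA; congr (_ *: _).
  by rewrite [in LHS](mulrC _^-1).
by rewrite stairsZ stairsXn.
Qed.

End Heaviside.

(** * Exponential and Euler integrals *)

Lemma ge0_integralZl_fun d (T : measurableType d) (R : realType)
    (mu : {measure set T -> \bar R}) (D : set T) (f : T -> R) (c : R) :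
  measurable D -> measurable_fun D f -> (forall x, D x -> 0 <= f x) -> 0 <= c ->
  (\int[mu]_(x in D) (c * f x)%R%:E = c%:E * \int[mu]_(x in D) (f x)%:E)%E.
Proof.
move=> mD mf f0 c0; rewrite -(@ge0_integralZl_EFin _ _ _ mu D mD (EFin \o f))//.
exact/measurable_EFinP.
Qed.

Section RealIntegrals.
Context {R : realType}.
Notation leb := (@lebesgue_measure R).

Lemma is_derive_expRN (r x : R) :
  is_derive x 1 (fun y : R => expR (- (r * y))) (- r * expR (- (r * x))).
Proof.
rewrite (_ : (fun y : R => _) = expR \o ( *%R (- r))); last first.
  by apply/funext => y /=; rewrite mulNr.
have d : is_derive x 1 ( *%R (- r)) (- r).
  rewrite (_ : *%R (- r) = (fun y : R => - r *: y)) //.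
  by apply: is_derive_eq; rewrite /GRing.scale /= mulr1.
apply: is_derive_eq (is_derive1_comp (is_derive_expR (- r * x)) d) _.
by rewrite mulrC -(mulNr r x).
Qed.

Lemma continuous_expRN (r : R) : continuous (fun y : R => expR (- (r * y))).
Proof.
move=> x; apply/differentiable_continuous/derivable1_diffP.
have := is_derive_expRN r x; by move/@ex_derive.
Qed.

Lemma measurable_expRN (r : R) D : measurable_fun D (fun y : R => expR (- (r * y))).
Proof.
apply: measurable_funTS; apply: continuous_measurable_fun; exact: continuous_expRN.
Qed.

Lemma measurable_expN (D : set R) : measurable_fun D (fun y : R => expR (- y)).
Proof.
rewrite (_ : (fun y : R => _) = fun y => expR (- (1 * y))).
  exact: measurable_expRN.
by apply/funext => y; rewrite mul1r.
Qed.
Arguments measurable_expN : clear implicits.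

Lemma integral_expRN (r a : R) : 0 < r ->
  (\int[leb]_(y in `[a, +oo[) (r * expR (- (r * y)))%:E = (expR (- (r * a)))%:E)%E.
Proof.
move=> r0; rewrite (@ge0_continuous_FTC2y _ _ (fun y => - expR (- (r * y))) a 0).
- by rewrite sub0e -EFinN opprK.
- by move=> x _; rewrite mulr_ge0 ?expR_ge0 ?ltW.
- apply: continuous_subspaceT => x; apply: cvgM; first exact: cvg_cst.
  exact: continuous_expRN.
- rewrite -oppr0; apply: cvgN.
  rewrite (_ : (fun y => _) = (fun z => expR (- z)) \o (fun z => r * z))//.
  apply: (@cvg_comp _ _ _ _ _ _ (pinfty_nbhs R)); last exact: cvgr_expR.
  exact: gt0_cvgMry.
- move=> x _; apply: derivableN; have := is_derive_expRN r x.
  by move/@ex_derive.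
- by apply: cvg_at_right_filter; apply: cvgN; exact: continuous_expRN.
- move=> x _; rewrite derive1E deriveN; last first.
    by have := is_derive_expRN r x; move/@ex_derive.
  have := is_derive_expRN r x; move/@derive_val => ->.
  by rewrite mulNr opprK.
Qed.

(** For z < 1 the integrand blows up at 0, so the fundamental theorem of calculus is applied on
    [[e n, y]], and these intervals grow to []0, y]]. *)
Lemma integral_powR0 (z y : R) : 0 < z -> 0 < y ->
  (\int[leb]_(x in `]0%R, y]) (x `^ (z - 1))%R%:E = (y `^ z / z)%R%:E)%E.
Proof.
move=> z0 y0.
(* The denominators start at 2, so that [e n < y] also for n = 0. *)
pose e n : R := y / n.+2%:R.
have e0 n : 0 < e n by rewrite divr_gt0.
have ey n : e n < y by rewrite ltr_pdivrMr// ltr_pMr// ltr1n.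
have U : \bigcup_n `[e n, y]%classic = `]0, y]%classic.
  apply/seteqP; split => x /=.
    by move=> [n _] /=; rewrite !in_itv/= => /andP[h ->]; rewrite (lt_le_trans (e0 n)).
  rewrite in_itv/= => /andP[x0 xy].
  exists (Num.truncn (y / x)) => //=; rewrite in_itv/= xy andbT.
  rewrite ler_pdivrMr// mulrC -ler_pdivrMr//.
  have /andP[_ /ltW h] := @truncn_itv _ (y / x) (divr_ge0 (ltW y0) (ltW x0)).
  by apply: le_trans h _; rewrite ler_nat.
have lim1 : (\int[leb]_(x in `[e n, y]) (x `^ (z - 1))%R%:E @[n --> \oo] -->
    \int[leb]_(x in \bigcup_n `[e n, y]%classic) (x `^ (z - 1))%R%:E)%E.
  apply: ge0_nondecreasing_set_cvg_integral => //=.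
  - apply/nondecreasing_seqP => n; rewrite subsetEset => x /=.
    rewrite !in_itv/= => /andP[h ->]; rewrite andbT (le_trans _ h)//.
    by rewrite ler_pM2l// lef_pV2 ?posrE// ler_nat.
  - by move=> n; apply/measurable_EFinP; apply: measurable_funTS.
  - by move=> n x _; rewrite lee_fin powR_ge0.
have dF (x : R) : 0 < x -> is_derive x 1 (fun x => x `^ z / z : R) (x `^ (z - 1)).
  move=> x0; rewrite (_ : (fun x => _) = z^-1 *: (fun x => x `^ z)); last first.
    by apply/funext => u; rewrite mulrC.
  have := @is_deriveZ _ _ _ (fun x => x `^ z) z^-1 x 1 _ (is_derive1_powR z x0).
  by move=> h; apply: is_derive_eq h _; rewrite /GRing.scale /= mulKf ?gt_eqF.
have cont (r u : R) : 0 < u -> {for u, continuous (fun x : R => x `^ r)}.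
  move=> u0; apply/differentiable_continuous/derivable1_diffP.
  by have := is_derive1_powR r u0; move/@ex_derive.
have FTC n : (\int[leb]_(x in `[e n, y]) (x `^ (z - 1))%R%:E =
    (y `^ z / z - e n `^ z / z)%R%:E)%E.
  rewrite (@continuous_FTC2 _ _ (fun x => x `^ z / z)) ?EFinB//.
  - apply: continuous_in_subspaceT => x; rewrite inE/= in_itv/= => /andP[h _].
    by apply: cont; exact: lt_le_trans h.
  - split.
    + move=> x; rewrite in_itv/= => /andP[h _].
      by have := dF x (lt_trans (e0 n) h); move/@ex_derive.
    + apply: cvg_at_right_filter; apply: cvgM; last exact: cvg_cst.
      exact: cont.
    + apply: cvg_at_left_filter; apply: cvgM; last exact: cvg_cst.
      exact: cont.
  - move=> x; rewrite in_itv/= => /andP[h _]; rewrite derive1E.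
    by have := dF x (lt_trans (e0 n) h); move/@derive_val.
rewrite -U -(cvg_lim _ lim1)//; apply/cvg_lim => //.
under eq_fun do rewrite FTC.
apply: cvg_EFin; first exact: nearW.
rewrite (_ : fine \o _ = fun n => y `^ z / z - e n `^ z / z)//.
rewrite -[X in _ --> X]subr0; apply: cvgB; first exact: cvg_cst.
rewrite -(mul0r z^-1); apply: cvgM; last exact: cvg_cst.
have ce : e @ \oo --> 0.
  rewrite -(mulr0 y); apply: cvgM; first exact: cvg_cst.
  by have := @cvg_harmonic R; rewrite -cvg_shiftS.
by have /cvg_at_rightP := powR_cvg0 z0; apply; split.
Qed.



Let euler_density (z x : R) : R := x `^ (z - 1) * expR (- x).

Let measurable_euler_density z D : measurable_fun D (euler_density z).
Proof.
apply: measurable_funTS; apply: measurable_funM => //.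
exact: measurable_expN.
Qed.

Let euler_density_ge0 z x : 0 <= euler_density z x.
Proof. by rewrite mulr_ge0 ?powR_ge0 ?expR_ge0. Qed.

(** Tonelli takes the place of integration by parts: on the region [0 < x <= y] the function
    [x ^ (z - 1) e ^ (- y)] integrates in y to the density at z, and in x to [1 / z] times the
    density at z + 1. The identity holds before any finiteness is known. *)
Let euler_recE (z : R) : 0 < z ->
  (\int[leb]_(x in `]0%R, +oo[) (euler_density (z + 1) x)%:E =
   z%:E * \int[leb]_(x in `]0%R, +oo[) (euler_density z x)%:E)%E.
Proof.
move=> z0.
pose f (p : R * R) : \bar R :=
  (if (0 < p.1) && (p.1 <= p.2) then p.1 `^ (z - 1) * expR (- p.2) else 0)%:E.
have mf : measurable_fun setT f.
  apply/measurable_EFinP; apply: measurable_fun_ifT => //.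
  - refine (measurable_and (@measurable_fun_ltr _ _ _ _ (fun=> 0) fst _ _)
      (@measurable_fun_ler _ _ _ _ fst snd _ _)) => //.
  - apply: measurable_funM; first by apply: (measurableT_comp (measurable_powR _)).
    by apply: (measurableT_comp (measurable_expN setT)).
have f0 p : (0 <= f p)%E.
  by rewrite lee_fin; case: ifP => // _; rewrite mulr_ge0 ?powR_ge0 ?expR_ge0.
have tonelli := @fubini_tonelli _ _ _ _ R leb leb f mf f0.
have e1 x : fubini_F leb f x = ((fun x => (euler_density z x)%:E) \_ `]0%R, +oo[) x.
  rewrite /fubini_F patchE mem_setE in_itv/= andbT.
  case: ifPn => x0; last first.
    by apply: integral0_eq => y _; rewrite /f /= (negbTE x0).
  rewrite /euler_density.
  have := integral_expRN x (@ltr01 R); rewrite mul1r EFinM => <-.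
  rewrite -(@ge0_integralZl_fun _ _ _ leb `[x, +oo[%classic
    (fun y => 1 * expR (- (1 * y))) (x `^ (z - 1))); last 4 first.
  - exact: measurable_itv.
  - apply: measurable_funM; [exact: measurable_cst|exact: measurable_expRN].
  - by move=> y _; rewrite mul1r expR_ge0.
  - exact: powR_ge0.
  rewrite [RHS]integral_mkcond; apply: eq_integral => y _.
  rewrite patchE mem_setE in_itv/= andbT /f /= x0 /=; case: ifP => [_|//].
  by rewrite !mul1r.
have e2 y : fubini_G leb f y =
    ((fun y => (z^-1 * euler_density (z + 1) y)%:E) \_ `]0%R, +oo[) y.
  rewrite /fubini_G patchE mem_setE in_itv/= andbT.
  case: ifPn => y0; last first.
    apply: integral0_eq => x _; rewrite /f /=; case: ifP => [/andP[x0 xy]|//].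
    by rewrite (lt_le_trans x0 xy) in y0.
  rewrite /euler_density addrK mulrA (mulrC z^-1) EFinM -(integral_powR0 z0 y0).
  rewrite muleC -(@ge0_integralZl_fun _ _ _ leb `]0, y]%classic
    (fun x => x `^ (z - 1)) (expR (- y))); last 4 first.
  - exact: measurable_itv.
  - exact: measurable_funTS.
  - by move=> x _; exact: powR_ge0.
  - exact: expR_ge0.
  rewrite [RHS]integral_mkcond; apply: eq_integral => x _.
  rewrite patchE mem_setE in_itv/= /f /=; case: ifP => [_|//].
  by rewrite mulrC.
have -> : (\int[leb]_(x in `]0%R, +oo[) (euler_density z x)%:E =
    \int[leb]_(y in `]0%R, +oo[) (z^-1 * euler_density (z + 1) y)%:E)%E.
  rewrite [LHS]integral_mkcond [RHS]integral_mkcond.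
  transitivity (\int[leb]_x fubini_F leb f x)%E.
    by apply: eq_integral => x _; rewrite e1.
  rewrite [LHS]tonelli; apply: eq_integral => y _.
  by rewrite -e2.
rewrite ge0_integralZl_fun; last 4 first.
- exact: measurable_itv.
- exact: measurable_euler_density.
- by move=> x _; exact: euler_density_ge0.
- by rewrite invr_ge0 ltW.
rewrite muleA -EFinM divff; last by rewrite gt_eqF.
by rewrite mul1e.
Qed.

(** On []0, 1]] the density lies between [e ^ (- 1) x ^ (z - 1)] and [x ^ (z - 1)]; on []1, +oo[] it
    is at most [e ^ (- x)], because z <= 1. The argument 1 - c of the Gamma ratio falls in this
    range. *)
Let euler_fin (z : R) : 0 < z -> z <= 1 ->
  (0 < \int[leb]_(x in `]0%R, +oo[) (euler_density z x)%:E < +oo)%E.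
Proof.
move=> z0 z1.
have -> : `]0%R, +oo[%classic = `]0%R, 1%R] `|` `]1%R, +oo[ :> set R.
  by rewrite -itv_bndbnd_setU// bnd_simp.
have mE D : measurable_fun D (fun x => (euler_density z x)%:E).
  exact/measurable_EFinP.
have E0 x : (0 <= (euler_density z x)%:E)%E by rewrite lee_fin.
rewrite ge0_integral_setU; first last.
- rewrite disj_set2E; apply/eqP/seteqP; split => // x /=.
  by rewrite !in_itv/= andbT => -[/andP[_ h]]; rewrite ltNge h.
- by move=> x _; exact: E0.
- exact: mE.
- exact: measurable_itv.
- exact: measurable_itv.
apply/andP; split.
  apply: (@lt_le_trans _ _ (\int[leb]_(x in `]0%R, 1%R]) (euler_density z x)%:E)%E); last first.
    by rewrite leeDl ?integral_ge0.
  apply: (@lt_le_trans _ _ ((expR (- 1))%:E * (1 `^ z / z)%R%:E)%E).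
    by rewrite -EFinM lte_fin mulr_gt0 ?expR_gt0// powR1 mul1r invr_gt0.
  rewrite -(integral_powR0 z0 ltr01) -(@ge0_integralZl_fun _ _ _ leb `]0, 1]%classic
    (fun x => x `^ (z - 1)) (expR (- 1))); last 4 first.
  - exact: measurable_itv.
  - exact: measurable_funTS.
  - by move=> x _; exact: powR_ge0.
  - exact: expR_ge0.
  apply: ge0_le_integral.
  - exact: measurable_itv.
  - by move=> x _; rewrite lee_fin mulr_ge0 ?expR_ge0 ?powR_ge0.
  - apply/measurable_EFinP; apply: measurable_funM; first exact: measurable_cst.
    exact: measurable_funTS.
  - exact: mE.
  - move=> x /=; rewrite in_itv/= => /andP[x0 x1].
    rewrite lee_fin /euler_density mulrC ler_wpM2l ?powR_ge0//.
    by rewrite ler_expR lerN2.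
apply: (@le_lt_trans _ _ ((1 `^ z / z)%R%:E + (expR (- (1 * 1)))%R%:E)%E); last first.
  by rewrite -EFinD ltry.
rewrite -(integral_powR0 z0 ltr01) -(integral_expRN 1 ltr01); apply: leeD.
  apply: ge0_le_integral.
  - exact: measurable_itv.
  - by move=> x _; exact: E0.
  - exact: mE.
  - by apply/measurable_EFinP; apply: measurable_funTS.
  - move=> x /=; rewrite in_itv/= => /andP[x0 x1].
    rewrite lee_fin /euler_density -[leRHS]mulr1 ler_wpM2l ?powR_ge0//.
    by rewrite -expR0 ler_expR oppr_le0 ltW.
rewrite -[leRHS]integral_itv_obnd_cbnd; last first.
  apply/measurable_EFinP; apply: measurable_funM; [exact: measurable_cst|exact: measurable_expRN].
apply: ge0_le_integral.
- exact: measurable_itv.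
- by move=> x _; exact: E0.
- exact: mE.
- apply/measurable_EFinP; apply: measurable_funM; [exact: measurable_cst|exact: measurable_expRN].
- move=> x /=; rewrite in_itv/= andbT => x1.
  rewrite lee_fin /euler_density !mul1r -[leRHS]mul1r ler_wpM2r ?expR_ge0//.
  rewrite -[leRHS](powRr0 x) ler_powR ?(ltW x1)//.
  by rewrite subr_le0.
Qed.

Lemma euler_integral_gt0 (z : R) : 0 < z -> z <= 1 -> 0 < euler_integral z.
Proof. by move=> z0 z1; apply: fine_gt0; exact: euler_fin. Qed.

Lemma euler_integralD1 (z : R) : 0 < z ->
  euler_integral (z + 1) = z * euler_integral z.
Proof.
move=> z0; rewrite /euler_integral /Rintegral; have /= -> := euler_recE z0.
(* An infinite integral is harmless here: [fine] sends both sides to 0. *)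
case: (integral _ _ _) => [r| |] /=; rewrite ?mulr0//.
- by rewrite gt0_muley ?lte_fin.
- by rewrite gt0_muleNy ?lte_fin.
Qed.

(** The functional equation makes both Gamma values rational multiples of Euler's integral at 1 - c,
    which cancels in the ratio. *)
Lemma Gamma_ratioE (a : R) n : 0 < a <= 1 ->
  - a * Gamma_ratio n a = \prod_(i < n) (i%:R - a).
Proof.
have ratio (c : R) : 0 < c < 1 ->
    Gamma (n%:R - c) / Gamma (1 - c) = \prod_(i < n) (i%:R - c) / - c.
  move=> /andP[c0 c1].
  have E0 : euler_integral (1 - c) != 0.
    by rewrite gt_eqF// euler_integral_gt0; lra.
  have GE m : Gamma (m.+1%:R - c) = \prod_(i < m) (i.+1%:R - c) * euler_integral (1 - c).
    have pos i : 0 < i.+1%:R - c by rewrite subr_gt0 (lt_le_trans c1)// ler1n.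
    rewrite /Gamma pos; elim: m => [|m ih]; first by rewrite big_ord0 mul1r.
    have -> : m.+2%:R - c = m.+1%:R - c + 1 by rewrite -natr1 addrAC.
    rewrite big_ord_recr /=.
    rewrite (euler_integralD1 (pos m)) ih mulrA.
    by rewrite (mulrC (_ - _)).
  have -> : Gamma (1 - c) = euler_integral (1 - c).
    by have := GE 0%N; rewrite big_ord0 mul1r.
  case: n => [|m].
    (* For n = 0 the continuation of Gamma enters: since [0 < c < 1], the truncation of c is 0 and
       [Gamma (- c)] involves the single factor - c. *)
    rewrite big_ord0 sub0r /Gamma ltNge oppr_le0 ltW//= normrN ger0_norm ?ltW//.
    have -> : Num.truncn c = 0%N.
      by apply/eqP; rewrite truncn_eq ?ltW// lerr; lra.
    rewrite big_ord1 addr0 addrC; field.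
    by rewrite E0 ?oppr_eq0 gt_eqF.
  rewrite GE big_ord_recl /= sub0r.
  by field; rewrite E0 ?oppr_eq0 gt_eqF.
move=> /andP[a0 a1]; rewrite /Gamma_ratio.
have na0 : - a != 0 by rewrite oppr_eq0 gt_eqF.
have [a1'|a1'] := ltP a 1.
  by rewrite ratio ?a0// mulrC divfK.
have {a1 a1' a0 na0} -> : a = 1 by apply/eqP; rewrite eq_le a1.
suff -> : lim (Gamma (n%:R - c) / Gamma (1 - c) @[c --> 1^'-]) =
    \prod_(i < n) (i%:R - 1) / - 1 :> R.
  by rewrite mulrC divfK// oppr_eq0 oner_eq0.
apply/cvg_lim => //.
(* Left of 1 the ratio coincides with a rational function of c that is continuous at 1, although
   [Gamma (1 - c)] itself has no finite limit. *)
apply: (@cvg_trans _ ((\prod_(i < n) (i%:R - c) / - c : R) @[c --> 1^'-])).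
  apply: near_eq_cvg; near=> c; rewrite ratio//; apply/andP; split.
    near: c; exact: nbhs_left_gt.
  near: c; exact: nbhs_left_lt.
apply: cvg_at_left_filter; apply: cvgM.
  elim: n {ratio} => [|m ih].
    by under eq_fun do rewrite big_ord0; rewrite big_ord0; exact: cvg_cst.
  under eq_fun do rewrite big_ord_recr/=; rewrite big_ord_recr/=.
  by apply: cvgM => //; apply: cvgB; [exact: cvg_cst|exact: cvg_id].
apply: cvgV; first by rewrite oppr_eq0 oner_eq0.
by apply: cvgN; exact: cvg_id.
Unshelve. all: by end_near. Qed.


End RealIntegrals.

(** * Laplace transform of the fractional difference *)

HB.lock Definition lweight {R : realType} (s t : R) : R := expR (- (s * t)).

Section Weight.
Context {R : realType}.
Notation leb := (@lebesgue_measure R).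
Notation H := (`[(0%R : R), +oo[%classic).
Implicit Types (s t : R) (f g : R -> R).

Lemma lweight_gt0 s t : 0 < lweight s t.
Proof. by rewrite lweight.unlock expR_gt0. Qed.

Lemma lweight_ge0 s t : 0 <= lweight s t.
Proof. exact/ltW/lweight_gt0. Qed.

Lemma lweightD s t u : lweight s (t + u) = lweight s t * lweight s u.
Proof. by rewrite lweight.unlock mulrDr opprD expRD. Qed.

Lemma measurable_lweight s (D : set R) : measurable_fun D (lweight s).
Proof. by rewrite lweight.unlock; exact: measurable_expRN. Qed.

Lemma lweight_lt1 s t : 0 < s -> 0 < t -> lweight s t < 1.
Proof.
by move=> s0 t0; rewrite lweight.unlock -expR0 ltr_expR oppr_lt0 mulr_gt0.
Qed.

Lemma laplaceE f s : laplace f s =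
  fine (\int[leb]_(t in H) (lweight s t * f t)%:E)%E.
Proof. by rewrite /laplace lweight.unlock. Qed.

Lemma laplace_convergesE f s : laplace_converges f s =
  leb.-integrable H (fun t => (lweight s t * f t)%:E).
Proof. by rewrite /laplace_converges lweight.unlock. Qed.

(** The norm of [L^1] with weight [e ^ (- s t)], kept in the extended reals so that estimates can
    precede convergence. *)
Definition laplace_norm s f : \bar R :=
  (\int[leb]_(t in H) (lweight s t * `|f t|)%:E)%E.

Lemma measurable_lweightM s f (D : set R) :
  measurable_fun D f -> measurable_fun D (fun t => lweight s t * f t).
Proof. by move=> mf; apply: measurable_funM => //; exact: measurable_lweight. Qed.

Lemma laplace_convergesP f s :
  laplace_converges f s <-> measurable_fun H f /\ (laplace_norm s f < +oo)%E.
Proof.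
rewrite laplace_convergesE /laplace_norm; split.
  move=> /integrableP[mf fi]; split.
    rewrite (_ : f = fun t => (lweight s t)^-1 * (lweight s t * f t)); last first.
      by apply/funext => t; rewrite mulKf// gt_eqF ?lweight_gt0.
    apply: measurable_funM; last exact/measurable_EFinP.
    rewrite (_ : (fun t => _) = lweight (- s)); first exact: measurable_lweight.
    by apply/funext => t; rewrite lweight.unlock mulNr -expRN.
  apply: le_lt_trans fi; rewrite le_eqVlt; apply/orP; left; apply/eqP.
  apply: eq_integral => t _ /=.
  by rewrite normrM (ger0_norm (lweight_ge0 _ _)).
move=> [mf fi]; apply/integrableP; split.
  by apply/measurable_EFinP; exact: measurable_lweightM.
apply: le_lt_trans fi; rewrite le_eqVlt; apply/orP; left; apply/eqP.
apply: eq_integral => t _ /=.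
by rewrite normrM (ger0_norm (lweight_ge0 _ _)).
Qed.

(** Lebesgue measure is determined by its values on half-open intervals, and a translation preserves
    their lengths. *)
Lemma lebesgue_measure_shift (c : R) (A : set R) : measurable A ->
  pushforward leb (fun x : measurableTypeR R => x - c : measurableTypeR R) A = leb A.
Proof.
have mc : measurable_fun setT (fun x : measurableTypeR R => x - c : measurableTypeR R).
  by apply: measurable_funB => //.
move=> mA; apply/esym.
pose m := pushforward leb (fun x : measurableTypeR R => x - c : measurableTypeR R).
apply: (@lebesgue_measure_unique R m) => //= _ [[a b]] _ <-.
rewrite /m /pushforward (_ : _ @^-1` _ = `]a + c, b + c]%classic); last first.
  by apply/seteqP; split => x /=; rewrite !in_itv/= ltrBrDr lerBlDr.
rewrite !lebesgue_measure_itv/= !lte_fin ltrD2r; case: ifP => // _.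
by rewrite -!EFinD (addrC a) addrKA.
Qed.

Lemma integral_shift (c : R) (f : R -> \bar R) : measurable_fun setT f ->
  (\int[leb]_x f (x - c)%R = \int[leb]_x f x)%E.
Proof.
move=> mf.
have mc : measurable_fun setT (fun x : measurableTypeR R => x - c : measurableTypeR R).
  by apply: measurable_funB => //.
have nn (g : R -> \bar R) : measurable_fun setT g -> (forall x, 0 <= g x)%E ->
    (\int[leb]_x g (x - c)%R = \int[leb]_x g x)%E.
  move=> mg g0.
  pose tau (x : measurableTypeR R) : measurableTypeR R := x - c.
  transitivity (\int[pushforward leb tau]_x g x)%E.
    by rewrite ge0_integral_pushforward.
  by apply: eq_measure_integral => A mA _; exact: lebesgue_measure_shift.
rewrite integralE [RHS]integralE; congr (_ - _)%E.
- refine (eq_trans _ (nn f^\+%E (measurable_funepos mf) _)); last by [].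
  by apply: eq_integral => x _; rewrite !funeposE.
- refine (eq_trans _ (nn f^\-%E (measurable_funeneg mf) _)); last by [].
  by apply: eq_integral => x _; rewrite !funenegE.
Qed.

Lemma unit_shiftE f t : unit_shift f t = (f \_ H) (t - 1).
Proof. by rewrite patchE mem_setE in_itv/= andbT subr_ge0. Qed.

Lemma measurable_unit_shift f : measurable_fun H f -> measurable_fun H (unit_shift f).
Proof.
move=> mf; rewrite (_ : unit_shift f = (f \_ H) \o (fun t => t - 1)); last first.
  by apply/funext => t; rewrite unit_shiftE.
apply: measurable_funTS; apply: measurableT_comp; last exact: measurable_funB.
exact: (measurable_restrictT f (measurable_itv _)).1.
Qed.

(** This is translation by 1 on the whole line, applied to the integrand cut off outside [[0, +oo[];
    the cut-off is the extension by 0 built into [unit_shift], and the weight contributes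
    [lweight s 1]. *)
Lemma integral_unit_shift s f : measurable_fun H f ->
  (\int[leb]_(t in H) (lweight s t * unit_shift f t)%:E =
   \int[leb]_(t in H) (lweight s 1 * (lweight s t * f t))%:E)%E.
Proof.
move=> mf; rewrite [LHS]integral_mkcond [RHS]integral_mkcond.
rewrite -[RHS](@integral_shift 1); last first.
  apply/(measurable_restrictT _ (measurable_itv _)).
  apply/measurable_EFinP/measurable_funM; first exact: measurable_cst.
  exact: measurable_lweightM.
apply: eq_integral => t _; rewrite !patchE !mem_setE !in_itv/= !andbT subr_ge0.
rewrite /unit_shift; case: ifPn => t0; case: ifPn => t1.
- by rewrite mulrA -lweightD [1 + _]addrC subrK.
- by rewrite mulr0.
- by rewrite (le_trans _ t1) in t0.
- by [].
Qed.

Lemma norm_unit_shift f t : `|unit_shift f t| = unit_shift (fun u => `|f u|) t.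
Proof. by rewrite /unit_shift; case: ifP => // _; rewrite normr0. Qed.

Lemma laplace_norm_unit_shift s f : measurable_fun H f ->
  laplace_norm s (unit_shift f) = ((lweight s 1)%:E * laplace_norm s f)%E.
Proof.
move=> mf; rewrite /laplace_norm; under eq_integral do rewrite norm_unit_shift.
have mnf : measurable_fun H (fun u => `|f u|) by exact: measurableT_comp.
rewrite integral_unit_shift// ge0_integralZl_fun//.
- exact: measurable_lweightM.
- by move=> t _; rewrite mulr_ge0// lweight_ge0.
- exact: lweight_ge0.
Qed.

Lemma laplace_unit_shift s f : laplace_converges f s ->
  laplace_converges (unit_shift f) s /\
  laplace (unit_shift f) s = lweight s 1 * laplace f s.
Proof.
move=> cf; have [mf fi] := (laplace_convergesP f s).1 cf.
split.
  apply/laplace_convergesP; split; first exact: measurable_unit_shift.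
  by rewrite laplace_norm_unit_shift// lte_mul_pinfty ?lee_fin ?lweight_ge0.
rewrite !laplaceE integral_unit_shift//.
move: cf; rewrite laplace_convergesE => cf.
by have := @RintegralZl _ _ _ leb H _ (lweight s 1) (measurable_itv _) cf.
Qed.

End Weight.

(** The multiplier of [mean_shift] under the Laplace transform; in terms of the exponent phi it is
    [1 - phi s / Lambda]. *)
HB.lock Definition mean_lweight {R : realType} (k : nat) (lam : 'I_k -> R) (s : R) : R :=
  (total_rate lam)^-1 * \sum_(j < k) lam j * lweight s 1 ^+ j.+1.

Arguments mean_lweight {R k} lam s.

Section Difference.
Context {R : realType}.
Notation leb := (@lebesgue_measure R).
Notation H := (`[(0%R : R), +oo[%classic).
Implicit Types (s t : R) (f g : R -> R).

Lemma measurable_laplace_integrand s f : measurable_fun H f ->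
  measurable_fun H (fun t => (lweight s t * `|f t|)%:E).
Proof.
move=> mf; apply/measurable_EFinP; apply: measurable_lweightM.
exact: measurableT_comp.
Qed.

Lemma laplace_integrand_ge0 s f t : (0 <= (lweight s t * `|f t|)%:E)%E.
Proof. by rewrite lee_fin mulr_ge0// lweight_ge0. Qed.

Lemma laplace_norm_ge0 s f : (0 <= laplace_norm s f)%E.
Proof. by apply: integral_ge0 => t _; exact: laplace_integrand_ge0. Qed.

Lemma laplace_normZ s (c : R) f : measurable_fun H f ->
  laplace_norm s (fun t => c * f t) = (`|c|%:E * laplace_norm s f)%E.
Proof.
move=> mf; rewrite /laplace_norm -ge0_integralZl_fun//.
- by apply: eq_integral => t _; rewrite normrM mulrCA.
- by apply/measurable_EFinP; exact: measurable_laplace_integrand.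
- by move=> t _; rewrite mulr_ge0// lweight_ge0.
Qed.

Lemma laplace_normD s f g : measurable_fun H f -> measurable_fun H g ->
  (laplace_norm s (fun t => f t + g t)%R <= laplace_norm s f + laplace_norm s g)%E.
Proof.
move=> mf mg; rewrite /laplace_norm -ge0_integralD//; last 4 first.
- by move=> t _; exact: laplace_integrand_ge0.
- exact: measurable_laplace_integrand.
- by move=> t _; exact: laplace_integrand_ge0.
- exact: measurable_laplace_integrand.
apply: ge0_le_integral.
- exact: measurable_itv.
- by move=> t _; exact: (laplace_integrand_ge0 s (fun t => f t + g t)).
- apply: (@measurable_laplace_integrand s (fun t => f t + g t)).
  exact: measurable_funD.
- by apply: emeasurable_funD; exact: measurable_laplace_integrand.
- move=> t _; rewrite -EFinD lee_fin -mulrDr ler_wpM2l ?lweight_ge0//.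
  exact: ler_normD.
Qed.

Lemma laplace_norm0 s : laplace_norm s (fun _ => 0 : R) = 0%E.
Proof.
by apply: integral0_eq => t _; rewrite normr0 mulr0.
Qed.

Lemma laplaceZ s (c : R) f : laplace_converges f s ->
  laplace_converges (fun t => c * f t) s /\
  laplace (fun t => c * f t) s = c * laplace f s.
Proof.
move=> cf; have [mf fi] := (laplace_convergesP f s).1 cf; split.
  apply/laplace_convergesP; split; first exact: measurable_funM.
  by rewrite laplace_normZ// lte_mul_pinfty.
move: cf; rewrite laplace_convergesE => cf; rewrite !laplaceE.
under eq_integral do rewrite mulrCA.
by have := @RintegralZl _ _ _ leb H _ c (measurable_itv _) cf.
Qed.

Lemma laplaceD s f g : laplace_converges f s -> laplace_converges g s ->
  laplace_converges (fun t => f t + g t) s /\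
  laplace (fun t => f t + g t) s = laplace f s + laplace g s.
Proof.
move=> cf cg; have [mf fi] := (laplace_convergesP f s).1 cf.
have [mg gi] := (laplace_convergesP g s).1 cg; split.
  apply/laplace_convergesP; split; first exact: measurable_funD.
  by apply: le_lt_trans (laplace_normD _ _ _) _ => //; exact: lte_add_pinfty.
move: cf cg; rewrite !laplace_convergesE => cf cg; rewrite !laplaceE.
under eq_integral do rewrite mulrDr.
by have := @RintegralD _ _ _ leb H _ _ (measurable_itv _) cf cg.
Qed.

Lemma laplace_cst0 s : laplace_converges (fun _ => 0 : R) s /\
  laplace (fun _ => 0) s = 0 :> R.
Proof.
split; first by apply/laplace_convergesP; split => //; rewrite laplace_norm0.
rewrite laplaceE integral0_eq// => t _; by rewrite mulr0.
Qed.

Lemma laplace_sum s (I : Type) (r : seq I) (F : I -> R -> R) :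
  (forall i, laplace_converges (F i) s) ->
  laplace_converges (fun t => \sum_(i <- r) F i t) s /\
  laplace (fun t => \sum_(i <- r) F i t) s = \sum_(i <- r) laplace (F i) s.
Proof.
move=> cF; elim: r => [|i r [ih1 ih2]].
  rewrite big_nil (_ : (fun t => _) = fun=> 0); first exact: laplace_cst0.
  by apply/funext => t; rewrite big_nil.
rewrite big_cons (_ : (fun t => _) = fun t => F i t + \sum_(j <- r) F j t).
  by have [h1 h2] := laplaceD (cF i) ih1; split => //; rewrite h2 ih2.
by apply/funext => t; rewrite big_cons.
Qed.

Lemma laplace_norm_sum s (I : Type) (r : seq I) (F : I -> R -> R) :
  (forall i, measurable_fun H (F i)) ->
  (laplace_norm s (fun t => \sum_(i <- r) F i t)%R <=
   \sum_(i <- r) laplace_norm s (F i))%E.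
Proof.
move=> mF; elim: r => [|i r ih].
  rewrite big_nil (_ : (fun t => _) = fun=> 0); first by rewrite laplace_norm0.
  by apply/funext => t; rewrite big_nil.
rewrite big_cons (_ : (fun t => _) = fun t => F i t + \sum_(j <- r) F j t)%R.
  apply: le_trans (laplace_normD _ (mF i) _) _; last exact: leeD2l.
  exact: measurable_sum.
by apply/funext => t; rewrite big_cons.
Qed.

Lemma measurable_iter_unit_shift n f : measurable_fun H f ->
  measurable_fun H (iter n unit_shift f).
Proof. by move=> mf; elim: n => //= n ih; exact: measurable_unit_shift. Qed.

Lemma laplace_norm_iter_unit_shift s n f : measurable_fun H f ->
  laplace_norm s (iter n unit_shift f) = ((lweight s 1 ^+ n)%:E * laplace_norm s f)%E.
Proof.
move=> mf; elim: n => [|n ih] /=; first by rewrite expr0 mul1e.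
rewrite laplace_norm_unit_shift ?ih; last exact: measurable_iter_unit_shift.
by rewrite muleA -EFinM exprS.
Qed.

Lemma laplace_iter_unit_shift s n f : laplace_converges f s ->
  laplace_converges (iter n unit_shift f) s /\
  laplace (iter n unit_shift f) s = lweight s 1 ^+ n * laplace f s.
Proof.
move=> cf; elim: n => [|n [ih1 ih2]] /=; first by rewrite expr0 mul1r.
by have [h1 h2] := laplace_unit_shift ih1; split => //; rewrite h2 ih2 exprS mulrA.
Qed.

Variables (k : nat) (lam : 'I_k -> R).
Hypotheses (hk : (1 <= k)%N) (hlam : forall j, 0 < lam j).

Lemma total_rate_gt0 : 0 < total_rate lam.
Proof.
rewrite /total_rate; case: k hk lam hlam => // m _ l hl.
by rewrite big_ord_recl ltr_pwDl// sumr_ge0// => i _; exact: ltW.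
Qed.

Lemma mean_lweight_ge0 s : 0 <= mean_lweight lam s.
Proof.
rewrite mean_lweight.unlock mulr_ge0 ?invr_ge0 ?(ltW total_rate_gt0)// sumr_ge0// => i _.
by rewrite mulr_ge0 ?(ltW (hlam i))// exprn_ge0// lweight_ge0.
Qed.

Lemma mean_lweight_lt1 s : 0 < s -> mean_lweight lam s < 1.
Proof.
move=> s0; rewrite mean_lweight.unlock mulrC ltr_pdivrMr ?total_rate_gt0// mul1r.
have h j : lam j * lweight s 1 ^+ j.+1 < lam j.
  by rewrite gtr_pMr// exprn_ilt1 ?lweight_ge0 ?lweight_lt1.
rewrite /total_rate; case: k hk lam hlam h => // m _ l hl h.
by rewrite !big_ord_recl ltr_leD// ler_sum// => i _; exact: ltW.
Qed.

Lemma measurable_mean_shift f : measurable_fun H f -> measurable_fun H (mean_shift lam f).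
Proof.
move=> mf; apply: measurable_funM => //; apply: measurable_sum => j.
by apply: measurable_funM => //; exact: measurable_iter_unit_shift.
Qed.

Lemma laplace_norm_mean_shift s f : measurable_fun H f ->
  (laplace_norm s (mean_shift lam f) <= (mean_lweight lam s)%:E * laplace_norm s f)%E.
Proof.
move=> mf; rewrite mean_lweight.unlock /mean_shift laplace_normZ; last first.
  apply: measurable_sum => j; apply: measurable_funM => //.
  exact: measurable_iter_unit_shift.
have L0 := total_rate_gt0.
rewrite ger0_norm ?invr_ge0 ?(ltW L0)// EFinM -muleA lee_wpmul2l ?lee_fin ?invr_ge0 ?(ltW L0)//.
rewrite (le_trans (laplace_norm_sum _ _ _))//.
  move=> j; apply: measurable_funM => //; exact: measurable_iter_unit_shift.
rewrite -sumEFin ge0_sume_distrl; last first.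
  by move=> j _; rewrite lee_fin mulr_ge0 ?(ltW (hlam j))// exprn_ge0// lweight_ge0.
apply: lee_sum => j _; rewrite laplace_normZ; last exact: measurable_iter_unit_shift.
by rewrite laplace_norm_iter_unit_shift// gtr0_norm// muleA -EFinM.
Qed.

Lemma laplace_mean_shift s f : laplace_converges f s ->
  laplace_converges (mean_shift lam f) s /\
  laplace (mean_shift lam f) s = mean_lweight lam s * laplace f s.
Proof.
move=> cf.
have h j := laplace_iter_unit_shift j.+1 cf.
have h2 j := laplaceZ (lam j) (h j).1.
have [c1 e1] := laplace_sum (index_enum 'I_k) (fun j : 'I_k => (h2 j).1).
have [c2 e2] := laplaceZ (total_rate lam)^-1 c1.
split; first exact: c2.
rewrite mean_lweight.unlock [LHS]e2 e1 -mulrA mulr_suml; congr (_ * _); apply: eq_bigr => j _.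
by rewrite (h2 j).2 (h j).2 mulrA.
Qed.

Lemma iter_mean_shift_laplace s r f : laplace_converges f s ->
  laplace_converges (iter r (mean_shift lam) f) s /\
  laplace (iter r (mean_shift lam) f) s = mean_lweight lam s ^+ r * laplace f s.
Proof.
move=> cf; elim: r => [|n [ih1 ih2]] /=; first by rewrite expr0 mul1r.
by have [h1 h2] := laplace_mean_shift ih1; split => //; rewrite h2 ih2 exprS mulrA.
Qed.

Lemma measurable_iter_mean_shift r f : measurable_fun H f ->
  measurable_fun H (iter r (mean_shift lam) f).
Proof. by move=> mf; elim: r => //= n ih; exact: measurable_mean_shift. Qed.

Lemma laplace_norm_iter_mean_shift s r f : measurable_fun H f ->
  (laplace_norm s (iter r (mean_shift lam) f) <=
   (mean_lweight lam s ^+ r)%:E * laplace_norm s f)%E.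
Proof.
move=> mf; elim: r => [|n ih] /=; first by rewrite expr0 mul1e.
apply: le_trans (laplace_norm_mean_shift _ (measurable_iter_mean_shift _ mf)) _.
by rewrite exprS EFinM -muleA lee_wpmul2l// lee_fin mean_lweight_ge0.
Qed.

(** Each application of [mean_shift] moves the support to the right by at least 1. The power is
    [r.+1] because f may be nonzero at negative arguments until the first shift cuts it off
    there. *)
Lemma iter_mean_shift_eq0 r f t : t < r.+1%:R -> iter r.+1 (mean_shift lam) f t = 0.
Proof.
have us (g : R -> R) (c : R) m u : (forall v, v < c -> g v = 0) -> u < c + m%:R ->
    iter m unit_shift g u = 0.
  move=> gc; elim: m u => [|m ih] u /=; first by rewrite addr0; exact: gc.
  rewrite -natr1 addrA -ltrBlDr /unit_shift; case: ifP => // _; exact: ih.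
have ms (g : R -> R) (c : R) u : (forall v, v < c -> g v = 0) -> u < c + 1 ->
    mean_shift lam g u = 0.
  move=> gc uc; rewrite /mean_shift big1 ?mulr0// => j _.
  rewrite (us _ _ _ _ gc) ?mulr0//; apply: lt_le_trans uc _.
  by rewrite lerD2l ler1n.
elim: r t => [|r ih] t ht.
  rewrite /= /mean_shift big1 ?mulr0// => j _ /=.
  by rewrite /unit_shift ifF ?mulr0//; apply/negbTE; rewrite -ltNge.
by rewrite iterS (ms _ r.+1%:R) // natr1.
Qed.

Variable a : R.
Hypothesis ha : 0 < a <= 1.

Lemma frac_difference_cvg f t n : t < n.+1%:R ->
  series (fun r => (-1) ^+ r * gbinom a r * iter r (mean_shift lam) f t) @ \oo -->
  \sum_(r < n.+1) bcoef a r * iter r (mean_shift lam) f t.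
Proof.
move=> tn; apply: cvg_near_cst; near=> m.
have nm : (n.+1 <= m)%N by near: m; exact: nbhs_infty_ge.
rewrite /series /= -(big_mkord xpredT (fun r => bcoef a r * iter r (mean_shift lam) f t)).
rewrite (big_cat_nat (leq0n n.+1) nm)/= [X in _ + X]big_nat [X in _ + X]big1 ?addr0.
  by apply: eq_bigr => r _; rewrite bcoef.unlock.
move=> [//|r] /andP[nr _]; rewrite iter_mean_shift_eq0 ?mulr0//.
by rewrite (lt_le_trans tn)// ler_nat.
Unshelve. all: by end_near. Qed.

Lemma frac_differenceE f t n : t < n.+1%:R ->
  frac_difference lam a f t =
  total_rate lam `^ a * \sum_(r < n.+1) bcoef a r * iter r (mean_shift lam) f t.
Proof.
move=> tn; rewrite /frac_difference; congr (_ * _); apply/cvg_lim => //.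
exact: frac_difference_cvg.
Qed.

End Difference.

Section FractionalDifference.
Context {R : realType}.
Notation leb := (@lebesgue_measure R).
Notation H := (`[(0%R : R), +oo[%classic).
Variables (k : nat) (lam : 'I_k -> R).
Hypotheses (hk : (1 <= k)%N) (hlam : forall j, 0 < lam j).
Variable a : R.
Hypothesis ha : 0 < a <= 1.
Variable s : R.
Hypothesis s0 : 0 < s.
Implicit Types (t : R) (f : R -> R).

Let S := mean_shift lam.
Let L := frac_difference lam a.
Let theta := mean_lweight lam s.
Let theta_ge0 : 0 <= theta. Proof. exact: mean_lweight_ge0. Qed.
Let theta_lt1 : theta < 1. Proof. exact: mean_lweight_lt1. Qed.
Let La_ge0 : 0 <= total_rate lam `^ a. Proof. exact: powR_ge0. Qed.
Let a01 : 0 <= a <= 1. Proof. by case/andP: ha => /ltW -> ->. Qed.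

Let partial f n t : R :=
  total_rate lam `^ a * \sum_(r < n) bcoef a r * iter r S f t.

Let partial_cvg f t : partial f ^~ t @ \oo --> L f t.
Proof.
apply: cvg_near_cst; near=> n.
have n0 : (0 < n)%N by near: n; exact: nbhs_infty_gt.
have tn : t < n%:R by near: n; exact: nbhs_infty_gtr.
have tn' : t < n.-1.+1%:R by rewrite prednK.
by rewrite /L (frac_differenceE _ _ _ tn') prednK.
Unshelve. all: by end_near. Qed.

Let measurable_partial f n : measurable_fun H f -> measurable_fun H (partial f n).
Proof.
move=> mf; apply: measurable_funM; first exact: measurable_cst.
apply: measurable_sum => r; apply: measurable_funM; first exact: measurable_cst.
exact: measurable_iter_mean_shift.
Qed.

Lemma measurable_frac_difference f : measurable_fun H f ->
  measurable_fun H (frac_difference lam a f).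
Proof.
move=> mf; apply: (@measurable_fun_cvg _ _ _ _ (partial f)).
  by move=> n; exact: measurable_partial.
by move=> t _; exact: partial_cvg.
Qed.

(** Up to the factor [Lambda ^ a] this dominates all partial sums at once: the binomial coefficients
    are at most 1 in absolute value, and the norms of the powers of [mean_shift] decay
    geometrically. *)
Let dom f t : \bar R := (\sum_(0 <= r <oo) (lweight s t * `|iter r S f t|)%:E)%E.

Let partial_dom f n t :
  ((lweight s t * `|partial f n t|)%:E <= (total_rate lam `^ a)%R%:E * dom f t)%E.
Proof.
apply: (@le_trans _ _ ((total_rate lam `^ a)%R%:E *
    \sum_(0 <= r < n) (lweight s t * `|iter r S f t|)%:E)%E); last first.
  rewrite lee_wpmul2l ?lee_fin//; apply: nneseries_lim_ge => r _ _.
  exact: laplace_integrand_ge0.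
rewrite sumEFin -EFinM lee_fin /partial normrM (ger0_norm La_ge0) mulrCA.
rewrite ler_wpM2l// big_mkord -mulr_sumr ler_wpM2l ?lweight_ge0//.
apply: le_trans (ler_norm_sum _ _ _) _; apply: ler_sum => r _.
by rewrite normrM ler_piMl// norm_bcoef_le1.
Qed.

Let measurable_dom f : measurable_fun H f -> measurable_fun H (dom f).
Proof.
move=> mf; apply: ge0_emeasurable_sum.
  by move=> r t _ _; exact: laplace_integrand_ge0.
move=> r _; apply: measurable_laplace_integrand.
exact: measurable_iter_mean_shift.
Qed.

Let dom_ge0 f t : (0 <= dom f t)%E.
Proof. by apply: nneseries_ge0 => r _ _; exact: laplace_integrand_ge0. Qed.

Let integral_dom f : measurable_fun H f ->
  (\int[leb]_(t in H) dom f t <= (1 - theta)^-1%:E * laplace_norm s f)%E.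
Proof.
move=> mf; have mS r := measurable_iter_mean_shift lam r mf.
rewrite integral_nneseries//; last 2 first.
- by move=> r; apply: measurable_laplace_integrand; exact: mS.
- by move=> r t _; exact: laplace_integrand_ge0.
apply: lime_le.
  by apply: is_cvg_nneseries => r _ _; exact: laplace_norm_ge0.
apply: nearW => n.
apply: (@le_trans _ _ (\sum_(0 <= r < n) ((theta ^+ r)%:E * laplace_norm s f))%E).
  by apply: lee_sum => r _; exact: laplace_norm_iter_mean_shift.
rewrite -ge0_sume_distrl; last by move=> r _; rewrite lee_fin exprn_ge0.
rewrite lee_wpmul2r ?laplace_norm_ge0// sumEFin lee_fin.
have -> : \sum_(0 <= r < n) theta ^+ r = series (geometric 1 theta) n.
  by apply: eq_bigr => i _; rewrite /= mul1r.
rewrite geometric_seriesE ?lt_eqF//= mul1r -[leRHS]mul1r ler_wpM2r//.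
  by rewrite invr_ge0 subr_ge0 ltW.
by rewrite gerBl exprn_ge0.
Qed.

(** The constant does not depend on f, so that the bound can later be applied to every slice [g x]
    of a density and integrated in x. *)
Lemma laplace_norm_frac_difference f : measurable_fun H f ->
  (laplace_norm s (frac_difference lam a f) <=
    (total_rate lam `^ a)%R%:E * ((1 - mean_lweight lam s)^-1%:E * laplace_norm s f))%E.
Proof.
move=> mf.
have mL := measurable_frac_difference mf.
apply: (@le_trans _ _ (\int[leb]_(t in H) ((total_rate lam `^ a)%R%:E * dom f t))%E).
  apply: ge0_le_integral.
  - exact: measurable_itv.
  - by move=> t _; exact: laplace_integrand_ge0.
  - exact: measurable_laplace_integrand.
  - by apply: measurable_funeM; exact: measurable_dom.
  - move=> t _.
    have c : (lweight s t * `|partial f n t|)%:E @[n --> \oo] -->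
        (lweight s t * `|L f t|)%:E.
      apply: cvg_EFin; first exact: nearW.
      by apply: cvgM; [exact: cvg_cst|apply: cvg_norm; exact: partial_cvg].
    rewrite -(cvg_lim _ c)//; apply: lime_le; first by apply/cvg_ex; eexists; exact: c.
    by apply: nearW => n; exact: partial_dom.
rewrite ge0_integralZl//; last exact: measurable_dom.
by rewrite lee_wpmul2l ?lee_fin// integral_dom.
Qed.

Lemma laplace_frac_difference f : laplace_converges f s ->
  laplace_converges (frac_difference lam a f) s /\
  laplace (frac_difference lam a f) s =
    (total_rate lam * (1 - mean_lweight lam s)) `^ a * laplace f s.
Proof.
move=> cf; have [mf fi] := (laplace_convergesP f s).1 cf.
have mL := measurable_frac_difference mf.
have c : laplace_converges (frac_difference lam a f) s.
  apply/laplace_convergesP; split => //.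
  apply: le_lt_trans (laplace_norm_frac_difference mf) _.
  rewrite lte_mul_pinfty ?lee_fin// lte_mul_pinfty// lee_fin invr_ge0.
  by rewrite subr_ge0 ltW.
split => //.
have ip n := laplaceZ (total_rate lam `^ a) (laplace_sum (index_enum 'I_n)
   (fun r : 'I_n => (laplaceZ (bcoef a r) (iter_mean_shift_laplace lam r cf).1).1)).1.
have e n : laplace (partial f n) s =
    total_rate lam `^ a * (series (fun r => bcoef a r * theta ^+ r) n * laplace f s).
  rewrite [LHS](ip n).2 /series /= big_mkord; congr (_ * _).
  rewrite (laplace_sum _ _).2; last first.
    by move=> r; exact: (laplaceZ _ (iter_mean_shift_laplace lam r cf).1).1.
  rewrite mulr_suml; apply: eq_bigr => r _.
  have [h1 h2] := iter_mean_shift_laplace lam r cf.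
  by have [_ ->] := laplaceZ (bcoef a r) h1; rewrite h2 mulrA.
(* The finite partial sums transform term by term; domination carries the transform through the
   limit, where the scalar series sums to [(1 - theta) ^ a]. *)
have [] := @dominated_convergence _ _ R leb H (measurable_itv _)
    (fun n t => (lweight s t * partial f n t)%:E)
    (fun t => (lweight s t * L f t)%:E)
    (fun t => (total_rate lam `^ a)%R%:E * dom f t)%E.
- move=> n; apply/measurable_EFinP; apply: (measurable_lweightM s (f := partial f n)).
  exact: measurable_partial.
- by apply/measurable_EFinP; apply: (measurable_lweightM s (f := L f)).
- apply: nearW => t _; apply: cvg_EFin; first exact: nearW.
  by apply: cvgM; [exact: cvg_cst|exact: partial_cvg].
- apply/integrableP; split; first by apply: measurable_funeM; exact: measurable_dom.
  under eq_integral do rewrite gee0_abs ?mule_ge0 ?lee_fin//.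
  rewrite ge0_integralZl//; last exact: measurable_dom.
  rewrite lte_mul_pinfty ?lee_fin//; apply: le_lt_trans (integral_dom mf) _.
  rewrite lte_mul_pinfty// lee_fin invr_ge0.
  by rewrite subr_ge0 ltW.
- apply: nearW => t n _ /=; rewrite normrM (ger0_norm (lweight_ge0 _ _)).
  exact: partial_dom.
move=> _ _ lim.
have lim1 : laplace (partial f n) s @[n --> \oo] --> laplace (L f) s.
  under eq_fun do rewrite laplaceE; rewrite laplaceE.
  apply: fine_cvg; rewrite fineK; first exact: lim.
  by apply: integrable_fin_num => //; move: c; rewrite laplace_convergesE.
have lim2 : laplace (partial f n) s @[n --> \oo] -->
    total_rate lam `^ a * ((1 - theta) `^ a * laplace f s).
  under eq_fun do rewrite e.
  apply: cvgM; first exact: cvg_cst.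
  by apply: cvgM; [exact: cvg_bcoef_series|exact: cvg_cst].
rewrite powRM ?(ltW (total_rate_gt0 hk hlam))//; last by rewrite subr_ge0 ltW.
rewrite -mulrA -(cvg_lim _ lim2)// -(cvg_lim _ lim1)//.
Qed.

End FractionalDifference.

(** * The boundary value *)

Section Boundary.
Context {R : realType}.
Notation leb := (@lebesgue_measure R).
Notation H := (`[(0%R : R), +oo[%classic).
Variables (k : nat) (lam : 'I_k -> R).
Hypotheses (hk : (1 <= k)%N) (hlam : forall j, 0 < lam j).
Variable a : R.
Hypothesis ha : 0 < a <= 1.

(** By [Gamma_ratioE] the coefficient [Gamma_ratio n a] is [n! * bcoef a n / (- a)], and n! is the
    factor in the multinomial theorem. The two series thus agree term by term up to the constant -
    a, which passes through the limit because at fixed t the partial sums are eventually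
    constant. *)
Lemma boundary_valueE : boundary_value lam a = frac_difference lam a heaviside.
Proof.
have a0 : - a != 0 by rewrite oppr_eq0 gt_eqF//; case/andP: ha.
apply/funext => t.
pose v (r : nat) := (-1) ^+ r * gbinom a r * iter r (mean_shift lam) heaviside t.
pose n := Num.truncn `|t|.
have tn : t < n.+1%:R.
  by rewrite (le_lt_trans (ler_norm t))//; have /andP[] := truncn_itv (normr_ge0 t).
have cv := @frac_difference_cvg _ _ lam a heaviside _ _ tn.
rewrite /boundary_value /frac_difference -/v mulrAC mulrC; congr (_ * _).
rewrite (_ : series _ = (fun n => (- a)^-1 * series v n)).
  rewrite (cvg_lim _ cv)//.
  have c2 : (fun n => (- a)^-1 * series v n) @ \oo --> (- a)^-1 *
      \sum_(r < n.+1) bcoef a r * iter r (mean_shift lam) heaviside t.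
    by apply: cvgM; [exact: cvg_cst|exact: cv].
  by rewrite (cvg_lim _ c2)// mulrA divff// mul1r.
apply/funext => m; rewrite /series /= mulr_sumr; apply: eq_bigr => i _.
rewrite /v iter_mean_shift_heaviside.
set q := (\sum_(_ | _) _).
have -> : (-1) ^+ i * gbinom a i = bcoef a i by rewrite bcoef.unlock.
rewrite bcoefE -(Gamma_ratioE i ha).
have i0 : ((i`!)%:R : R) != 0 by rewrite pnatr_eq0 -lt0n fact_gt0.
have -> : (- a)^-1 * (- a * Gamma_ratio i a / i`!%:R * (i`!%:R / total_rate lam ^+ i * q)) =
  ((- a)^-1 * - a) * (i`!%:R^-1 * i`!%:R) * (Gamma_ratio i a / total_rate lam ^+ i * q).
  by ring.
by rewrite !mulVf// !mul1r.
Qed.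

Lemma laplace_heaviside s : 0 < s ->
  laplace_converges heaviside s /\ laplace heaviside s = s^-1 :> R.
Proof.
move=> s0.
have hE t : H t -> heaviside t = 1 :> R.
  by rewrite /= in_itv/= andbT /heaviside => ->.
have iE : (\int[leb]_(t in H) (lweight s t * heaviside t)%:E = (s^-1)%:E)%E.
  transitivity (\int[leb]_(t in H) (s^-1 * (s * expR (- (s * t))))%:E)%E.
    apply: eq_integral => t; rewrite inE => tH.
    by rewrite hE// mulr1 lweight.unlock mulKf// gt_eqF.
  rewrite (@ge0_integralZl_fun _ _ _ leb H (fun t => s * expR (- (s * t)))); last 4 first.
  - exact: measurable_itv.
  - by apply: measurable_funM; [exact: measurable_cst|exact: measurable_expRN].
  - by move=> t _; rewrite mulr_ge0 ?expR_ge0 ?(ltW s0).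
  - by rewrite invr_ge0 ltW.
  by rewrite integral_expRN// mulr0 oppr0 expR0 mule1.
split; last by rewrite laplaceE iE.
apply/laplace_convergesP; split.
  have := @measurable_cst _ _ R R H (1 : R); apply: eq_measurable_fun => t.
  by rewrite inE => tH; rewrite hE.
rewrite /laplace_norm (_ : integral _ _ _ = (s^-1)%:E) ?ltry//.
by rewrite -iE; apply: eq_integral => t; rewrite inE => tH; rewrite hE// normr1.
Qed.

(** The exponent phi of the counting process, with [e ^ (- s)] written as [lweight s 1]. *)
Definition jump_exponent s : R := \sum_(j < k) lam j * (1 - lweight s 1 ^+ j.+1).

Lemma jump_exponentE s :
  jump_exponent s = total_rate lam * (1 - mean_lweight lam s).
Proof.
rewrite mean_lweight.unlock mulrBr mulr1 mulVKf ?gt_eqF ?total_rate_gt0//.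
by rewrite /total_rate -sumrB; apply: eq_bigr => j _; rewrite mulrBr mulr1.
Qed.

Lemma jump_exponent_gt0 s : 0 < s -> 0 < jump_exponent s.
Proof.
move=> s0; rewrite jump_exponentE mulr_gt0 ?total_rate_gt0//.
by rewrite subr_gt0 mean_lweight_lt1.
Qed.

Lemma laplace_boundary_value s : 0 < s ->
  laplace_converges (boundary_value lam a) s /\
  laplace (boundary_value lam a) s = jump_exponent s `^ a / s.
Proof.
move=> s0; have [h1 h2] := laplace_heaviside s0.
have [h3 h4] := laplace_frac_difference hk hlam ha s0 h1.
by rewrite boundary_valueE; split => //; rewrite h4 h2 jump_exponentE.
Qed.

End Boundary.

(** * Laplace transforms of Levy processes *)

Section Independence.
Context {d : measure_display} {T : measurableType d} {R : realType}.
Variable P : probability T R.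

(** Independence says that the law of the pair (f, g) is the product of the two laws, so Tonelli
    applies. The absolute values make the integrand nonnegative on the whole plane without changing
    it on the range of (f, g). *)
Lemma integralM_independent (f g : T -> R) :
  measurable_fun setT f -> measurable_fun setT g ->
  (forall w, 0 <= f w) -> (forall w, 0 <= g w) ->
  (forall B C : set R, measurable B -> measurable C ->
    P (f @^-1` B `&` g @^-1` C) = (P (f @^-1` B) * P (g @^-1` C))%E) ->
  (\int[P]_w (f w * g w)%:E = \int[P]_w (f w)%:E * \int[P]_w (g w)%:E)%E.
Proof.
move=> mf mg f0 g0 ind.
pose X : {mfun T >-> R} := HB.pack f (isMeasurableFun.Build _ _ _ _ f mf).
pose Y : {mfun T >-> R} := HB.pack g (isMeasurableFun.Build _ _ _ _ g mg).
have mfg : measurable_fun setT (fun w => (f w, g w)) by exact: measurable_fun_pair.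
pose Z : {mfun T >-> (R * R)%type} := HB.pack (fun w => (f w, g w))
  (isMeasurableFun.Build _ _ _ _ _ mfg).
have E : forall A : set (R * R), measurable A ->
    (distribution P X \x distribution P Y)%E A = distribution P Z A.
  by apply: product_measure_unique => B C mB mC; exact: ind.
pose h (p : R * R) : \bar R := (`|p.1| * `|p.2|)%:E.
have mh : measurable_fun setT h.
  by apply/measurable_EFinP/measurable_funM; exact: measurableT_comp.
have h0 p : (0 <= h p)%E by rewrite lee_fin mulr_ge0.
have mn : measurable_fun setT (fun x : R => (`|x|)%:E).
  exact/measurable_EFinP.
have int1 (X' : {mfun T >-> R}) : (\int[distribution P X']_x (`|x|)%:E =
    \int[P]_w (`|X' w|)%:E)%E.
  by rewrite ge0_integral_pushforward// => x _; rewrite lee_fin.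
transitivity (\int[distribution P Z]_p h p)%E.
  rewrite ge0_integral_pushforward//; apply: eq_integral => w _.
  by rewrite /h /= !ger0_norm.
transitivity (\int[(distribution P X \x distribution P Y)%E]_p h p)%E.
  by apply: eq_measure_integral => A mA _; have := E A mA; move/esym.
rewrite fubini_tonelli1//.
transitivity (\int[distribution P X]_x ((`|x|)%:E * \int[P]_w (g w)%:E))%E.
  apply: eq_integral => x _; rewrite /fubini_F /h /=.
  rewrite ge0_integralZl_fun// int1; congr (_ * _)%E.
  by apply: eq_integral => w _; rewrite /= ger0_norm.
rewrite ge0_integralZr//; last by apply: integral_ge0 => w _; rewrite lee_fin.
rewrite int1; congr (_ * _)%E.
by apply: eq_integral => w _; rewrite /= ger0_norm.
Qed.

Lemma integral_cst_prob (c : R) : (\int[P]_w c%:E = c%:E)%E.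
Proof.
rewrite integral_cst// -[RHS]mule1; congr (_ * _)%E; exact: probability_setT.
Qed.

Definition independent3 (A : set T) (f g : T -> R) := forall B C : set R,
  measurable B -> measurable C ->
  P (A `&` f @^-1` B `&` g @^-1` C) = (P A * P (f @^-1` B) * P (g @^-1` C))%E.

(** The preimage of B under [\1_A * f] is the part of the preimage under f inside A, together with
    the whole complement of A when 0 lies in B. This is where the product rule for the complement
    enters. *)
Let integralM_indic (A : set T) (f g : T -> R) : measurable A ->
  measurable_fun setT f -> measurable_fun setT g ->
  (forall w, 0 <= f w) -> (forall w, 0 <= g w) ->
  independent3 A f g -> independent3 (~` A) f g ->
  (\int[P]_w (\1_A w * f w * g w)%:E =
   \int[P]_w (\1_A w * f w)%:E * \int[P]_w (g w)%:E)%E.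
Proof.
move=> mA mf mg f0 g0 i1 i2.
have mAf : measurable_fun setT (fun w => \1_A w * f w).
  by apply: measurable_funM => //; exact: measurable_indic.
have mpre (h : T -> R) (B : set R) : measurable_fun setT h -> measurable B ->
    measurable (h @^-1` B).
  by move=> mh mB; rewrite -[X in measurable X]setTI; exact: mh.
apply: integralM_independent => //.
  by move=> w; rewrite mulr_ge0// indicE.
move=> B C mB mC.
have pre (E : set T) : (fun w => \1_A w * f w) @^-1` B `&` E =
    (A `&` f @^-1` B `&` E) `|` (if 0 \in B then ~` A `&` E else set0).
  apply/seteqP; split => w /=; rewrite indicE.
    case: (asboolP (A w)) => Aw.
      by rewrite mem_set// mul1r => -[? ?]; left.
    by rewrite memNset// mul0r => -[B0 Ew]; right; rewrite mem_set.
  case=> [[[Aw Bw] Ew]|]; first by rewrite mem_set// mul1r.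
  by case: ifP => // /set_mem B0 [Aw Ew]; rewrite memNset// mul0r.
have PE (E : set T) : measurable E -> (P ((fun w => \1_A w * f w)%R @^-1` B `&` E) =
    P (A `&` f @^-1` B `&` E) + (if 0%R \in B then P (~` A `&` E) else 0))%E.
  move=> mE; rewrite pre measureU//.
  - by case: ifP => // _; rewrite measure0.
  - by apply: measurableI => //; apply: measurableI => //; exact: mpre.
  - by case: ifP => // _; apply: measurableI => //; exact: measurableC.
  - apply/seteqP; split => [w [[[Aw _] _]]|w //].
    by case: ifP => _ // -[nAw _]; exact: nAw.
have PT : (P ((fun w => \1_A w * f w)%R @^-1` B) = P A * P (f @^-1` B) +
    (if 0%R \in B then P (~` A) else 0))%E.
  have := PE setT measurableT; rewrite !setIT => ->; congr (_ + _)%E.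
  have := i1 B setT mB measurableT.
  by rewrite preimage_setT probability_setT mule1 setIT.
rewrite PE; last exact: mpre.
rewrite PT i1// ge0_muleDl; last 2 first.
- by rewrite mule_ge0.
- by case: ifP.
congr (_ + _)%E; case: ifP => _; last by rewrite mul0e.
have := i2 setT C measurableT mC.
by rewrite preimage_setT setIT probability_setT mule1.
Qed.

Lemma integral_independent3 (A : set T) (f g : T -> R) : measurable A ->
  measurable_fun setT f -> measurable_fun setT g ->
  (forall w, 0 <= f w) -> (forall w, 0 <= g w) ->
  independent3 A f g -> independent3 (~` A) f g ->
  (\int[P]_(w in A) (f w * g w)%:E =
   P A * \int[P]_w (f w)%:E * \int[P]_w (g w)%:E)%E.
Proof.
move=> mA mf mg f0 g0 i1 i2.
have cst1 (A' : set T) : independent3 A' f g -> independent3 A' (cst 1) f.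
  move=> i B C mB mC; rewrite preimage_cst; case: ifPn => _.
    rewrite setIT probability_setT mule1.
    have := i C setT mC measurableT.
    by rewrite preimage_setT setIT probability_setT mule1.
  by rewrite setI0 set0I !measure0 mule0 mul0e.
have e1 := integralM_indic mA mf mg f0 g0 i1 i2.
(* The first use splits off g; the second, with the constant 1 and f in the roles of f and g,
   separates [P A] from f. *)
have := integralM_indic mA (@measurable_cst _ _ T R setT (1:R)) mf (fun=> ler01) f0
  (cst1 _ i1) (cst1 _ i2).
under eq_integral do rewrite mulr1.
under [X in _ = (X * _)%E -> _]eq_integral do rewrite mulr1.
rewrite integral_indic// setIT => e2; rewrite -e2 -e1.
rewrite integral_mkcond; apply: eq_integral => w _.
by rewrite patchE indicE; case: ifP => _; rewrite ?mul1r// !mul0r.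
Qed.

End Independence.

Lemma cvg_sumr {R : realType} {U : Type} {F : set_system U} {FF : Filter F}
    (I : Type) (r : seq I) (f : I -> U -> R) (l : I -> R) :
  (forall i, f i x @[x --> F] --> l i) ->
  \sum_(i <- r) f i x @[x --> F] --> \sum_(i <- r) l i.
Proof.
move=> fl; elim: r => [|i r ih].
  rewrite big_nil; under eq_fun do rewrite big_nil.
  exact: cvg_cst.
rewrite big_cons; under eq_fun do rewrite big_cons.
exact: cvgD.
Qed.

Section LevyLaplace.
Context {d : measure_display} {T : measurableType d} {R : realType}.
Variable P : probability T R.
Variable s : R.

Definition mean_lexp (X : T -> R) : \bar R := (\int[P]_w (lweight s (X w))%:E)%E.

Lemma measurable_lexp (X : T -> R) : measurable_fun setT X ->
  measurable_fun setT (fun w => lweight s (X w)).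
Proof. by move=> mX; apply: measurableT_comp => //; exact: measurable_lweight. Qed.

Lemma mean_lexp_eq_law (X Y : T -> R) :
  measurable_fun setT X -> measurable_fun setT Y ->
  (forall A : set R, measurable A -> P [set w | A (X w)] = P [set w | A (Y w)]) ->
  mean_lexp X = mean_lexp Y.
Proof.
move=> mX mY XY.
have E (Z : {mfun T >-> R}) : mean_lexp Z = (\int[distribution P Z]_x (lweight s x)%:E)%E.
  rewrite ge0_integral_pushforward//.
  - by apply/measurable_EFinP; exact: measurable_lweight.
  - by move=> x _; rewrite lee_fin lweight_ge0.
pose X' : {mfun T >-> R} := HB.pack X (isMeasurableFun.Build _ _ _ _ X mX).
pose Y' : {mfun T >-> R} := HB.pack Y (isMeasurableFun.Build _ _ _ _ Y mY).
rewrite (E X') (E Y'); apply: eq_measure_integral => A mA _; exact: XY.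
Qed.

Lemma mean_lexpD (X Y : T -> R) :
  measurable_fun setT X -> measurable_fun setT Y ->
  (forall B C : set R, measurable B -> measurable C ->
    P (X @^-1` B `&` Y @^-1` C) = (P (X @^-1` B) * P (Y @^-1` C))%E) ->
  mean_lexp (fun w => X w + Y w) = (mean_lexp X * mean_lexp Y)%E.
Proof.
move=> mX mY ind; rewrite /mean_lexp; under eq_integral do rewrite lweightD.
have pre (Z : T -> R) (B : set R) :
    (fun w => lweight s (Z w)) @^-1` B = Z @^-1` (lweight s @^-1` B) by [].
have ml (B : set R) : measurable B -> measurable (lweight s @^-1` B).
  by move=> mB; rewrite -[X in measurable X]setTI; exact: (measurable_lweight s).
rewrite integralM_independent//.
- exact: measurable_lexp.
- exact: measurable_lexp.
- by move=> w; exact: lweight_ge0.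
- by move=> w; exact: lweight_ge0.
- by move=> B C mB mC; rewrite !pre; apply: ind; exact: ml.
Qed.

(** [X (t + h)] is [X t] plus an increment with the law of [X h]; the two are independent, being the
    increments over the successive times 0, t, t + h. *)
Lemma levy_mean_lexpD (X : R -> T -> R) t h : levy_process P X ->
  0 <= t -> 0 <= h ->
  mean_lexp (X (t + h)) = (mean_lexp (X t) * mean_lexp (X h))%E.
Proof.
move=> [mX X0 statX indX _] t0 h0.
have mt := mX _ t0; have mh := mX _ h0; have mth := mX _ (addr_ge0 t0 h0).
have mi : measurable_fun setT (fun w => X (t + h) w - X t w).
  exact: measurable_funB.
rewrite -(@mean_lexp_eq_law (fun w => X (t + h) w - X t w) (X h))//; last first.
  by move=> A mA; exact: statX.
rewrite -mean_lexpD//.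
  by congr mean_lexp; apply/funext => w; rewrite [RHS]addrC subrK.
move=> B C mB mC.
pose tt (i : nat) : R := if i == 0%N then 0 else if i == 1%N then t else t + h.
pose A (i : nat) : set R := if i == 0%N then B else C.
have := indX 2%N tt A.
rewrite /tt /A /= => /(_ (lexx _)).
have h1 (i : nat) : (i < 2)%N -> (if i == 0%N then 0 else if i == 1%N then t else t + h) <=
    (if i.+1 == 1%N then t else t + h).
  by case: i => [|[|]]//= _; rewrite lerDl.
have h2 (i : nat) : (i < 2)%N -> measurable (if i == 0%N then B else C).
  by case: i => [|[|]].
move=> /(_ h1 h2).
rewrite !big_ord_recl big_ord0 /= mule1.
have -> : [set w | B (X t w - X 0 w)] = X t @^-1` B.
  by apply/funext => w /=; rewrite X0 subr0.
move=> <-; congr (P _); apply/seteqP; split => w /=.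
  by move=> [Bw Cw] [|[|]]//= _; rewrite X0 subr0.
move=> H; split; first by have := H 0%N isT; rewrite /= X0 subr0.
exact: (H 1%N isT).
Qed.

End LevyLaplace.

(** * Laplace transform of the counting process from its transition rates *)

Section CountingProcess.
Context {d : measure_display} {T : measurableType d} {R : realType}.
Variable P : probability T R.
Variables (k : nat) (lam : 'I_k -> R) (M : R -> T -> nat).
Hypothesis hM : generalized_counting_process P lam M.
Variable s : R.
Hypothesis s0 : 0 < s.

(** The Laplace transform at s of an integer variable is its generating function at this u. *)
Let u := lweight s 1.
Let u0 : 0 <= u. Proof. exact: lweight_ge0. Qed.
Let u1 : u <= 1. Proof. by apply/ltW/lweight_lt1. Qed.

Let lwn n : lweight s n%:R = u ^+ n.
Proof.
elim: n => [|n ih]; first by rewrite lweight.unlock mulr0 oppr0 expR0 expr0.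
by rewrite -natr1 lweightD ih exprSr.
Qed.

Let N t w : R := (M t w)%:R.
Let levyN : levy_process P N. Proof. by case: hM. Qed.
Let mN t : 0 <= t -> measurable_fun setT (N t). Proof. by case: levyN => h *; exact: h. Qed.

Lemma measurable_counting_event t n : 0 <= t -> measurable [set w | M t w = n].
Proof.
move=> t0; have -> : [set w | M t w = n] = N t @^-1` [set n%:R].
  apply/seteqP; split => w /=; first by rewrite /N => ->.
  by move/eqP; rewrite /N eqr_nat => /eqP.
by rewrite -[X in measurable X]setTI; apply: mN.
Qed.

Let f t := fine (mean_lexp P s (N t)).

Let fE t : 0 <= t -> (mean_lexp P s (N t) = (f t)%:E)%E.
Proof.
move=> t0; rewrite fineK// ge0_fin_numE; last first.
  by apply: integral_ge0 => w _; rewrite lee_fin lweight_ge0.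
apply: (@le_lt_trans _ _ (\int[P]_w 1%:E)%E); last first.
  by rewrite integral_cst_prob ltry.
apply: ge0_le_integral => //.
- by move=> w _; rewrite lee_fin lweight_ge0.
- by apply/measurable_EFinP/measurable_lexp; exact: mN.
- by move=> w _; rewrite lee_fin /N lwn exprn_ile1.
Qed.

Let f_ge0 t : 0 <= f t.
Proof. by apply: fine_ge0; apply: integral_ge0 => w _; rewrite lee_fin lweight_ge0. Qed.

Let fD t h : 0 <= t -> 0 <= h -> f (t + h) = f t * f h.
Proof.
move=> t0 h0; apply: EFin_inj.
by rewrite EFinM -!fE ?addr_ge0//; exact: levy_mean_lexpD.
Qed.

Let fX n h : 0 <= h -> f (n.+1%:R * h) = f h ^+ n.+1.
Proof.
move=> h0; elim: n => [|n ih]; first by rewrite mul1r expr1.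
by rewrite -natr1 mulrDl mul1r fD ?mulr_ge0// ih [RHS]exprSr.
Qed.

Let p h j := fine (P [set w | M h w = j]).

Let pE h j : 0 <= h -> (P [set w | M h w = j] = (p h j)%:E)%E.
Proof. by move=> h0; rewrite fineK// fin_num_measure//; exact: measurable_counting_event. Qed.

Let N0 w : M 0 w = 0%N.
Proof. by case: levyN => _ /(_ w) + _ _ _; rewrite /N => /eqP; rewrite pnatr_eq0 => /eqP. Qed.

(** At time 0 the process is in state 0 with probability 1, so the conditional probabilities there
    are the plain ones, [p h j]. *)
Let p_rates : ((p h 0%N - 1) / h @[h --> 0^'+] --> - total_rate lam) /\
  forall j : 'I_k, p h j.+1 / h @[h --> 0^'+] --> lam j.
Proof.
have [_ /(_ 0 0%N (lexx _))] := hM.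
have S : [set w | M 0 w = 0%N] = setT by apply/seteqP; split => // w _; exact: N0.
rewrite S probability_setT => /(_ lte01) [].
rewrite /cond_prob.
have E h j : fine (P ([set w | M (0 + h) w = (0 + j)%N] `&` setT)) / fine (P setT) = p h j.
  by rewrite setIT probability_setT /= divr1 add0r add0n.
move=> h1 h2 _; split.
  have : (p h 0%N - (1 - total_rate lam * h)) / h - total_rate lam @[h --> 0^'+] -->
      0 - total_rate lam.
    apply: cvgB; last exact: cvg_cst.
    by move: h1; under eq_fun do rewrite E.
  rewrite sub0r; apply: cvg_trans; apply: near_eq_cvg; near=> h.
  have hn0 : h != 0 by rewrite gt_eqF//; near: h; exact: nbhs_right_gt.
  by field.
move=> j.
have : (p h j.+1 - lam j * h) / h + lam j @[h --> 0^'+] --> 0 + lam j.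
  apply: cvgD; last exact: cvg_cst.
  by move: (h2 j); under eq_fun do rewrite E.
rewrite add0r; apply: cvg_trans; apply: near_eq_cvg; near=> h.
have hn0 : h != 0 by rewrite gt_eqF//; near: h; exact: nbhs_right_gt.
by field.
Unshelve. all: by end_near. Qed.

(** The extra term F serves the upper bound, where the weights [1 - u ^ j] are added to the
    transform instead of being subtracted from 1. *)
Let int_sum h (c : nat -> R) (F : T -> R) : 0 <= h -> (forall j, 0 <= c j) ->
  measurable_fun setT F -> (forall w, 0 <= F w) ->
  (\int[P]_w (F w + \sum_(j < k.+1) c j * \1_[set w | M h w = j] w)%:E =
   \int[P]_w (F w)%:E + (\sum_(j < k.+1) c j * p h j)%:E)%E.
Proof.
move=> h0 c0 mF F0.
have mI j : measurable_fun setT (\1_[set w | M h w = j] : T -> R).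
  by apply: measurable_indic; exact: measurable_counting_event.
under eq_integral do rewrite EFinD.
rewrite ge0_integralD//; last 4 first.
- by move=> w _; rewrite lee_fin.
- exact/measurable_EFinP.
- by move=> w _; rewrite lee_fin sumr_ge0// => j _; rewrite mulr_ge0// indicE.
- apply/measurable_EFinP; apply: measurable_sum => j; exact: measurable_funM.
congr (_ + _)%E.
under eq_integral do rewrite -sumEFin.
rewrite ge0_integral_sum//; last 2 first.
- move=> j; apply/measurable_EFinP; exact: measurable_funM.
- by move=> j w _; rewrite lee_fin mulr_ge0// indicE.
rewrite -sumEFin; apply: eq_bigr => j _.
rewrite ge0_integralZl_fun//.
have mj := measurable_counting_event j h0.
rewrite integral_indic// setIT EFinM; congr (_ * _)%E; exact: pE.
Qed.

Let indic_sum h w (c : nat -> R) :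
  \sum_(j < k.+1) c j * \1_[set w | M h w = j] w =
  if (M h w < k.+1)%N then c (M h w) else 0.
Proof.
case: ltnP => Mk.
  rewrite (bigD1 (Ordinal Mk))//= big1 ?addr0.
    by rewrite indicE mem_set// mulr1.
  move=> j jM; rewrite indicE memNset ?mulr0// => /= e.
  by move/eqP: jM; apply; apply: val_inj; rewrite /= e.
rewrite big1// => j _; rewrite indicE memNset ?mulr0// => /= e.
by move: Mk; rewrite e leqNgt ltn_ord.
Qed.

(** The states beyond k are counted here with weight 0 and in [f_upper] with weight 1. Both bounds
    have value 1 and right derivative - phi in the limit h = 0, which squeezes the derivative of
    f. *)
Let f_lower h : 0 <= h -> \sum_(j < k.+1) u ^+ j * p h j <= f h.
Proof.
move=> h0; rewrite -lee_fin -fE//.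
have := @int_sum h (fun j => u ^+ j) (cst 0) h0 (fun j => exprn_ge0 j u0)
  (measurable_cst _) (fun=> lexx _).
rewrite integral0 add0e => <-.
apply: ge0_le_integral => //.
- move=> w _; rewrite lee_fin add0r indic_sum; case: ifP => // _; exact: exprn_ge0.
- apply/measurable_EFinP; apply: measurable_funD => //.
  apply: measurable_sum => j; apply: measurable_funM => //.
  by apply: measurable_indic; exact: measurable_counting_event.
- by apply/measurable_EFinP/measurable_lexp; exact: mN.
- move=> w _; rewrite lee_fin add0r indic_sum /N lwn.
  by case: ifP => // _; exact: exprn_ge0.
Qed.

Let f_upper h : 0 <= h -> f h + \sum_(j < k.+1) (1 - u ^+ j) * p h j <= 1.
Proof.
move=> h0; rewrite -lee_fin EFinD -fE//.
have c0 j : 0 <= 1 - u ^+ j by rewrite subr_ge0 exprn_ile1.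
have mw : measurable_fun setT (fun w => lweight s (N h w)).
  by apply: measurable_lexp; exact: mN.
rewrite -(@int_sum h (fun j => 1 - u ^+ j) (fun w => lweight s (N h w)))//; last first.
  by move=> w; exact: lweight_ge0.
rewrite -[leRHS](_ : \int[P]_w (cst 1%:E) w = 1)%E; last first.
  by rewrite integral_cst_prob.
apply: ge0_le_integral => //.
- move=> w _; rewrite lee_fin (indic_sum h w (fun j => 1 - u ^+ j)) addr_ge0 ?lweight_ge0//.
  by case: ifP.
- apply/measurable_EFinP; apply: measurable_funD => //.
  apply: measurable_sum => j; apply: measurable_funM => //.
  by apply: measurable_indic; exact: measurable_counting_event.
- move=> w _; rewrite lee_fin (indic_sum h w (fun j => 1 - u ^+ j)) /N lwn.
  by case: ifP => _; [rewrite addrC subrK|rewrite addr0 exprn_ile1].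
Qed.

Let phi := jump_exponent lam s.

Let f_derivative : (f h - 1) / h @[h --> 0^'+] --> - phi.
Proof.
have [r0 r1] := p_rates.
have phiE : - phi = - total_rate lam + \sum_(j < k) u ^+ j.+1 * lam j.
  rewrite /phi /jump_exponent /total_rate -sumrN -sumrN -big_split; apply: eq_bigr => j _ /=.
  by rewrite -/u; ring.
have lower : (p h 0%N - 1) / h + \sum_(j < k) u ^+ j.+1 * (p h j.+1 / h)
    @[h --> 0^'+] --> - phi.
  rewrite phiE; apply: cvgD => //; apply: cvg_sumr => j.
  by apply: cvgM; [exact: cvg_cst|exact: r1].
have upper : - \sum_(j < k) (1 - u ^+ j.+1) * (p h j.+1 / h) @[h --> 0^'+] --> - phi.
  rewrite /phi /jump_exponent; apply: cvgN; apply: cvg_sumr => j.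
  by rewrite mulrC; apply: cvgM; [exact: cvg_cst|exact: r1].
apply: (squeeze_cvgr _ lower upper); near=> h.
have h0 : 0 < h by near: h; exact: nbhs_right_gt.
apply/andP; split.
  rewrite ler_pdivlMr// mulrDl divfK ?gt_eqF// mulr_suml.
  have := f_lower (ltW h0); rewrite big_ord_recl expr0 mul1r => fl.
  rewrite addrAC lerB//; apply: le_trans fl; rewrite lerD2l; apply: ler_sum => j _.
  by rewrite -mulrA divfK ?gt_eqF.
rewrite ler_pdivrMr// mulNr mulr_suml.
have := f_upper (ltW h0); rewrite big_ord_recl expr0 subrr mul0r add0r.
have -> : \sum_(j < k) (1 - u ^+ j.+1) * (p h j.+1 / h) * h =
    \sum_(j < k) (1 - u ^+ j.+1) * p h j.+1.
  by apply: eq_bigr => j _; rewrite -mulrA divfK ?gt_eqF.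
by under [X in f h + X <= 1 -> _]eq_bigr do rewrite lift0 /=; move=> fu; lra.
Unshelve. all: by end_near. Qed.

(** Only a right derivative at 0 is at hand, so no differential equation is solved. Instead
    [f t = f (t / n) ^ n], and the inequalities [e ^ ((x - 1) / x) <= x <= e ^ (x - 1)] at
    [x = f (t / n)], raised to the power n, enclose [f t] between two sequences tending to
    [e ^ (- t phi)]. *)
Lemma counting_laplace t : 0 <= t ->
  mean_lexp P s (fun w => (M t w)%:R) = (expR (- (t * jump_exponent lam s)))%:E.
Proof.
rewrite le_eqVlt => /orP[/eqP <-|t0].
  rewrite mul0r oppr0 expR0 /mean_lexp.
  under eq_integral do rewrite N0 lwn expr0.
  by rewrite integral_cst_prob.
rewrite [LHS](fE (ltW t0)); congr EFin.
pose h n : R := t / n.+1%:R.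
have h0 n : 0 < h n by rewrite divr_gt0.
have ch : h @ \oo --> 0.
  by rewrite -(mulr0 t); apply: cvgM; [exact: cvg_cst|exact: cvg_harmonic].
have c1 : t * ((f (h n) - 1) / h n) @[n --> \oo] --> t * (- phi).
  apply: cvgM; first exact: cvg_cst.
  by have /cvg_at_rightP := f_derivative; apply; split.
have c2 : f (h n) @[n --> \oo] --> (1 : R).
  have : h n * ((f (h n) - 1) / h n) + 1 @[n --> \oo] --> 0 * (- phi) + 1.
    apply: cvgD; last exact: cvg_cst.
    apply: cvgM => //.
    by have /cvg_at_rightP := f_derivative; apply; split.
  rewrite mul0r add0r; apply: cvg_trans; apply: near_eq_cvg; apply: nearW => n.
  by rewrite mulrC divfK ?gt_eqF// subrK.
have hE n : n.+1%:R * (f (h n) - 1) = t * ((f (h n) - 1) / h n).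
  rewrite /h; have t0' : t != 0 by rewrite gt_eqF.
  by field; rewrite t0' addrC natr1 pnatr_eq0.
have fE' n : f t = f (h n) ^+ n.+1.
  by rewrite -fX ?(ltW (h0 _))// /h mulrCA divff ?pnatr_eq0// mulr1.
have c3 : t * ((f (h n) - 1) / h n) / f (h n) @[n --> \oo] --> t * (- phi).
  rewrite -[X in _ --> X]divr1; apply: cvgM => //.
  by apply: cvgV.
rewrite -mulrN.
have e1 : expR (t * ((f (h n) - 1) / h n)) @[n --> \oo] --> expR (t * (- phi)).
  exact: (continuous_cvg _ (@continuous_expR R _)).
have e2 : expR (t * ((f (h n) - 1) / h n) / f (h n)) @[n --> \oo] --> expR (t * (- phi)).
  exact: (continuous_cvg _ (@continuous_expR R _)).
have sq : (fun=> f t) @ \oo --> expR (t * (- phi)).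
  apply: (squeeze_cvgr _ e2 e1); near=> n.
  have fp : 0 < f (h n).
    by near: n; apply: (cvgr_gt 1).
  have lo : expR ((f (h n) - 1) / f (h n)) <= f (h n).
    rewrite -[leRHS]invrK -[leLHS]invrK lef_pV2 ?posrE ?invr_gt0 ?expR_gt0// -expRN.
    apply: le_trans (expR_ge1Dx _).
    by rewrite mulrBl divff ?gt_eqF// mul1r opprB addrC subrK.
  have up : f (h n) <= expR (f (h n) - 1).
    by apply: le_trans (expR_ge1Dx _); rewrite addrC subrK.
  rewrite -hE -mulrA !expRM_natl (fE' n); apply/andP; split.
    by apply: lerXn2r; rewrite ?nnegrE ?expR_ge0.
  by apply: lerXn2r; rewrite ?nnegrE ?expR_ge0.
have L := cvg_lim (@Rhausdorff R) sq.
have C : (fun=> f t) @ \oo --> f t by exact: cvg_cst.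
by rewrite -[LHS](cvg_lim (@Rhausdorff R) C) L.
Unshelve. all: by end_near. Qed.

End CountingProcess.

(** * Sampling right-continuous processes on a grid *)

Section RightContinuousProcess.
Context {d : measure_display} {T : measurableType d} {R : realType}.

(** [grid n (grid_index n t)] is the first multiple of 1 / (n + 1) strictly above t. The numerator
    [i.+1] makes it strict, as a limit along [t^'+] does not see t itself. *)
Definition grid (n : nat) (i : nat) : R := i.+1%:R / n.+1%:R.
Definition grid_index (n : nat) (t : R) : nat := Num.truncn (n.+1%:R * t).

Lemma grid_ge0 n i : 0 <= grid n i.
Proof. by rewrite divr_ge0. Qed.

Lemma grid_gt n (t : R) : 0 <= t -> t < grid n (grid_index n t).
Proof.
move=> t0; rewrite ltr_pdivlMr// mulrC.
by have /andP[_] := truncn_itv (mulr_ge0 (ler0n R n.+1) t0).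
Qed.

Lemma grid_cvg (t : R) : 0 <= t -> grid n (grid_index n t) @[n --> \oo] --> t.
Proof.
move=> t0.
have h : t + harmonic n @[n --> \oo] --> t.
  by rewrite -[X in _ --> X]addr0; apply: cvgD; [exact: cvg_cst|exact: cvg_harmonic].
apply: (squeeze_cvgr _ (cvg_cst t) h); apply: nearW => n.
rewrite (ltW (grid_gt _ t0))/= /grid /harmonic ler_pdivrMr// mulrDl mulVf ?pnatr_eq0//.
rewrite -natr1 lerD2r mulrC.
by have /andP[] := truncn_itv (mulr_ge0 (ler0n R n.+1) t0).
Qed.

Lemma cvg_grid (f : R -> R) (t l : R) : 0 <= t -> f x @[x --> t^'+] --> l ->
  f (grid n (grid_index n t)) @[n --> \oo] --> l.
Proof.
move=> t0 /cvg_at_rightP; apply; split; last exact: grid_cvg.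
by move=> n; exact: grid_gt.
Qed.

Lemma measurable_grid_index d' (S : measurableType d') (f : S -> R) n i :
  measurable_fun setT f -> (forall x, 0 <= f x) ->
  measurable [set x | grid_index n (f x) = i].
Proof.
move=> mf f0.
rewrite (_ : [set x | _] = (fun x => n.+1%:R * f x) @^-1` `[i%:R, i.+1%:R[%classic).
  rewrite -[X in measurable X]setTI; apply: measurable_funM => //.
apply/seteqP; split => x /=; rewrite in_itv/= /grid_index.
  move=> <-; exact: truncn_itv (mulr_ge0 (ler0n R n.+1) (f0 x)).
by move=> /truncn_def.
Qed.

Lemma measurable_countable_choice d' (S : measurableType d') (c : S -> nat)
    (F : nat -> S -> R) :
  (forall i, measurable [set x | c x = i]) -> (forall i, measurable_fun setT (F i)) ->
  measurable_fun setT (fun x => F (c x) x).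
Proof.
move=> mc mF _ B mB; rewrite setTI.
rewrite (_ : _ @^-1` B = \bigcup_i ([set x | c x = i] `&` F i @^-1` B)).
  apply: bigcupT_measurable => i; apply: measurableI => //.
  by rewrite -[X in measurable X]setTI; exact: mF.
apply/seteqP; split => x /=; first by move=> Bx; exists (c x).
by move=> [i _ [/= <-]].
Qed.

(** Sampled at the next grid point, the map is a countable gluing of functions of w alone, and
    right-continuity makes these samples converge. The maximum with 0 keeps to the times at which f
    is controlled. *)
Lemma measurable_right_continuous (f : R -> T -> R) :
  (forall t, 0 <= t -> measurable_fun setT (f t)) ->
  (forall w t, 0 <= t -> f x w @[x --> t^'+] --> f t w) ->
  measurable_fun setT (fun p : R * T => f (Num.max 0 p.1) p.2).
Proof.
move=> mf cf.
pose pos (p : R * T) : R := Num.max 0 p.1.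
have mpos : measurable_fun setT pos.
  by apply: measurable_maxr => //; exact: measurable_fst.
have pos0 p : 0 <= pos p by rewrite le_max lexx.
apply: (@measurable_fun_cvg _ _ _ _
  (fun n p => f (grid n (grid_index n (pos p))) p.2)).
  move=> n; apply: (@measurable_countable_choice _ _ (fun p => grid_index n (pos p))
    (fun i (p : R * T) => f (grid n i) p.2)).
    by move=> i; exact: measurable_grid_index.
  move=> i; apply: (measurableT_comp (mf _ (grid_ge0 n i))); exact: measurable_snd.
by move=> p _; apply: (@cvg_grid (f^~ p.2)) => //; exact: cf.
Qed.

Lemma measurable_time_change (f : R -> T -> R) (D : T -> R) :
  (forall t, 0 <= t -> measurable_fun setT (f t)) ->
  (forall w t, 0 <= t -> f x w @[x --> t^'+] --> f t w) ->
  measurable_fun setT D -> (forall w, 0 <= D w) ->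
  measurable_fun setT (fun w => f (D w) w).
Proof.
move=> mf cf mD D0.
have := measurableT_comp (measurable_right_continuous mf cf)
  (measurable_fun_pair mD (@measurable_id _ _ setT)).
by apply: eq_measurable_fun => w _ /=; rewrite max_r.
Qed.

End RightContinuousProcess.

(** * Independent random times *)

Section TimeChange.
Context {d : measure_display} {T : measurableType d} {R : realType}.
Variable P : probability T R.

Lemma bounded_convergence (F : nat -> T -> R) (G : T -> R) :
  (forall n, measurable_fun setT (F n)) -> measurable_fun setT G ->
  (forall n w, 0 <= F n w <= 1) -> (forall w, F n w @[n --> \oo] --> G w) ->
  (\int[P]_w (F n w)%:E @[n --> \oo] --> \int[P]_w (G w)%:E)%E.
Proof.
move=> mF mG F01 FG.
have [] := @dominated_convergence _ _ R P setT measurableT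
  (fun n w => (F n w)%:E) (fun w => (G w)%:E) (cst 1%:E) => //.
- by move=> n; exact/measurable_EFinP.
- exact/measurable_EFinP.
- by apply: nearW => w _; apply: cvg_EFin; [apply: nearW|exact: FG].
- by apply: finite_measure_integrable_cst.
- apply: nearW => w n _ /=; have /andP[h1 h2] := F01 n w.
  by rewrite lee_fin ger0_norm.
Qed.

Variables (s : R) (N : R -> T -> R) (phi : R).
Hypothesis s0 : 0 <= s.
Hypothesis phi0 : 0 <= phi.
Hypothesis mN : forall t, 0 <= t -> measurable_fun setT (N t).
Hypothesis N0 : forall t w, 0 <= t -> 0 <= N t w.
Hypothesis cN : forall w t, 0 <= t -> N x w @[x --> t^'+] --> N t w.
Hypothesis lapN : forall t, 0 <= t -> mean_lexp P s (N t) = (lweight phi t)%:E.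

Lemma lweight_le1 (r t : R) : 0 <= r -> 0 <= t -> lweight r t <= 1.
Proof. by move=> r0 t0; rewrite lweight.unlock -expR0 ler_expR oppr_le0 mulr_ge0. Qed.

Lemma continuous_lweight (r : R) : continuous (lweight r).
Proof. by rewrite lweight.unlock; exact: continuous_expRN. Qed.

(** This stands for conditioning on D. With D rounded up to the grid, N is read at a fixed time on
    each event [A n i], where independence splits the integral; summing over i restores the
    transform of the rounded D. Bounded convergence removes the rounding. The factor g will carry
    the second subordinator. *)
Lemma mean_time_change (D g : T -> R) :
  measurable_fun setT D -> (forall w, 0 <= D w) ->
  measurable_fun setT g -> (forall w, 0 <= g w <= 1) ->
  (forall (E : set R) t, measurable E -> 0 <= t ->
    independent3 P (D @^-1` E) (fun w => lweight s (N t w)) g) ->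
  (\int[P]_w (lweight s (N (D w) w) * g w)%:E =
   mean_lexp P phi D * \int[P]_w (g w)%:E)%E.
Proof.
move=> mD D0 mg g01 ind.
have g0 w : 0 <= g w by case/andP: (g01 w).
have g1 w : g w <= 1 by case/andP: (g01 w).
pose Dn n w : R := grid n (grid_index n (D w)).
have Dn0 n w : 0 <= Dn n w by exact: grid_ge0.
pose A n i := [set w | grid_index n (D w) = i].
have mA n i : measurable (A n i) by exact: measurable_grid_index.
have tA n : trivIset setT (A n).
  apply/trivIsetP => i j _ _ /eqP ij; apply/seteqP; split => w //.
  by rewrite /A => -[/= e1 e2]; apply: ij; rewrite -e1 -e2.
have UA n : \bigcup_i A n i = setT.
  by apply/seteqP; split => w //= _; exists (grid_index n (D w)).
have mlw (X : T -> R) : measurable_fun setT X ->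
    measurable_fun setT (fun w => lweight s (X w) * g w).
  by move=> mX; apply: measurable_funM => //; exact: measurable_lexp.
have mNDn n : measurable_fun setT (fun w => N (Dn n w) w).
  apply: (@measurable_countable_choice _ _ _ (fun w => grid_index n (D w))
    (fun i w => N (grid n i) w)); first by move=> i; exact: mA.
  by move=> i; apply: mN; exact: grid_ge0.
have mDn n : measurable_fun setT (Dn n).
  apply: (@measurable_countable_choice _ _ _ (fun w => grid_index n (D w))
    (fun i w => grid n i)); first by move=> i; exact: mA.
  by move=> i; exact: measurable_cst.
have gfin : (0 <= \int[P]_w (g w)%:E)%E by apply: integral_ge0 => w _; rewrite lee_fin.
have gf : (\int[P]_w (g w)%:E \is a fin_num)%E.
  rewrite ge0_fin_numE//; apply: (@le_lt_trans _ _ (\int[P]_w (1:R)%:E)%E).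
    apply: ge0_le_integral => //.
    - by move=> w _; rewrite lee_fin.
    - exact/measurable_EFinP.
    - by move=> w _; rewrite lee_fin.
  by rewrite integral_cst_prob ltry.
have split_int n (h : T -> R) : measurable_fun setT h -> (forall w, 0 <= h w) ->
    (\int[P]_w (h w)%:E = \sum_(0 <= i <oo) \int[P]_(w in A n i) (h w)%:E)%E.
  move=> mh h0; transitivity (\int[P]_(w in \bigcup_i A n i) (h w)%:E)%E.
    by rewrite UA.
  apply: ge0_integral_bigcup.
  - by move=> i; exact: mA.
  - by rewrite UA; exact/measurable_EFinP.
  - by move=> w _; rewrite lee_fin.
  - exact: tA.
have indA n i : independent3 P (A n i) (fun w => lweight s (N (grid n i) w)) g /\
    independent3 P (~` A n i) (fun w => lweight s (N (grid n i) w)) g.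
  (* The maximum changes nothing on the range of D; it makes E a measurable set of the whole line,
     whose complement is again admissible in [ind]. *)
  pose E := [set t : R | grid_index n (Num.max 0 t) = i].
  have mE : measurable E.
    apply: measurable_grid_index; last by move=> t; rewrite le_max lexx.
    exact: measurable_maxr.
  have AE : A n i = D @^-1` E.
    by apply/seteqP; split => w; rewrite /A /E /= max_r.
  by rewrite AE; split; [exact: (ind _ _ mE (grid_ge0 n i))|
    exact: (ind _ _ (measurableC mE) (grid_ge0 n i))].
have step n : (\int[P]_w (lweight s (N (Dn n w) w) * g w)%:E =
    mean_lexp P phi (Dn n) * \int[P]_w (g w)%:E)%E.
  rewrite [LHS](split_int n); last 2 first.
  - exact: (mlw _ (mNDn n)).
  - by move=> w; rewrite mulr_ge0 ?lweight_ge0.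
  rewrite [mean_lexp _ _ _](split_int n); last 2 first.
  - exact: measurable_lexp.
  - by move=> w; rewrite lweight_ge0.
  rewrite -(fineK gf) muleC -nneseriesZl; last first.
    by move=> i _; apply: integral_ge0 => w _; rewrite lee_fin lweight_ge0.
  apply: eq_eseriesr => i _.
  have -> : (\int[P]_(w in A n i) (lweight s (N (Dn n w) w) * g w)%:E =
    \int[P]_(w in A n i) (lweight s (N (grid n i) w) * g w)%:E)%E.
    by apply: eq_integral => w; rewrite inE /Dn => <-.
  have -> : (\int[P]_(w in A n i) (lweight phi (Dn n w))%:E =
    \int[P]_(w in A n i) (cst (lweight phi (grid n i))%:E) w)%E.
    by apply: eq_integral => w; rewrite inE /Dn => <-.
  have [i1 i2] := indA n i.
  rewrite integral_independent3//; last 2 first.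
  - by apply: measurable_lexp; apply: mN; exact: grid_ge0.
  - by move=> w; exact: lweight_ge0.
  rewrite integral_cst// fineK// muleC; congr (_ * _)%E.
  by rewrite muleC; congr (_ * _)%E; apply: lapN; exact: grid_ge0.
have lim1 : (\int[P]_w (lweight s (N (Dn n w) w) * g w)%:E @[n --> \oo] -->
    \int[P]_w (lweight s (N (D w) w) * g w)%:E)%E.
  apply: bounded_convergence.
  - by move=> n; exact: (mlw _ (mNDn n)).
  - exact: (mlw _ (measurable_time_change mN cN mD D0)).
  - move=> n w; rewrite mulr_ge0 ?lweight_ge0//= mulr_ile1 ?lweight_ge0//.
    by apply: lweight_le1 => //; exact: N0.
  - move=> w; apply: cvgM; last exact: cvg_cst.
    apply: (@continuous_cvg _ _ _ _ _ (fun n => N (Dn n w) w) (lweight s)).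
      exact: continuous_lweight.
    by apply: (@cvg_grid _ (fun t => N t w)) => //; exact: cN.
have lim2 : (mean_lexp P phi (Dn n) @[n --> \oo] --> mean_lexp P phi D)%E.
  apply: bounded_convergence.
  - by move=> n; exact: measurable_lexp.
  - exact: measurable_lexp.
  - by move=> n w; rewrite lweight_ge0/= lweight_le1.
  - move=> w; apply: (@continuous_cvg _ _ _ _ _ (Dn^~ w) (lweight phi)).
      exact: continuous_lweight.
    exact: grid_cvg.
have lim3 : (mean_lexp P phi (Dn n) * \int[P]_w (g w)%:E @[n --> \oo] -->
    mean_lexp P phi D * \int[P]_w (g w)%:E)%E.
  exact: cvgeZr.
move: lim1; under eq_fun do rewrite step; move=> lim1.
by rewrite -(cvg_lim _ lim3)// -(cvg_lim _ lim1).
Qed.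

Lemma laplace_measure_pushforward (Y : T -> R) (mu : R) : 0 <= mu ->
  measurable_fun setT Y -> (forall w, 0 <= Y w) ->
  (laplace_measure (pushforward P Y) mu)%:E = mean_lexp P mu Y.
Proof.
move=> mu0 mY Y0.
rewrite /laplace_measure ge0_integral_pushforward//; last first.
  by apply/measurable_EFinP; exact: measurable_expRN.
rewrite (_ : _ @^-1` _ = setT); last first.
  by apply/seteqP; split => w //= _; rewrite in_itv/= andbT.
rewrite (_ : integral _ _ _ = mean_lexp P mu Y); last first.
  by rewrite /mean_lexp lweight.unlock.
rewrite fineK// ge0_fin_numE; last first.
  by apply: integral_ge0 => w _; rewrite lee_fin lweight_ge0.
apply: (@le_lt_trans _ _ (\int[P]_w (1:R)%:E)%E).
  apply: ge0_le_integral => //.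
  - by move=> w _; rewrite lee_fin lweight_ge0.
  - by apply/measurable_EFinP/measurable_lexp.
  - by move=> w _; rewrite lee_fin lweight_le1.
by rewrite integral_cst_prob ltry.
Qed.

End TimeChange.

(** * First passage times *)

Section FirstPassage.
Context {d : measure_display} {T : measurableType d} {R : realType}.
Notation leb := (@lebesgue_measure R).
Notation Hl := (`[(0%R : R), +oo[%classic).

Lemma integral_lweight (r a : R) : 0 < r ->
  (\int[leb]_(y in `[a, +oo[) (r * lweight r y)%:E = (lweight r a)%:E)%E.
Proof. by rewrite lweight.unlock; exact: integral_expRN. Qed.

Lemma integral_lweight_co (r a : R) : 0 < r -> 0 <= a ->
  (\int[leb]_(y in `[0%R, a[) (r * lweight r y)%:E = (1 - lweight r a)%:E)%E.
Proof.
move=> r0 a0.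
have m D : measurable_fun D (fun y => (r * lweight r y)%:E).
  apply/measurable_EFinP; apply: measurable_funM; first exact: measurable_cst.
  exact: measurable_lweight.
have p y : (0 <= (r * lweight r y)%:E)%E by rewrite lee_fin mulr_ge0 ?ltW// lweight_gt0.
have := integral_lweight 0 r0.
have -> : `[0%R, +oo[%classic = `[0%R, a[ `|` `[a, +oo[ :> set R.
  by rewrite -itv_bndbnd_setU// bnd_simp.
rewrite ge0_integral_setU//; last first.
  rewrite disj_set2E; apply/eqP/seteqP; split => // x /=.
  by rewrite !in_itv/= andbT => -[/andP[_ xa]]; rewrite leNgt xa.
  exact: m.
have l0 : lweight r 0 = 1 by rewrite lweight.unlock mulr0 oppr0 expR0.
have ea := integral_lweight a r0.
rewrite l0 => /(congr1 (fun z => z - (lweight r a)%:E)%E).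
rewrite -{1}ea addeK; last by rewrite ea.
by move=> ->.
Qed.

Variable P : probability T R.
Variable X : R -> T -> R.
Hypothesis mX : forall t, 0 <= t -> measurable_fun setT (X t).
Hypothesis cX : forall w t, 0 <= t -> X x w @[x --> t^'+] --> X t w.
Hypothesis X0 : forall t w, 0 <= t -> 0 <= X t w.
Hypothesis ndX : {ae P, forall w x y, 0 <= x -> x <= y -> X x w <= X y w}.
Variable psi : R -> R.
Hypothesis psi0 : forall s, 0 < s -> 0 < psi s.
Hypothesis lapX : forall s t, 0 < s -> 0 <= t ->
  mean_lexp P s (X t) = (lweight (psi s) t)%:E.

Let H := first_passage X.

Let has_lb t w : has_lbound [set s | 0 <= s /\ t < X s w].
Proof. by exists 0 => s [s0 _]. Qed.

Lemma first_passage_ge0 t w : 0 <= H t w.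
Proof.
rewrite /H /first_passage; have [->|/set0P ne] := eqVneq [set s | 0 <= s /\ t < X s w] set0.
  by rewrite inf0.
by apply: lb_le_inf => // s [].
Qed.

Let measurable_above t s : 0 <= s -> measurable [set w | t < X s w].
Proof.
move=> s0; rewrite (_ : [set w | _] = X s @^-1` `]t, +oo[%classic).
  by rewrite -[Y in measurable Y]setTI; exact: mX.
by apply/seteqP; split => w /=; rewrite in_itv/= andbT.
Qed.

(** [H t w < x] when some grid point below x is a crossing time: by right-continuity a crossing
    persists at grid points just to its right. For x > 0 the paths that never cross must be added,
    because the infimum of the empty set is 0. *)
Lemma measurable_first_passage t : measurable_fun setT (H t).
Proof.
apply: (measurability (@RGenInftyO.G R)) => [|/= _ [_] [x] -> <-].
  exact: RGenInftyO.measurableE.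
apply: measurableI => //.
pose U (Q : pred R) := \bigcup_n \bigcup_i
  (if Q (grid n i) then [set w | t < X (grid n i) w] else set0).
have mU Q : measurable (U Q).
  apply: bigcupT_measurable => n; apply: bigcupT_measurable => i.
  by case: ifP => // _; apply: measurable_above; exact: grid_ge0.
have UP Q w : U Q w <-> exists n i, Q (grid n i) /\ t < X (grid n i) w.
  split=> [[n _ [i _]]|[n [i [q h]]]]; first by case: ifP => // q h; exists n, i.
  by exists n => //; exists i => //; rewrite q.
have approx w s : 0 <= s -> t < X s w -> forall x, s < x ->
    exists n i, grid n i < x /\ t < X (grid n i) w.
  move=> s0 tX y sy.
  have c1 := grid_cvg s0.
  have c2 := cvg_grid s0 (@cX w s s0).
  have [n [h1 h2]] : exists n, grid n (grid_index n s) < y /\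
      t < X (grid n (grid_index n s)) w.
    near \oo => n; exists n; split; near: n.
      exact: (cvgr_lt s).
    exact: (cvgr_gt (X s w)).
  by exists n, (grid_index n s).
rewrite (_ : _ @^-1` _ = U (fun q => q < x) `|` (if 0 < x then ~` U xpredT else set0)).
  by apply: measurableU => //; case: ifP => // _; exact: measurableC.
apply/seteqP; split => w /=; rewrite in_itv/=.
  move=> Hx; have [e|/set0P ne] := eqVneq [set s | 0 <= s /\ t < X s w] set0.
    right; rewrite (le_lt_trans (first_passage_ge0 t w) Hx) => /UP[n [i [_ h]]].
    have : [set s | 0 <= s /\ t < X s w] (grid n i) by split => //; exact: grid_ge0.
    by rewrite e.
  have [s [s0 ts] sx] := inf_lt ne Hx.
  by left; apply/UP; exact: approx ts _ sx.
case=> [/UP[n [i [qx h]]]|].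
  by apply: le_lt_trans qx; apply: ge_inf => //; split => //; exact: grid_ge0.
case: ifP => // x0 nU; rewrite /H /first_passage.
rewrite (_ : [set s | _] = set0) ?inf0//.
apply/seteqP; split => s //= [s0 ts]; apply: nU; apply/UP.
have s1 : s < s + 1 by rewrite ltrDl.
have [n [i [_ h]]] := approx w s s0 ts (s + 1) s1.
by exists n, i.
Unshelve. all: by end_near. Qed.

(** Where X stays at or below t at all integers, [e ^ (- X n) >= e ^ (- t)], while the mean of
    [e ^ (- X n)] is [e ^ (- n psi 1)] and tends to 0. So the default value of [inf] occurs with
    probability 0. *)
Let crossing t : {ae P, forall w, exists x, 0 <= x /\ t < X x w}.
Proof.
pose N := \bigcap_n [set w | X n%:R w <= t].
have mle n : measurable [set w | X n%:R w <= t].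
  rewrite (_ : [set w | _] = ~` [set w | t < X n%:R w]).
    by apply: measurableC; exact: measurable_above.
  by apply/seteqP; split => w /=; [rewrite leNgt => /negP|move=> /negP; rewrite -leNgt].
have mN : measurable N by exact: bigcapT_measurable.
exists N; split => //; last first.
  move=> w /= nex n _ /=; rewrite leNgt; apply/negP => h; apply: nex.
  by exists n%:R.
apply/eqP; rewrite eq_le measure_ge0 andbT.
have bnd n : (P N * (lweight 1 t)%:E <= (lweight (psi 1) n%:R)%:E)%E.
  rewrite -(@lapX 1 n%:R)//.
  apply: (@le_trans _ _ (\int[P]_(w in N) (lweight 1 (X n%:R w))%:E)%E).
    apply: (@le_trans _ _ (\int[P]_(w in N) (cst (lweight 1 t)%:E) w)%E).
      by rewrite integral_cst// muleC.
    apply: ge0_le_integral => //.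
    - by move=> w _; rewrite lee_fin lweight_ge0.
    - apply/measurable_EFinP; apply: measurable_funTS; apply: measurable_lexp.
      exact: mX.
    - move=> w Nw; rewrite lee_fin lweight.unlock ler_expR !mul1r lerN2.
      exact: Nw.
  apply: ge0_subset_integral => //.
  - by apply/measurable_EFinP/measurable_lexp; exact: mX.
  - by move=> w _; rewrite lee_fin lweight_ge0.
have lim0 : (lweight (psi 1) n%:R)%:E @[n --> \oo] --> (0 : \bar R)%E.
  apply: cvg_EFin; first exact: nearW.
  rewrite (_ : fine \o _ = fun n => lweight (psi 1) 1 ^+ n).
    apply: cvg_expr; rewrite ger0_norm ?lweight_ge0// lweight_lt1//.
    exact: psi0.
  apply/funext => n /=; elim: n => [|n ih].
    by rewrite expr0 lweight.unlock mulr0 oppr0 expR0.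
  by rewrite -natr1 lweightD ih exprSr.
have le0 : (P N * (lweight 1 t)%:E <= 0)%E.
  rewrite -(cvg_lim _ lim0)//; apply: lime_ge; first by apply/cvg_ex; exists 0%E.
  exact: nearW.
by move: le0; rewrite pmule_lle0// lte_fin lweight_gt0.
Qed.

Variables mu eta : R.
Hypothesis mu0 : 0 < mu.
Hypothesis eta0 : 0 < eta.

(** [e ^ (- mu H(t))] is the integral of [mu e ^ (- mu x)] over x > H(t). Replacing this domain by t
    < X(x) gives an integrand jointly measurable in t, w and x, which can be integrated over t
    first. *)
Let kernel (t : R) (q : T * R) : \bar R :=
  (if (0 <= q.2) && (t < X (Num.max 0 q.2) q.1) then mu * lweight mu q.2 else 0)%:E.

Let kernel_ge0 t q : (0 <= kernel t q)%E.
Proof.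
by rewrite lee_fin; case: ifP => // _; rewrite mulr_ge0 ?lweight_ge0 ?ltW.
Qed.

Let mXm : measurable_fun setT (fun q : T * R => X (Num.max 0 q.2) q.1).
Proof.
exact: (measurableT_comp (measurable_right_continuous mX cX)
  (measurable_fun_pair (@measurable_snd _ _ T R) (@measurable_fst _ _ T R))).
Qed.

Let mkernel : measurable_fun setT (fun p : R * (T * R) => kernel p.1 p.2).
Proof.
pose x (p : R * (T * R)) : R := p.2.2.
pose Y (p : R * (T * R)) : R := X (Num.max 0 p.2.2) p.2.1.
have mx : measurable_fun setT x by exact: (measurableT_comp measurable_snd measurable_snd).
have mY : measurable_fun setT Y by exact: (measurableT_comp mXm measurable_snd).
apply/measurable_EFinP; apply: measurable_fun_ifT => //.
- exact: (measurable_and (@measurable_fun_ler _ _ _ _ (fun=> 0) x (measurable_cst _) mx)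
    (@measurable_fun_ltr _ _ _ _ fst Y measurable_fst mY)).
- apply: measurable_funM; first exact: measurable_cst.
  exact: (measurableT_comp (@measurable_lweight _ mu setT) mx).
Qed.

Let mkernel1 t : measurable_fun setT (kernel t).
Proof. exact: (measurableT_comp mkernel (@pair1_measurable _ _ _ _ t)). Qed.

Let wx t := laplace_measure (pushforward P (H t)) mu.

Let wxE t : (wx t)%:E = (\int[P \x leb]_q kernel t q)%E.
Proof.
have mH := measurable_first_passage t.
rewrite [LHS](laplace_measure_pushforward _ (ltW mu0) mH (first_passage_ge0 t)) /mean_lexp.
rewrite fubini_tonelli1; [|exact: mkernel1|exact: kernel_ge0].
apply: ge0_ae_eq_integral => //.
- by apply/measurable_EFinP/measurable_lexp.
- exact: (@measurable_fun_fubini_tonelli_F _ _ _ _ _ leb (kernel t) (mkernel1 t) (kernel_ge0 t)).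
- by move=> w _; rewrite lee_fin lweight_ge0.
- by move=> w _; apply: integral_ge0 => x _; exact: kernel_ge0.
apply: filterS2 ndX (crossing t) => w nd cr _.
have HE x : 0 <= x -> t < X x w -> H t w <= x.
  by move=> x0 tx; apply: ge_inf.
have HE' x : H t w < x -> t < X x w.
  move=> Hx; have ne : [set s | 0 <= s /\ t < X s w] !=set0 by case: cr => y ?; exists y.
  have [s [s0 ts] sx] := inf_lt ne Hx.
  by rewrite (lt_le_trans ts)// nd// ltW.
have mden D : measurable_fun D (fun y : R => (mu * lweight mu y)%:E).
  apply/measurable_EFinP; apply: measurable_funM; first exact: measurable_cst.
  exact: measurable_lweight.
have den0 y : 0 <= mu * lweight mu y by rewrite mulr_ge0 ?lweight_ge0 ?ltW.
have mkw : measurable_fun setT (fun x => kernel t (w, x)).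
  exact: (measurableT_comp (mkernel1 t) (@pair1_measurable _ _ _ _ w)).
have -> : fubini_F leb (kernel t) w = (\int[leb]_x kernel t (w, x))%E by [].
rewrite -(integral_lweight (H t w) mu0).
(* The comparison of paths decides every x except H(t) itself; this null point is dropped for one
   inequality and kept for the other. *)
apply/eqP; rewrite eq_le; apply/andP; split.
  rewrite -integral_itv_obnd_cbnd; last exact: (mden `]H t w, +oo[%classic).
  rewrite [leLHS]integral_mkcond; apply: ge0_le_integral.
  - exact: measurableT.
  - by move=> x _; rewrite patchE; case: ifP => // _; rewrite lee_fin.
  - exact: (measurable_restrictT _ (measurable_itv _)).1.
  - exact: mkw.
  - move=> x _; rewrite patchE mem_setE in_itv/= andbT /kernel /=.
    case: ifPn => [Hx|_]; last by rewrite lee_fin; case: ifP.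
    have x0 : 0 <= x by rewrite (le_trans (first_passage_ge0 t w))// ltW.
    by rewrite x0 max_r// HE'.
rewrite [leRHS]integral_mkcond; apply: ge0_le_integral.
- exact: measurableT.
- by move=> x _; exact: kernel_ge0.
- exact: mkw.
- exact: (measurable_restrictT _ (measurable_itv _)).1.
- move=> x _; rewrite patchE mem_setE in_itv/= andbT /kernel /=.
  case: ifPn => [/andP[x0]|_]; last by case: ifP => _; rewrite ?lee_fin.
  by rewrite max_r// => tx; rewrite HE.
Qed.

(** Tonelli is to exchange t with the pair (w, x), so the product of P and Lebesgue measure needs a
    sigma-finite structure of its own. *)
Let base := lebesgue_integral_fubini_product_measure1__canonical__measure_function_Measure P leb.

Let product_sigma_finite : sigma_finite setT base.
Proof.
have /sigma_finiteP[G [TG ndG Goo]] := sigma_finiteT leb.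
exists (fun n => setT `*` G n).
  rewrite -setXTT TG predeqE => -[x y]; split=> [[_ [n _ Gy]]|[n _ [_ Gy]]].
    by exists n.
  by split => //; exists n.
move=> n; have [mG Gn] := Goo n; split; first exact: measurableX.
rewrite /base /= product_measure1E//.
apply: (@le_lt_trans _ _ (1 * leb (G n))%E); last by rewrite mul1e.
by apply: lee_wpmul2r => //; exact: probability_le1.
Qed.

Let nu : {sigma_finite_measure set _ -> \bar R} :=
  HB.pack (Measure.sort base)
    (Measure_isSigmaFinite.Build _ _ _ (Measure.sort base) product_sigma_finite).

Let wxE' t : (wx t)%:E = (\int[nu]_q kernel t q)%E.
Proof. exact: wxE. Qed.

Let wx_ge0 t : 0 <= wx t.
Proof.
rewrite -lee_fin wxE; apply: integral_ge0 => q _; exact: kernel_ge0.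
Qed.

Let measurable_wx : measurable_fun setT wx.
Proof.
apply/measurable_EFinP.
rewrite (_ : _ \o _ = fubini_F nu (fun p => kernel p.1 p.2)); last first.
  by apply/funext => t; rewrite /= wxE'.
exact: (@measurable_fun_fubini_tonelli_F _ _ _ _ R nu (fun p => kernel p.1 p.2) mkernel
  (fun p => kernel_ge0 p.1 p.2)).
Qed.

Let one_sub_int d' (S : measurableType d') (m : {measure set S -> \bar R})
    (f g : S -> R) (c e : R) :
  measurable_fun setT f -> measurable_fun setT g ->
  (forall x, 0 <= f x) -> (forall x, 0 <= g x) ->
  (\int[m]_x (f x + g x)%:E = e%:E)%E -> (\int[m]_x (g x)%:E = c%:E)%E ->
  (\int[m]_x (f x)%:E = (e - c)%:E)%E.
Proof.
move=> mf mg f0 g0 fg gc.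
have : (\int[m]_x (f x)%:E + \int[m]_x (g x)%:E = e%:E)%E.
  rewrite -fg -ge0_integralD//.
  - by move=> x _; rewrite lee_fin.
  - exact/measurable_EFinP.
  - by move=> x _; rewrite lee_fin.
  - exact/measurable_EFinP.
rewrite gc EFinB => <-; by rewrite addeK.
Qed.

Let mu_psi_gt0 : 0 < mu + psi eta. Proof. by rewrite addr_gt0 ?psi0. Qed.

(** The density of the exponential law of rate r. *)
Let den (r x : R) : R := if 0 <= x then r * lweight r x else 0.

Let measurable_den r : measurable_fun setT (den r).
Proof.
apply: measurable_fun_ifT => //; first exact: (measurable_fun_ler (f := fun=> 0)).
by apply: measurable_funM; [exact: measurable_cst|exact: measurable_lweight].
Qed.

Let den_ge0 r x : 0 <= r -> 0 <= den r x.
Proof. by move=> r0; rewrite /den; case: ifP => // _; rewrite mulr_ge0// lweight_ge0. Qed.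

Let integral_den r : 0 < r -> (\int[leb]_x (den r x)%:E = 1)%E.
Proof.
move=> r0; transitivity (\int[leb]_(x in Hl) (r * lweight r x)%:E)%E.
  rewrite [RHS]integral_mkcond; apply: eq_integral => x _.
  by rewrite patchE mem_setE in_itv/= andbT /den; case: ifP.
by rewrite integral_lweight// lweight.unlock mulr0 oppr0 expR0.
Qed.

(** What is left of [kernel] once t is integrated against the exponential density of rate eta: the
    domain [0 <= t < X(x)] has mass [1 - e ^ (- eta X(x))]. *)
Let Kq (q : T * R) : R := den mu q.2 * (1 - lweight eta (X (Num.max 0 q.2) q.1)).

Let lX_le1 x w : 0 <= 1 - lweight eta (X (Num.max 0 x) w).
Proof. by rewrite subr_ge0 lweight_le1 ?(ltW eta0)// X0// le_max lexx. Qed.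

Let measurable_Kq : measurable_fun setT Kq.
Proof.
apply: measurable_funM; first exact: (measurableT_comp (measurable_den mu) measurable_snd).
apply: measurable_funB => //.
exact: (measurableT_comp (@measurable_lweight _ eta setT) mXm).
Qed.

Let Kq_ge0 q : (0 <= (Kq q)%:E)%E.
Proof. by rewrite lee_fin mulr_ge0// den_ge0// ltW. Qed.

(** Averaging over w first leaves [1 - e ^ (- x psi eta)] against the exponential density of rate
    mu, that is [1 - mu / (mu + psi eta)]. *)
Let integral_Kq : (\int[P \x leb]_q (Kq q)%:E = (psi eta / (mu + psi eta))%:E)%E.
Proof.
have p0 := psi0 eta0.
rewrite fubini_tonelli2; [|exact/measurable_EFinP|exact: Kq_ge0].
transitivity (\int[leb]_x (den mu x * (1 - lweight (psi eta) x))%:E)%E.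
  apply: eq_integral => x _; rewrite /fubini_G /Kq /=.
  have [x0|x0] := leP 0 x; last first.
    rewrite /den leNgt x0 /= mul0r; apply: integral0_eq => w _.
    by rewrite mul0r.
  rewrite ge0_integralZl_fun; last 4 first.
  - exact: measurableT.
  - by apply: measurable_funB => //; apply: measurable_lexp; exact: mX.
  - by move=> w _; have := lX_le1 x w; rewrite max_r.
  - by rewrite den_ge0// ltW.
  rewrite EFinM; congr (_ * _)%E.
  rewrite -(@one_sub_int _ _ P (fun w => 1 - lweight eta (X x w))
     (fun w => lweight eta (X x w)) (lweight (psi eta) x) 1).
  - by [].
  - by apply: measurable_funB => //; apply: measurable_lexp; exact: mX.
  - by apply: measurable_lexp; exact: mX.
  - by move=> w; have := lX_le1 x w; rewrite max_r.
  - by move=> w; exact: lweight_ge0.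
  - under eq_integral do rewrite subrK.
    exact: integral_cst_prob.
  - exact: lapX.
have e : psi eta / (mu + psi eta) = 1 - mu / (mu + psi eta).
  by field; rewrite gt_eqF.
have le1 x : 0 <= x -> 0 <= 1 - lweight (psi eta) x.
  by move=> x0; rewrite subr_ge0 lweight_le1// ltW.
have mw : measurable_fun setT (lweight (psi eta)) by exact: measurable_lweight.
rewrite e; apply: (@one_sub_int _ _ leb (fun x => den mu x * (1 - lweight (psi eta) x))
  (fun x => den mu x * lweight (psi eta) x)).
- by apply: (measurable_funM (measurable_den mu)); apply: (measurable_funB _ mw).
- exact: (measurable_funM (measurable_den mu) mw).
- move=> x; rewrite /den; case: ifPn => [x0|_]; last by rewrite mul0r.
  by rewrite !mulr_ge0 ?lweight_ge0 ?(ltW mu0)// le1.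
- by move=> x; rewrite mulr_ge0 ?lweight_ge0// den_ge0// ltW.
- under eq_integral do rewrite -mulrDr subrK mulr1.
  exact: integral_den.
- transitivity (\int[leb]_x (mu / (mu + psi eta) * den (mu + psi eta) x)%:E)%E.
    apply: eq_integral => x _; rewrite /den; case: ifP => _; last by rewrite mul0r mulr0.
    rewrite mulrA divfK ?gt_eqF// -mulrA; congr (_ * _)%:E.
    by rewrite lweight.unlock -expRD mulrDl opprD.
  rewrite ge0_integralZl_fun; last 4 first.
  + exact: measurableT.
  + exact: measurable_den.
  + by move=> x _; rewrite den_ge0// ltW.
  + by rewrite divr_ge0// ltW.
  by rewrite integral_den// mule1.
Qed.

Let integral_Kq' : (\int[nu]_q (Kq q)%:E = (psi eta / (mu + psi eta))%:E)%E.
Proof. exact: integral_Kq. Qed.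

Let integral_wx :
  (\int[leb]_(t in Hl) (eta * lweight eta t * wx t)%:E = (psi eta / (mu + psi eta))%:E)%E.
Proof.
rewrite -integral_Kq'.
pose G (p : R * (T * R)) : \bar R := ((den eta p.1)%:E * kernel p.1 p.2)%E.
have mG : measurable_fun setT G.
  apply: emeasurable_funM => //; apply/measurable_EFinP.
  exact: (measurableT_comp (measurable_den eta) measurable_fst).
have G0 p : (0 <= G p)%E by rewrite mule_ge0// lee_fin den_ge0// ltW.
transitivity (\int[leb]_t \int[nu]_q G (t, q))%E.
  rewrite [LHS]integral_mkcond; apply: eq_integral => t _.
  have c0 : (0 <= (den eta t)%:E)%E by rewrite lee_fin den_ge0// ltW.
  have := @ge0_integralZl _ _ R nu setT measurableT (kernel t) (mkernel1 t)
    (den eta t)%:E (fun q _ => kernel_ge0 t q) c0.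
  rewrite /G /= => ->.
  rewrite -wxE' -EFinM patchE mem_setE in_itv/= andbT /den.
  by case: ifP => _; rewrite ?mul0r.
rewrite (@fubini_tonelli _ _ _ _ R leb nu G mG G0); apply: eq_integral => -[w x] _.
rewrite /G /kernel /Kq /den /=.
have [x0|x0] := leP 0 x; last first.
  by rewrite mul0r; apply: integral0_eq => t _; rewrite mule0.
have Xx0 := @X0 x w x0.
rewrite EFinM -(integral_lweight_co eta0 Xx0).
rewrite -ge0_integralZl//; last 3 first.
- apply/measurable_EFinP; apply: measurable_funM; first exact: measurable_cst.
  exact: measurable_lweight.
- by move=> t _; rewrite lee_fin mulr_ge0 ?lweight_ge0 ?ltW.
- by rewrite lee_fin mulr_ge0 ?lweight_ge0 ?ltW.
rewrite [RHS]integral_mkcond; apply: eq_integral => t _.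
rewrite patchE mem_setE in_itv/=.
case: (0 <= t) => /=; last by rewrite mul0e.
by case: (t < X x w); rewrite ?mule0// muleC.
Qed.

Lemma first_passage_laplace :
  laplace_converges (fun t => laplace_measure (pushforward P (first_passage X t)) mu) eta /\
  laplace (fun t => laplace_measure (pushforward P (first_passage X t)) mu) eta =
    psi eta / (eta * (mu + psi eta)).
Proof.
have e0 : eta != 0 by rewrite gt_eqF.
have E : (\int[leb]_(t in Hl) (lweight eta t * wx t)%:E =
    (psi eta / (eta * (mu + psi eta)))%:E)%E.
  transitivity (\int[leb]_(t in Hl) (eta^-1 * (eta * lweight eta t * wx t))%:E)%E.
    by apply: eq_integral => t _; rewrite !mulrA mulVf// mul1r.
  rewrite ge0_integralZl_fun; last 4 first.
  - exact: measurable_itv.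
  - apply: measurable_funM; last exact: measurable_funTS.
    by apply: measurable_funM; [exact: measurable_cst|exact: measurable_lweight].
  - by move=> t _; rewrite mulr_ge0// mulr_ge0 ?lweight_ge0// ltW.
  - by rewrite invr_ge0 ltW.
  rewrite integral_wx -EFinM; congr EFin; field.
  by rewrite e0 gt_eqF.
split; last by rewrite laplaceE E.
apply/laplace_convergesP; split; first exact: measurable_funTS.
rewrite /laplace_norm.
have -> : (\int[leb]_(t in Hl) (lweight eta t * `|wx t|)%:E =
    \int[leb]_(t in Hl) (lweight eta t * wx t)%:E)%E.
  by apply: eq_integral => t _; rewrite ger0_norm.
by rewrite E ltry.
Qed.

End FirstPassage.

(** * The time-changed process *)

Section Subordinators.
Context {d : measure_display} {T : measurableType d} {R : realType}.
Variable P : probability T R.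

Section Stable.
Variables (a : R) (D : R -> T -> R).
Hypothesis ha : 0 < a <= 1.
Hypothesis hD : stable_subordinator P a D.

Let cases : a < 1 \/ a = 1.
Proof. by case/andP: ha => _; rewrite le_eqVlt => /orP[/eqP ->|]; [right|left]. Qed.

Lemma stable_measurable t : 0 <= t -> measurable_fun setT (D t).
Proof.
move=> t0; have [hlt heq] := hD; case: cases => [/hlt[[mD _ _ _ _] _ _]|/heq Dt].
  exact: mD.
by rewrite (_ : D t = cst t)//; apply/funext => w; rewrite Dt.
Qed.

Lemma stable_nondecreasing w s t : 0 <= s -> s <= t -> D s w <= D t w.
Proof.
move=> s0 st; have [hlt heq] := hD; case: cases => [/hlt[_ ndD _]|/heq Dt].
  exact: ndD.
by rewrite !Dt// (le_trans s0).
Qed.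

Lemma stable_ge0 w t : 0 <= t -> 0 <= D t w.
Proof.
move=> t0; have [hlt heq] := hD; case: cases => [/hlt[[_ D0 _ _ _] ndD _]|/heq Dt].
  by rewrite -(D0 w); exact: ndD.
by rewrite Dt.
Qed.

Lemma stable_right_continuous w t : 0 <= t -> D s w @[s --> t^'+] --> D t w.
Proof.
move=> t0; have [hlt heq] := hD; case: cases => [/hlt[[_ _ _ _ cD] _ _]|/heq Dt].
  by have [h _] := cD w; exact: h.
rewrite Dt//.
apply: (@cvg_trans _ (s @[s --> t^'+])).
  apply: near_eq_cvg; near=> s; rewrite Dt//.
  by rewrite (le_trans t0)// ltW//; near: s; exact: nbhs_right_gt.
by apply: cvg_at_right_filter; exact: cvg_id.
Unshelve. all: by end_near. Qed.

Lemma stable_laplace s t : 0 < s -> 0 <= t ->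
  mean_lexp P s (D t) = (lweight (s `^ a) t)%:E.
Proof.
move=> s0 t0; have [hlt heq] := hD; rewrite /mean_lexp lweight.unlock.
case: cases => [/hlt[_ _ lD]|a1].
  by rewrite lD// mulrC.
have Dt := heq a1; rewrite a1 powRr1 ?ltW//.
under eq_integral do rewrite Dt//.
exact: integral_cst_prob.
Qed.

End Stable.

(** [N t - N s] has the law of [N (t - s)], which is nonnegative, so each pair of times costs one
    null set. The pairs of grid points are countable, and right-continuity carries the order from
    them to all times. *)
Lemma levy_nondecreasing (N : R -> T -> R) : levy_process P N ->
  (forall t w, 0 <= t -> 0 <= N t w) ->
  {ae P, forall w s t, 0 <= s -> s <= t -> N s w <= N t w}.
Proof.
move=> [mN N0 stat _ cN] Nge0.
have cN' w t : 0 <= t -> N x w @[x --> t^'+] --> N t w by have [+ _] := cN w; apply.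
have inc s t : 0 <= s -> s <= t -> {ae P, forall w, N s w <= N t w}.
  move=> s0 st; have ts0 : 0 <= t - s by rewrite subr_ge0.
  have t0 := le_trans s0 st.
  exists [set w | `]-oo, 0[%classic (N t w - N s w)]; split.
  - rewrite -[X in measurable X]setTI.
    by apply: (measurable_funB (mN _ t0) (mN _ s0)).
  - have := @stat s (t - s) s0 ts0 `]-oo, 0[%classic (measurable_itv _).
    rewrite addrC subrK => ->.
    rewrite (_ : [set w | _] = set0) ?measure0//.
    apply/seteqP; split => w //=; rewrite in_itv/= => h.
    by have := Nge0 (t - s) w ts0; rewrite leNgt h.
  - move=> w /= /negP; rewrite -ltNge in_itv/= => h.
    by rewrite subr_lt0.
have le_grid n i j : (i <= j)%N -> (grid n i : R) <= grid n j.
  by move=> ij; rewrite ler_wpM2r ?invr_ge0// ler_nat ltnS.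
have : {ae P, forall w, forall n i j, (i <= j)%N -> N (grid n i) w <= N (grid n j) w}.
  apply: ae_foralln => n; apply: ae_foralln => i; apply: ae_foralln => j.
  have [ij|ij] := boolP (i <= j)%N; last by apply: nearW.
  by apply: filterS (inc _ _ (grid_ge0 n i) (le_grid n i j ij)) => w h _.
apply: filterS => w h s t s0 st.
have t0 := le_trans s0 st.
have ls := @cvg_grid _ (N^~ w) s (N s w) s0 (cN' w s s0).
have lt := @cvg_grid _ (N^~ w) t (N t w) t0 (cN' w t t0).
apply: ler_cvg_to ls lt _; apply: nearW => n; apply: h.
rewrite /grid_index; apply: le_truncn.
by rewrite ler_wpM2l.
Qed.

(** As D is nondecreasing, [D x] approaches [D t] from the right, the side on which N is continuous.
    The case [D x = D t] is treated apart, since the right limit excludes the point. *)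
Lemma right_continuous_time_change (N D : R -> R) t :
  0 <= t -> (forall u, 0 <= u -> N x @[x --> u^'+] --> N u) ->
  (forall s u, 0 <= s -> s <= u -> D s <= D u) -> 0 <= D t ->
  D x @[x --> t^'+] --> D t -> N (D x) @[x --> t^'+] --> N (D t).
Proof.
move=> t0 cN ndD Dt0 cD; apply/cvgrPdist_lt => e e0.
have /cvgrPdist_lt/(_ _ e0) := cN _ Dt0.
rewrite near_withinE => -[/= r r0 hr].
have /cvgrPdist_lt/(_ _ r0) : D x @[x --> t^'+] --> D t := cD.
move=> cDr; near=> x.
have tx : t < x by near: x; exact: nbhs_right_gt.
have := ndD _ _ t0 (ltW tx); rewrite le_eqVlt => /orP[/eqP <-|Dx].
  by rewrite subrr normr0.
by apply: hr => //=; near: x.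
Unshelve. all: by end_near. Qed.

End Subordinators.

Section TimeChangedProcess.
Context {d : measure_display} {T : measurableType d} {R : realType}.
Variable P : probability T R.
Variables (alpha gamma b : R) (k : nat) (lam : 'I_k -> R).
Variables (M : R -> T -> nat) (Dgamma Dalpha : R -> T -> R).
Hypotheses (halpha : 0 < alpha <= 1) (hgamma : 0 < gamma <= 1) (hb : 0 <= b).
Hypotheses (hk : (1 <= k)%N) (hlam : forall j, 0 < lam j).
Hypothesis hM : generalized_counting_process P lam M.
Hypothesis hDgamma : stable_subordinator P gamma Dgamma.
Hypothesis hDalpha : stable_subordinator P alpha Dalpha.
Hypothesis hindep :
  independent_processes3 P (fun t w => (M t w)%:R) Dgamma Dalpha.

Let X := time_changed_gcp b M Dgamma Dalpha.
Let N t w : R := (M t w)%:R.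
Let levyN : levy_process P N. Proof. by case: hM. Qed.
Let mN t : 0 <= t -> measurable_fun setT (N t). Proof. by case: levyN => h *; exact: h. Qed.
Let cN w t : 0 <= t -> N x w @[x --> t^'+] --> N t w.
Proof. by case: levyN => _ _ _ _ /(_ w)[+ _]; apply. Qed.
Let N0 t w : 0 <= t -> 0 <= N t w. Proof. by []. Qed.

Definition time_changed_exponent (s : R) : R :=
  jump_exponent lam s `^ gamma + (b * s) `^ alpha.

Lemma time_changed_exponent_gt0 s : 0 < s -> 0 < time_changed_exponent s.
Proof.
by move=> s0; rewrite ltr_pwDl ?powR_ge0// powR_gt0// jump_exponent_gt0.
Qed.

Lemma time_changed_measurable t : 0 <= t -> measurable_fun setT (X t).
Proof.
move=> t0; apply: measurable_funD.
  apply: (measurable_time_change mN cN).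
    exact: stable_measurable hgamma hDgamma _ t0.
  by move=> w; exact: (stable_ge0 hgamma hDgamma).
apply: measurable_funM => //; exact: stable_measurable halpha hDalpha _ t0.
Qed.

Lemma time_changed_right_continuous w t : 0 <= t -> X x w @[x --> t^'+] --> X t w.
Proof.
move=> t0; apply: cvgD.
  apply: (@right_continuous_time_change _ (N^~ w) (Dgamma^~ w)) => //.
  - by move=> u u0; exact: cN.
  - by move=> s u; exact: (stable_nondecreasing hgamma hDgamma).
  - exact: (stable_ge0 hgamma hDgamma).
  - exact: (stable_right_continuous hgamma hDgamma).
by apply: cvgM; [exact: cvg_cst|exact: (stable_right_continuous halpha hDalpha)].
Qed.

Lemma time_changed_ge0 t w : 0 <= t -> 0 <= X t w.
Proof. by move=> t0; rewrite addr_ge0// mulr_ge0// (stable_ge0 halpha hDalpha). Qed.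

Lemma time_changed_nondecreasing :
  {ae P, forall w x y, 0 <= x -> x <= y -> X x w <= X y w}.
Proof.
apply: filterS (levy_nondecreasing levyN N0) => w ndN x y x0 xy.
apply: lerD.
  apply: ndN; first exact: (stable_ge0 hgamma hDgamma).
  exact: (stable_nondecreasing hgamma hDgamma).
by apply: ler_wpM2l => //; exact: (stable_nondecreasing halpha hDalpha).
Qed.

Lemma time_changed_laplace s t : 0 < s -> 0 <= t ->
  mean_lexp P s (X t) = (lweight (time_changed_exponent s) t)%:E.
Proof.
move=> s0 t0.
pose phi := jump_exponent lam s.
have phi0 : 0 < phi by exact: jump_exponent_gt0.
have Dg0 w : 0 <= Dgamma t w by exact: (stable_ge0 hgamma hDgamma).
have Da0 w : 0 <= Dalpha t w by exact: (stable_ge0 halpha hDalpha).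
have mDg := stable_measurable hgamma hDgamma t0.
have mDa := stable_measurable halpha hDalpha t0.
have mbDa : measurable_fun setT (fun w => b * Dalpha t w) by exact: measurable_funM.
have gen (Y : R -> T -> R) u (B : set R) : 0 <= u -> measurable B ->
    process_sigma_algebra Y (Y u @^-1` B).
  by move=> u0 mB; apply: sub_gen_smallest; exists u, B.
have mpre (f : R -> R) (B : set R) : measurable_fun setT f -> measurable B ->
    measurable (f @^-1` B).
  by move=> mf mB; rewrite -[Y in measurable Y]setTI; exact: mf.
have lapN u : 0 <= u -> mean_lexp P s (N u) = (lweight phi u)%:E.
  move=> u0; rewrite /N (counting_laplace hM s0 u0) lweight.unlock /phi.
  by rewrite mulrC.
have := @mean_time_change _ _ _ P s N phi (ltW s0) (ltW phi0) mN N0 cN lapN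
  (Dgamma t) (fun w => lweight s (b * Dalpha t w)) mDg Dg0 (measurable_lexp s mbDa).
have g01 w : 0 <= lweight s (b * Dalpha t w) <= 1.
  by rewrite lweight_ge0/= lweight_le1 ?(ltW s0)// mulr_ge0.
move=> /(_ g01) h; rewrite /mean_lexp.
under eq_integral do rewrite lweightD.
rewrite h.
  rewrite (stable_laplace hgamma hDgamma phi0 t0).
  rewrite (_ : integral _ _ _ = (lweight ((b * s) `^ alpha) t)%:E).
    by rewrite -EFinM lweight.unlock -expRD -opprD -mulrDl.
  (* For b = 0 the transform of [Dalpha] would be taken at 0, outside the range of [stable_laplace];
     both sides are then 1. *)
  have := hb; rewrite le_eqVlt => /orP[/eqP b0|b0].
    rewrite -b0 mul0r powR0; last by case/andP: halpha => /gt_eqF ->.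
    under eq_integral do rewrite mul0r.
    have -> : lweight 0 t = lweight s 0 by rewrite lweight.unlock mulr0 mul0r.
    exact: integral_cst_prob.
  have bs0 : 0 < b * s by rewrite mulr_gt0.
  rewrite -(stable_laplace halpha hDalpha bs0 t0) /mean_lexp.
  by apply: eq_integral => w _; rewrite lweight.unlock mulrA (mulrC s).
move=> E u mE u0 B C mB mC.
rewrite (setIC (Dgamma t @^-1` E)).
have mlw r : measurable_fun setT (lweight r : R -> R) by exact: measurable_lweight.
have -> : (fun w => lweight s (N u w)) @^-1` B = N u @^-1` (lweight s @^-1` B) by [].
have -> : (fun w => lweight s (b * Dalpha t w)) @^-1` C =
    Dalpha t @^-1` ((fun x => lweight s (b * x)) @^-1` C) by [].
rewrite (hindep (gen N u _ u0 (mpre _ _ (mlw s) mB)) (gen Dgamma t _ t0 mE)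
  (gen Dalpha t _ t0 _)).
  by rewrite (muleC (P (N u @^-1` _))).
apply: mpre => //; apply: (measurableT_comp (mlw s)); exact: mulrl_measurable.
Qed.

Let psi := time_changed_exponent.

Lemma time_changed_passage_laplace mu eta : 0 < mu -> 0 < eta ->
  laplace_converges
    (fun t => laplace_measure (pushforward P (first_passage X t)) mu) eta /\
  laplace (fun t => laplace_measure (pushforward P (first_passage X t)) mu) eta =
    psi eta / (eta * (mu + psi eta)).
Proof.
move=> mu0 eta0; apply: first_passage_laplace => //.
- exact: time_changed_measurable.
- exact: time_changed_right_continuous.
- exact: time_changed_ge0.
- exact: time_changed_nondecreasing.
- exact: time_changed_exponent_gt0.
- exact: time_changed_laplace.
Qed.

(** Collecting F gives [(mu + psi eta) F = psi eta / eta]: the initial datum contributes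
    [(b eta) ^ alpha / eta] to the right-hand side and the boundary datum [phi ^ gamma / eta]. *)
Lemma laplace_image_equation mu eta (F : R) : 0 < mu -> 0 < eta ->
  F = psi eta / (eta * (mu + psi eta)) ->
  b `^ alpha * caputo_image alpha eta F (laplace_measure (\d_(0 : R)) mu)
    + jump_exponent lam eta `^ gamma * F
  = - derivative_image mu F (jump_exponent lam eta `^ gamma / eta).
Proof.
move=> mu0 eta0 FE.
have d0 : laplace_measure (\d_(0 : R)) mu = 1.
  rewrite /laplace_measure integral_dirac//; last first.
    by apply/measurable_EFinP; exact: measurable_expRN.
  rewrite diracE mem_set /=; last by rewrite in_itv/= lexx.
  by rewrite mulr0 oppr0 expR0 mulr1.
have e1 : eta `^ (alpha - 1) = eta `^ alpha / eta.
  rewrite powRB ?powRr1 ?(ltW eta0)//.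
  by apply/implyP => _; rewrite gt_eqF.
have p0 := time_changed_exponent_gt0 eta0.
rewrite /caputo_image /derivative_image d0 e1 FE /psi.
move: p0; rewrite /time_changed_exponent powRM ?(ltW eta0)//.
set u := _ `^ gamma; set v := b `^ alpha; set z := eta `^ alpha => p0.
have h1 : eta != 0 by rewrite gt_eqF.
have h2 : mu + (u + v * z) != 0 by rewrite gt_eqF// addr_gt0.
by field; rewrite h1 h2.
Qed.

Lemma inverse_process_measure :
  solves_ibvp_measure b alpha gamma lam \d_(0 : R) (boundary_value lam gamma)
    (fun t => pushforward P (first_passage X t)).
Proof.
move=> mu eta mu0 eta0 wx Lwx.
have [c1 e1] := time_changed_passage_laplace mu0 eta0.
have [c2 e2] := laplace_frac_difference hk hlam hgamma eta0 c1.
have [c3 e3] := laplace_boundary_value hk hlam hgamma eta0.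
split => //; rewrite [laplace Lwx eta]e2 e3 -(jump_exponentE hk hlam).
exact: laplace_image_equation.
Qed.

End TimeChangedProcess.

(** * Two-variable transforms and densities *)

Section TwoVariableLaplace.
Context {R : realType}.
Notation leb := (@lebesgue_measure R).
Notation Hl := (`[(0%R : R), +oo[%classic).
Implicit Types (G : R -> R -> R).

Lemma measurable_quadrant : measurable (@quadrant R).
Proof.
rewrite (_ : quadrant = Hl `*` Hl); first by apply: measurableX; exact: measurable_itv.
by apply/seteqP; split => -[x t]; rewrite /quadrant /= !in_itv/= !andbT.
Qed.

Definition quadrant_measurable G := measurable_fun (@quadrant R) (fun p => G p.1 p.2).

(** Extension by 0 turns measurability on the quadrant into measurability on the plane, where
    Tonelli is available. *)
Let hat G : R * R -> R := (fun p => G p.1 p.2) \_ quadrant.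

Let hatE G x t : hat G (x, t) = if (0 <= x) && (0 <= t) then G x t else 0.
Proof.
rewrite /hat patchE; congr (if _ then _ else _).
by apply/idP/andP => [/set_mem[]|[? ?]] //; exact/mem_set.
Qed.

Let measurable_hat G : quadrant_measurable G -> measurable_fun setT (hat G).
Proof. by move=> mG; apply: (measurable_restrictT _ measurable_quadrant).1. Qed.

Let quadrant_measurable_of G (K : R * R -> R) : measurable_fun setT K ->
  (forall x t, 0 <= x -> 0 <= t -> G x t = K (x, t)) -> quadrant_measurable G.
Proof.
move=> mK GK; have := measurable_funTS mK (D := quadrant); apply: eq_measurable_fun.
by move=> [x t] /set_mem[/= x0 t0]; rewrite GK.
Qed.

Lemma quadrant_measurable_slice G x : quadrant_measurable G -> 0 <= x ->
  measurable_fun Hl (G x).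
Proof.
move=> mG x0.
have := measurable_funTS (D := Hl)
  (measurableT_comp (measurable_hat mG) (@pair1_measurable _ _ _ _ x)).
apply: eq_measurable_fun => t; rewrite inE/= in_itv/= andbT => t0.
by rewrite hatE x0 t0.
Qed.

Let integral_hat G x (h : R -> R) (c : R -> R) : 0 <= x -> h 0 = 0 ->
  (\int[leb]_(t in Hl) (c t * h (G x t))%:E = \int[leb]_t (c t * h (hat G (x, t)))%:E)%E.
Proof.
move=> x0 h0; rewrite [LHS]integral_mkcond; apply: eq_integral => t _.
rewrite patchE mem_setE in_itv/= andbT hatE x0 /=; case: ifP => // _.
by rewrite h0 mulr0.
Qed.

Let measurable_integral_hat G s (h : R -> R) : quadrant_measurable G ->
  measurable_fun setT h -> (forall x, 0 <= h x) ->
  measurable_fun setT (fun x => \int[leb]_t (lweight s t * h (hat G (x, t)))%:E)%E.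
Proof.
move=> mG mh h0.
apply: (@measurable_fun_fubini_tonelli_F _ _ _ _ R leb
  (fun p => (lweight s p.2 * h (hat G (p.1, p.2)))%:E)).
  apply/measurable_EFinP; apply: measurable_funM.
    exact: (measurableT_comp (@measurable_lweight _ s setT) measurable_snd).
  apply: (measurableT_comp mh).
  by under eq_fun do rewrite -surjective_pairing; exact: measurable_hat.
by move=> p; rewrite lee_fin mulr_ge0 ?lweight_ge0.
Qed.

Lemma measurable_laplace_norm G s : quadrant_measurable G ->
  measurable_fun Hl (fun x => laplace_norm s (G x)).
Proof.
move=> mG.
have := measurable_funTS (measurable_integral_hat s mG (@normr_measurable R setT)
  (fun x => normr_ge0 x)) (D := Hl).
apply: eq_measurable_fun => x; rewrite inE/= in_itv/= andbT => x0.
by rewrite /laplace_norm (integral_hat _ _ x0) ?normr0.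
Qed.

(** The transform is a difference of two nonnegative integrals, those of the positive and negative
    parts; each is measurable in x by Tonelli, and [fine] is a Borel map. *)
Lemma measurable_laplace G s : quadrant_measurable G ->
  measurable_fun Hl (fun x => laplace (G x) s).
Proof.
move=> mG.
pose hp (x : R) := Num.max x 0; pose hn (x : R) := Num.max (- x) 0.
have mp : measurable_fun setT hp by apply: measurable_maxr.
have mn : measurable_fun setT hn by apply: measurable_maxr => //; exact: measurable_funN.
have hp0 x : 0 <= hp x by rewrite le_max lexx orbT.
have hn0 x : 0 <= hn x by rewrite le_max lexx orbT.
have m1 := measurable_integral_hat s mG mp hp0.
have m2 := measurable_integral_hat s mG mn hn0.
have m3 : measurable_fun Hl (fun x =>
    fine (\int[leb]_t (lweight s t * hp (hat G (x, t)))%:E -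
     \int[leb]_t (lweight s t * hn (hat G (x, t)))%:E)%E).
  apply: measurable_funTS; apply: measurableT_comp; last exact: emeasurable_funB.
  exact: fine_measurable.
apply: eq_measurable_fun m3 => x; rewrite inE/= in_itv/= andbT => x0.
rewrite [RHS]laplaceE [in RHS]integralE; congr (fine (_ - _)%E).
  rewrite -(@integral_hat G x hp (lweight s) x0); last by rewrite /hp maxxx.
  apply: eq_integral => t _; rewrite funeposE /hp -EFin_max.
  by rewrite maxr_pMr ?lweight_ge0// mulr0.
rewrite -(@integral_hat G x hn (lweight s) x0); last by rewrite /hn oppr0 maxxx.
apply: eq_integral => t _; rewrite funenegE /hn -EFinN -EFin_max.
by rewrite maxr_pMr ?lweight_ge0// mulr0 mulrN.
Qed.

Lemma quadrant_measurable_swap G : quadrant_measurable G ->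
  quadrant_measurable (fun t x => G x t).
Proof.
move=> mG; apply: (@quadrant_measurable_of _ (hat G \o fun p => (p.2, p.1))).
  apply: measurableT_comp; first exact: measurable_hat.
  exact: (measurable_fun_pair measurable_snd measurable_fst).
by move=> t x t0 x0; rewrite /= hatE x0 t0.
Qed.

(** The half-lines are built into the weights [u], so both sides are iterated integrals of one
    nonnegative function on the plane; [half] takes a general kernel in order to serve both orders
    of integration. *)
Lemma laplace_norm_swap G mu eta : quadrant_measurable G ->
  (\int[leb]_(x in Hl) ((lweight mu x)%:E * laplace_norm eta (G x)) =
   \int[leb]_(t in Hl) ((lweight eta t)%:E * laplace_norm mu (G^~ t)))%E.
Proof.
move=> mG.
pose u (s x : R) := if 0 <= x then lweight s x else 0.
have mu' s : measurable_fun setT (u s).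
  apply: measurable_fun_ifT => //; last exact: measurable_lweight.
  exact: (measurable_fun_ler (f := fun=> 0)).
have u0 s x : 0 <= u s x by rewrite /u; case: ifP => // _; exact: lweight_ge0.
pose F (p : R * R) : \bar R := (u mu p.1 * u eta p.2 * `|hat G p|)%:E.
have mF : measurable_fun setT F.
  apply/measurable_EFinP; apply: measurable_funM; last first.
    by apply: measurableT_comp => //; exact: measurable_hat.
  apply: measurable_funM; first exact: (measurableT_comp (mu' mu) measurable_fst).
  exact: (measurableT_comp (mu' eta) measurable_snd).
have F0 p : (0 <= F p)%E by rewrite lee_fin !mulr_ge0.
have half (K : R -> R -> R) (a c : R) (x : R) : 0 <= x -> measurable_fun setT (K x) ->
    (\int[leb]_t (u a x * u c t * `|K x t|)%:E =
     (lweight a x)%:E * \int[leb]_(t in Hl) (lweight c t * `|K x t|)%:E)%E.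
  move=> x0 mK; rewrite [in RHS]integral_mkcond.
  transitivity (\int[leb]_t (lweight a x * (u c t * `|K x t|))%:E)%E.
    by apply: eq_integral => t _; rewrite [u a x]/u x0 mulrA.
  rewrite ge0_integralZl_fun//.
  - congr (_ * _)%E; apply: eq_integral => t _.
    by rewrite patchE mem_setE in_itv/= andbT /u; case: ifP => // _; rewrite mul0r.
  - apply: measurable_funM; first exact: mu'.
    exact: (measurableT_comp (@normr_measurable R setT) mK).
  - by move=> t _; rewrite mulr_ge0.
  - exact: lweight_ge0.
transitivity (\int[leb]_x \int[leb]_t F (x, t))%E.
  rewrite [LHS]integral_mkcond; apply: eq_integral => x _.
  rewrite patchE mem_setE in_itv/= andbT /F /=.
  case: ifP => x0; last first.
    by rewrite integral0_eq// => t _; rewrite /u x0 !mul0r.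
  rewrite (half (fun x t => hat G (x, t)))//; last first.
    exact: (measurableT_comp (measurable_hat mG) (@pair1_measurable _ _ _ _ x)).
  congr (_ * _)%E; apply: eq_integral => t; rewrite inE/= in_itv/= andbT => t0.
  by rewrite hatE x0 t0.
rewrite (@fubini_tonelli _ _ _ _ R leb leb F mF F0).
rewrite [RHS]integral_mkcond; apply: eq_integral => t _.
rewrite patchE mem_setE in_itv/= andbT /F /=.
case: ifP => t0; last first.
  by rewrite integral0_eq// => x _; rewrite /u t0 mulr0 mul0r.
transitivity (\int[leb]_x (u eta t * u mu x * `|hat G (x, t)|)%:E)%E.
  by apply: eq_integral => x _; rewrite (mulrC (u mu x)).
rewrite (half (fun t x => hat G (x, t)))//; last first.
  exact: (measurableT_comp (measurable_hat mG) (@pair2_measurable _ _ _ _ t)).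
congr (_ * _)%E; apply: eq_integral => x; rewrite inE/= in_itv/= andbT => x0.
by rewrite hatE x0 t0.
Qed.

Lemma laplace2_convergesP G mu eta : quadrant_measurable G ->
  (\int[leb]_(x in Hl) ((lweight mu x)%:E * laplace_norm eta (G x)) < +oo)%E ->
  laplace2_converges G mu eta.
Proof.
move=> mG fin.
have -> : laplace2_converges G mu eta =
  (leb \x leb)%E.-integrable quadrant
    (fun p : R * R => (lweight mu p.1 * lweight eta p.2 * G p.1 p.2)%:E).
  by rewrite /laplace2_converges lweight.unlock.
have mw : measurable_fun (@quadrant R) (fun p => lweight mu p.1 * lweight eta p.2).
  apply: measurable_funTS; apply: measurable_funM.
    exact: (measurableT_comp (@measurable_lweight _ mu setT) measurable_fst).
  exact: (measurableT_comp (@measurable_lweight _ eta setT) measurable_snd).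
apply/integrableP; split; first by apply/measurable_EFinP; exact: measurable_funM.
rewrite integral_mkcond.
pose F (p : R * R) : \bar R := ((if 0 <= p.1 then lweight mu p.1 else 0) *
   (lweight eta p.2 * `|hat G p|))%:E.
have FE p : ((fun p => `|(lweight mu p.1 * lweight eta p.2 * G p.1 p.2)%:E|) \_ quadrant)%E p = F p.
  case: p => x t; rewrite patchE /F hatE /=.
  case: ifPn => [/set_mem[/= x0 t0]|/negP nq].
    by rewrite x0 t0/= !normrM !(ger0_norm (lweight_ge0 _ _)) mulrA.
  have [x0|x0] := boolP (0 <= x); last by rewrite mul0r.
  have [t0|t0] := boolP (0 <= t); first by case: nq; exact/mem_set.
  by rewrite /= normr0 !mulr0.
under eq_integral do rewrite FE.
have mF : measurable_fun setT F.
  apply/measurable_EFinP; apply: measurable_funM.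
    apply: (measurableT_comp (f := fun x : R => if 0 <= x then lweight mu x else 0)
      _ measurable_fst).
    apply: measurable_fun_ifT => //; last exact: measurable_lweight.
    exact: (measurable_fun_ler (f := fun=> 0)).
  apply: measurable_funM.
    exact: (measurableT_comp (@measurable_lweight _ eta setT) measurable_snd).
  by apply: measurableT_comp => //; exact: measurable_hat.
have F0 p : (0 <= F p)%E.
  rewrite lee_fin mulr_ge0//; last by rewrite mulr_ge0 ?lweight_ge0.
  by case: ifP => // _; exact: lweight_ge0.
rewrite (@fubini_tonelli1 _ _ _ _ R leb leb F mF F0).
rewrite (_ : integral _ _ _ = \int[leb]_(x in Hl) ((lweight mu x)%:E * laplace_norm eta (G x)))%E//.
rewrite [RHS]integral_mkcond; apply: eq_integral => x _.
rewrite patchE mem_setE in_itv/= andbT /fubini_F /F /=.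
case: ifP => x0; last by apply: integral0_eq => t _; rewrite mul0r.
rewrite /laplace_norm (integral_hat _ _ x0) ?normr0//.
rewrite ge0_integralZl_fun//.
- apply: measurable_funM; first exact: measurable_lweight.
  apply: measurableT_comp => //.
  exact: (measurableT_comp (measurable_hat mG) (@pair1_measurable _ _ _ _ x)).
- by move=> t _; rewrite mulr_ge0 ?lweight_ge0.
- exact: lweight_ge0.
Qed.

Variables (k : nat) (lam : 'I_k -> R).

Let qm_unit_shift G : quadrant_measurable G ->
  quadrant_measurable (fun x => unit_shift (G x)).
Proof.
move=> mG; apply: (@quadrant_measurable_of _ (fun p => hat G (p.1, p.2 - 1))).
  apply: (measurableT_comp (measurable_hat mG)).
  apply: measurable_fun_pair; first exact: measurable_fst.
  by apply: measurable_funB => //; exact: measurable_snd.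
move=> x t x0 t0; rewrite hatE x0 /= /unit_shift subr_ge0.
by case: ifP.
Qed.

Let qmZ G (c : R) : quadrant_measurable G -> quadrant_measurable (fun x t => c * G x t).
Proof. by move=> mG; apply: measurable_funM => //; exact: measurable_cst. Qed.

Let qm_sum n (G : 'I_n -> R -> R -> R) : (forall i, quadrant_measurable (G i)) ->
  quadrant_measurable (fun x t => \sum_(i < n) G i x t).
Proof. by move=> mG; apply: measurable_sum. Qed.

Let qm_mean_shift G : quadrant_measurable G ->
  quadrant_measurable (fun x => mean_shift lam (G x)).
Proof.
move=> mG; apply: qmZ; apply: qm_sum => j; apply: qmZ.
have : quadrant_measurable (fun x => iter j.+1 unit_shift (G x)).
  by elim: j.+1 => [//|n ih]; exact: (qm_unit_shift ih).
by [].
Qed.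

Lemma quadrant_measurable_frac_difference a G : quadrant_measurable G ->
  quadrant_measurable (fun x => frac_difference lam a (G x)).
Proof.
move=> mG.
have mit r : quadrant_measurable (fun x => iter r (mean_shift lam) (G x)).
  by elim: r => [//|n ih]; exact: (qm_mean_shift ih).
apply: (@measurable_fun_cvg _ _ _ _ (fun n p => total_rate lam `^ a *
   \sum_(r < n) bcoef a r * iter r (mean_shift lam) (G p.1) p.2)).
  move=> n; apply: (@qmZ (fun x t => \sum_(r < n) bcoef a r * iter r (mean_shift lam) (G x) t)).
  by apply: qm_sum => r; apply: qmZ.
move=> p _; apply: cvg_near_cst; near=> n.
have n0 : (0 < n)%N by near: n; exact: nbhs_infty_gt.
have tn : p.2 < n%:R by near: n; exact: nbhs_infty_gtr.
have tn' : p.2 < n.-1.+1%:R by rewrite prednK.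
by rewrite (frac_differenceE _ _ _ tn') prednK.
Unshelve. all: by end_near. Qed.

End TwoVariableLaplace.

(** * From the law of the passage time to its density *)

Section Density.
Context {d : measure_display} {T : measurableType d} {R : realType}.
Notation leb := (@lebesgue_measure R).
Notation Hl := (`[(0%R : R), +oo[%classic).

(** A layer-cake formula: [e ^ (- mu z)] is the integral of [mu e ^ (- mu y)] over y >= z. It
    expresses a transform through half-lines, on which the defining property of the density is
    inserted; it is applied to Lebesgue measure with g and to P with [H t]. *)
Lemma integral_lweight_layers d' (S : measurableType d')
    (m : {sigma_finite_measure set S -> \bar R}) (Z h : S -> R) (mu : R) :
  measurable_fun setT Z -> measurable_fun setT h -> (forall s, 0 <= h s) -> 0 < mu ->
  (\int[m]_s (lweight mu (Z s) * h s)%:E =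
   \int[leb]_y ((mu * lweight mu y)%:E * \int[m]_(s in Z @^-1` `]-oo, y]) (h s)%:E))%E.
Proof.
move=> mZ mh h0 mu0.
have a0 y : 0 <= mu * lweight mu y by rewrite mulr_ge0 ?lweight_ge0 ?ltW.
have ma D : measurable_fun D (fun y => mu * lweight mu y).
  by apply: measurable_funM; [exact: measurable_cst|exact: measurable_lweight].
pose K (p : S * R) : \bar R :=
  (if Z p.1 <= p.2 then h p.1 * (mu * lweight mu p.2) else 0)%:E.
have mK : measurable_fun setT K.
  apply/measurable_EFinP; apply: measurable_fun_ifT => //.
    exact: (@measurable_fun_ler _ _ _ _ (Z \o fst) snd
      (measurableT_comp mZ measurable_fst) measurable_snd).
  apply: measurable_funM; first exact: (measurableT_comp mh measurable_fst).
  exact: (measurableT_comp (ma setT) measurable_snd).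
have K0 p : (0 <= K p)%E by rewrite lee_fin; case: ifP => // _; exact: mulr_ge0.
transitivity (\int[m]_s \int[leb]_y K (s, y))%E.
  apply: eq_integral => s _.
  transitivity (\int[leb]_(y in `[Z s, +oo[) (h s * (mu * lweight mu y))%:E)%E.
    rewrite ge0_integralZl_fun//; last exact: ma.
    by rewrite integral_lweight// mulrC EFinM.
  rewrite [LHS]integral_mkcond; apply: eq_integral => y _.
  by rewrite patchE mem_setE in_itv/= andbT /K /=; case: ifP.
rewrite (@fubini_tonelli _ _ _ _ R m leb K mK K0); apply: eq_integral => y _.
have mZy : measurable (Z @^-1` `]-oo, y]%classic).
  by rewrite -[Y in measurable Y]setTI; exact: mZ.
rewrite -ge0_integralZl_fun//; last exact: measurable_funTS.
rewrite [RHS]integral_mkcond; apply: eq_integral => s _.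
rewrite patchE /K /=; case: ifPn => [Zy|nZy].
  by rewrite mem_set /= ?in_itv//= mulrC.
by rewrite memNset //= in_itv/=; apply/negP.
Qed.

Variable P : probability T R.
Variables (H : R -> T -> R) (g : R -> R -> R).
Hypothesis mH : forall t, measurable_fun setT (H t).
Hypothesis H0 : forall t w, 0 <= H t w.
Hypothesis dens : is_density P H g.

Let mg : quadrant_measurable g. Proof. by case: dens. Qed.

Variable mu : R.
Hypothesis mu0 : 0 < mu.

Let wx t := laplace_measure (pushforward P (H t)) mu.

Lemma laplace_norm_density t : 0 < t -> laplace_norm mu (g^~ t) = (wx t)%:E.
Proof.
move=> t0; have [_ g0 gH] := dens.
rewrite [RHS](laplace_measure_pushforward _ (ltW mu0) (mH t) (H0 t)) /mean_lexp.
pose h x := if 0 <= x then g x t else 0.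
have mgt : measurable_fun Hl (g^~ t).
  exact: (quadrant_measurable_slice (quadrant_measurable_swap mg) (ltW t0)).
have hE : h = (g^~ t) \_ Hl.
  by apply/funext => x; rewrite patchE mem_setE in_itv/= andbT.
have mh : measurable_fun setT h.
  by rewrite hE; exact: (measurable_restrictT _ (measurable_itv _)).1.
have h0 x : 0 <= h x by rewrite /h; case: ifP => // x0; exact: g0.
transitivity (\int[leb]_x (lweight mu x * h x)%:E)%E.
  rewrite /laplace_norm [LHS]integral_mkcond; apply: eq_integral => x _.
  rewrite patchE mem_setE in_itv/= andbT /h /=; case: ifP => x0; last by rewrite mulr0.
  by rewrite ger0_norm// g0.
refine (eq_trans (@integral_lweight_layers _ _ leb id h mu (@measurable_id _ _ setT) mh h0 mu0) _).
transitivity (\int[P]_w (lweight mu (H t w) * 1)%:E)%E; last first.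
  by apply: eq_integral => w _; rewrite mulr1.
refine (eq_trans _ (esym (@integral_lweight_layers _ _ P (H t) (fun=> 1) mu (mH t)
  (measurable_cst (1 : R)) (fun=> ler01) mu0))).
apply: eq_integral => y _; congr (_ * _)%E.
have mHy : measurable (H t @^-1` `]-oo, y]%classic).
  by rewrite -[Y in measurable Y]setTI; exact: mH.
transitivity (P (H t @^-1` `]-oo, y]%classic)); last first.
  by rewrite integral_cst// mul1e.
rewrite (gH t t0)//.
rewrite [LHS]integral_mkcond [RHS]integral_mkcond; apply: eq_integral => x _.
rewrite !patchE in_setI mem_setE /h /= !mem_setE.
rewrite [x \in `[0, +oo[]in_itv/= andbT.
by case: (x \in `]-oo, y]); case: (0 <= x).
Qed.

Variable eta : R.
Hypothesis cwx : laplace_converges wx eta.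

Let wx_ge0 t : 0 <= wx t.
Proof.
rewrite -lee_fin (laplace_measure_pushforward _ (ltW mu0) (mH t) (H0 t)).
by apply: integral_ge0 => w _; rewrite lee_fin lweight_ge0.
Qed.

(** Tonelli moves the transform in x inside, where it equals [wx t] for t > 0. The time t = 0, at
    which g need not be a density, is removed as a null set. *)
Let finite_norm : (\int[leb]_(x in Hl) ((lweight mu x)%:E * laplace_norm eta (g x)) =
  (laplace wx eta)%:E)%E.
Proof.
have [mwx wxoo] := (laplace_convergesP wx eta).1 cwx.
have mn := measurable_laplace_norm mu (quadrant_measurable_swap mg).
rewrite (laplace_norm_swap mu eta mg).
transitivity (laplace_norm eta wx); last first.
  rewrite laplaceE (_ : laplace_norm eta wx = \int[leb]_(t in Hl) (lweight eta t * wx t)%:E)%E.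
    rewrite fineK// ge0_fin_numE.
      apply: le_lt_trans wxoo; rewrite /laplace_norm.
      by under [leRHS]eq_integral do rewrite ger0_norm//.
    by apply: integral_ge0 => t _; rewrite lee_fin mulr_ge0// lweight_ge0.
  by apply: eq_integral => t _; rewrite ger0_norm.
have sub : `]0, +oo[%classic `<=` Hl by move=> x /=; rewrite !in_itv/= !andbT => /ltW.
rewrite /laplace_norm -integral_itv_obnd_cbnd; last first.
  apply: emeasurable_funM.
    by apply/measurable_EFinP; exact: measurable_lweight.
  exact: (measurable_funS (measurable_itv _) sub mn).
rewrite -[RHS]integral_itv_obnd_cbnd; last first.
  exact: (measurable_funS (measurable_itv _) sub (measurable_laplace_integrand eta mwx)).
apply: eq_integral => t; rewrite inE/= in_itv/= andbT => t0.
by rewrite [X in (_ * X)%E](laplace_norm_density t0) ger0_norm.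
Qed.

Lemma laplace2_converges_density : laplace2_converges g mu eta.
Proof. by apply: laplace2_convergesP => //; rewrite finite_norm ltry. Qed.

Let laplace_density x : 0 <= x -> laplace (g x) eta = fine (laplace_norm eta (g x)).
Proof.
move=> x0; have [_ g0 _] := dens; have mgx := quadrant_measurable_slice mg x0.
have sub : `]0, +oo[%classic `<=` Hl by move=> y /=; rewrite !in_itv/= !andbT => /ltW.
rewrite laplaceE /laplace_norm; congr fine.
rewrite -integral_itv_obnd_cbnd; last first.
  apply: (measurable_funS (measurable_itv _) sub); apply/measurable_EFinP.
  exact: measurable_lweightM.
rewrite -[RHS]integral_itv_obnd_cbnd; last first.
  exact: (measurable_funS (measurable_itv _) sub (measurable_laplace_integrand eta mgx)).
apply: eq_integral => t; rewrite inE/= in_itv/= andbT => t0.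
by rewrite ger0_norm// g0.
Qed.

Let laplace_density_ge0 x : 0 <= x -> 0 <= laplace (g x) eta.
Proof.
by move=> x0; rewrite laplace_density// fine_ge0// laplace_norm_ge0.
Qed.

(** A positive weight times the norm has a finite integral, so the norm is finite almost everywhere.
    The exceptional x matter because [laplace] may read a divergent integral as 0. *)
Let finite_ae : {ae leb, forall x, Hl x -> laplace_norm eta (g x) \is a fin_num}.
Proof.
have mn := measurable_laplace_norm eta mg.
have mw : measurable_fun Hl (fun x => (lweight mu x)%:E * laplace_norm eta (g x))%E.
  apply: emeasurable_funM; last exact: mn.
  by apply/measurable_EFinP; exact: measurable_lweight.
have nn x : (0 <= (lweight mu x)%:E * laplace_norm eta (g x))%E.
  by rewrite mule_ge0 ?lee_fin ?lweight_ge0 ?laplace_norm_ge0.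
have int : leb.-integrable Hl (fun x => (lweight mu x)%:E * laplace_norm eta (g x))%E.
  apply/integrableP; split => //.
  under eq_integral do rewrite gee0_abs//.
  by rewrite finite_norm ltry.
have mHl : measurable (Hl : set (measurableTypeR R)) by exact: measurable_itv.
apply: filterS (integrable_ae mHl int) => x + Hx.
move=> /(_ Hx); rewrite !ge0_fin_numE ?laplace_norm_ge0//.
apply: contraTT; rewrite -leNgt leye_eq => /eqP ->.
by rewrite gt0_muley ?lte_fin ?lweight_gt0.
Qed.

Let integral_laplace_density :
  (\int[leb]_(x in Hl) (lweight mu x * laplace (g x) eta)%:E = (laplace wx eta)%:E)%E.
Proof.
rewrite -finite_norm; apply: ae_eq_integral.
- exact: measurable_itv.
- apply/measurable_EFinP; apply: measurable_lweightM.
  exact: measurable_laplace.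
- apply: emeasurable_funM; last exact: measurable_laplace_norm.
  by apply/measurable_EFinP; exact: measurable_lweight.
apply: (@filterS _ _ (ae_filter_ringOfSetsType leb) _ _ _ finite_ae) => x fx Hx.
have x0 : 0 <= x by move: Hx; rewrite /= in_itv/= andbT.
by rewrite laplace_density// EFinM fineK// fx.
Qed.

Lemma laplace2_density : laplace2 g mu eta = laplace wx eta.
Proof. by rewrite /laplace2 laplaceE integral_laplace_density. Qed.

Variables (k : nat) (lam : 'I_k -> R) (a : R).
Hypotheses (hk : (1 <= k)%N) (hlam : forall j, 0 < lam j) (ha : 0 < a <= 1).
Hypothesis eta0 : 0 < eta.

Let mLg := quadrant_measurable_frac_difference lam a mg.

Lemma laplace2_converges_frac_difference :
  laplace2_converges (fun x => frac_difference lam a (g x)) mu eta.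
Proof.
apply: laplace2_convergesP => //.
(* The constant of [laplace_norm_frac_difference], the same for every slice [g x]. *)
pose c := total_rate lam `^ a * (1 - mean_lweight lam eta)^-1.
have c0 : 0 <= c.
  by rewrite mulr_ge0 ?powR_ge0// invr_ge0 subr_ge0 ltW// mean_lweight_lt1.
have mn := measurable_laplace_norm eta mg.
have mw : measurable_fun Hl (fun x => (lweight mu x)%:E * laplace_norm eta (g x))%E.
  apply: emeasurable_funM; last exact: mn.
  by apply/measurable_EFinP; exact: measurable_lweight.
apply: (@le_lt_trans _ _ (\int[leb]_(x in Hl)
  (c%:E * ((lweight mu x)%:E * laplace_norm eta (g x))))%E); last first.
  rewrite ge0_integralZl_EFin//.
  - by rewrite finite_norm -EFinM ltry.
  - by move=> x _; rewrite mule_ge0 ?lee_fin ?lweight_ge0 ?laplace_norm_ge0.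
apply: ge0_le_integral.
- exact: measurable_itv.
- by move=> x _; rewrite mule_ge0 ?lee_fin ?lweight_ge0 ?laplace_norm_ge0.
- apply: emeasurable_funM; last exact: (measurable_laplace_norm eta mLg).
  by apply/measurable_EFinP; exact: measurable_lweight.
- by apply: emeasurable_funM; [exact: measurable_cst|exact: mw].
- move=> x /=; rewrite in_itv/= andbT => x0.
  rewrite muleCA; apply: lee_wpmul2l; first by rewrite lee_fin lweight_ge0.
  rewrite EFinM -muleA.
  exact: (laplace_norm_frac_difference hk hlam ha eta0 (quadrant_measurable_slice mg x0)).
Qed.

(** The one-variable rule asks for convergence of the transform of [g x], which holds for almost
    every x; the outer integral ignores the others. *)
Lemma laplace2_frac_difference :
  laplace2 (fun x => frac_difference lam a (g x)) mu eta =
  jump_exponent lam eta `^ a * laplace2 g mu eta.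
Proof.
rewrite laplace2_density /laplace2 laplaceE.
transitivity (fine (\int[leb]_(x in Hl)
    (jump_exponent lam eta `^ a * (lweight mu x * laplace (g x) eta))%:E)%E); last first.
  rewrite ge0_integralZl_fun.
  - by rewrite integral_laplace_density.
  - exact: measurable_itv.
  - by apply: measurable_lweightM; exact: measurable_laplace.
  - move=> x /=; rewrite in_itv/= andbT => x0.
    by rewrite mulr_ge0 ?lweight_ge0 ?laplace_density_ge0.
  - exact: powR_ge0.
congr fine; apply: ae_eq_integral.
- exact: measurable_itv.
- apply/measurable_EFinP; apply: measurable_lweightM.
  exact: (measurable_laplace eta mLg).
- apply/measurable_EFinP; apply: measurable_funM; first exact: measurable_cst.
  by apply: measurable_lweightM; exact: measurable_laplace.
apply: (@filterS _ _ (ae_filter_ringOfSetsType leb) _ _ _ finite_ae) => x fx Hx.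
have x0 : 0 <= x by move: Hx; rewrite /= in_itv/= andbT.
have cgx : laplace_converges (g x) eta.
  apply/laplace_convergesP; split; first exact: (quadrant_measurable_slice mg x0).
  by rewrite -ge0_fin_numE ?fx// laplace_norm_ge0.
have [_ ->] := laplace_frac_difference hk hlam ha eta0 cgx.
by rewrite (jump_exponentE hk hlam) mulrCA.
Qed.

End Density.

(* The first conclusion concerns the density g of the inverse process; the
   second one its law, which need not have a density (alpha = 1 and b > 0). *)
Theorem theorem3p3 (R : realType) (d : measure_display) (T : measurableType d)
    (P : probability T R) (alpha gamma b : R) (k : nat) (lam : 'I_k -> R)
    (M : R -> T -> nat) (Dgamma Dalpha : R -> T -> R)
    (halpha : 0 < alpha <= 1) (hgamma : 0 < gamma <= 1) (hb : 0 <= b)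
    (hk : (1 <= k)%N) (hlam : forall j, 0 < lam j)
    (hM : generalized_counting_process P lam M)
    (hDgamma : stable_subordinator P gamma Dgamma)
    (hDalpha : stable_subordinator P alpha Dalpha)
    (hindep : independent_processes3 P (fun t w => (M t w)%:R) Dgamma Dalpha) :
  let H := first_passage (time_changed_gcp b M Dgamma Dalpha) in
  (forall g : R -> R -> R, is_density P H g ->
     solves_ibvp b alpha gamma lam \d_(0 : R) (boundary_value lam gamma) g) /\
  solves_ibvp_measure b alpha gamma lam \d_(0 : R) (boundary_value lam gamma)
    (fun t => pushforward P (H t)).
Proof.
move=> H; split; last first.
  exact: (inverse_process_measure halpha hgamma hb hk hlam hM hDgamma hDalpha hindep).
move=> g dens mu eta mu0 eta0 Lw.
have mX := time_changed_measurable b halpha hgamma hM hDgamma hDalpha.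
have cX := @time_changed_right_continuous _ _ _ _ _ _ b _ _ _ _ _ halpha hgamma hM hDgamma hDalpha.
have mH t : measurable_fun setT (H t) by exact: (measurable_first_passage mX cX).
have H0 t w : 0 <= H t w by exact: first_passage_ge0.
have [cwx wxE] := time_changed_passage_laplace halpha hgamma hb hk hlam hM hDgamma
  hDalpha hindep mu0 eta0.
have [cb bE] := laplace_boundary_value hk hlam hgamma eta0.
(* The double transform of the density is that of the law, so both conclusions end in the same
   identity between images. *)
have FE := laplace2_density mH H0 dens mu0 cwx.
split=> //.
- exact: (laplace2_converges_density mH H0 dens mu0 cwx).
- exact: (laplace2_converges_frac_difference mH H0 dens mu0 cwx hk hlam hgamma eta0).
rewrite bE (laplace2_frac_difference mH H0 dens mu0 cwx hk hlam hgamma eta0).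
by apply: (laplace_image_equation hb hk hlam mu0 eta0); rewrite FE.
Qed.
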